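(* Let $b\in H^\infty(\mathbb{D})$ with $\|b\|_\infty\le 1$. Then the polynomials are dense in $\mathcal{A}(b)$.
   Context: $\mathbb{D}$ is the open unit disk in $\mathbb{C}$, $dA$ is normalized Lebesgue area measure on $\mathbb{D}$, and $H^\infty(\mathbb{D})$ is the space of bounded analytic functions on $\mathbb{D}$ with the supremum norm $\|\cdot\|_\infty$. The Bergman space $A^2$ is the closed subspace of analytic functions in $L^2(\mathbb{D},dA)$, and $\widetilde P$ is the orthogonal projection of $L^2(\mathbb{D},dA)$ onto $A^2$. For $u\in L^\infty(\mathbb{D})$, the Bergman Toeplitz operator $\widetilde T_u$ on $A^2$ is $\widetilde T_u h=\widetilde P(uh)$. For a bounded operator $A$ on a Hilbert space $H$, the range space is $\mathcal{M}(A)=AH$ with inner product $\langle Af,Ag\rangle_{\mathcal{M}(A)}=\langle f,g\rangle_H$ for $f,g\in H\ominus\operatorname{Ker}A$. For $b\in H^\infty(\mathbb{D})$ with $\|b\|_\infty\le 1$, the sub-Bergman Hilbert space $\mathcal{A}(b)$ is the range space $\mathcal{M}\big((I-\widetilde T_b\widetilde T_{\bar b})^{1/2}\big)=(I-\widetilde T_b\widetilde T_{\bar b})^{1/2}A^2$ with its range-space inner product and norm; density is with respect to this norm. Polynomials are analytic polynomials in $z$. *)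

(* Defs.v *)
From mathcomp Require Import all_boot all_order all_algebra.
From mathcomp Require Import complex.
From mathcomp Require Import all_classical all_reals all_analysis.

Set Implicit Arguments.
Unset Strict Implicit.
Unset Printing Implicit Defensive.

Import Order.TTheory GRing.Theory Num.Theory.
Import numFieldNormedType.Exports.
Import ComplexField.

Local Open Scope classical_set_scope.
Local Open Scope complex_scope.
Local Open Scope ring_scope.

(* A complex Hilbert space is given by its carrier H, a subset of an ambient  *)
(* vector space E, and its inner product dot, linear in the first argument.   *)
(* Operators on H are functions E -> E, of which only the values on H matter. *)
Section HilbertOperators.
Context {R : realType} {E : lmodType R[i]}.
Variables (H : set E) (dot : E -> E -> R[i]).

Definition hnorm (f : E) : R := Num.sqrt (complex.Re (dot f f)).

Definition bounded_operator (A : E -> E) : Prop :=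
  [/\ forall f, H f -> H (A f),
      forall (c : R[i]) f g, H f -> H g -> A (c *: f + g) = c *: A f + A g
    & exists M : R, forall f, H f -> hnorm (A f) <= M * hnorm f].

(* In R[i], 0 <= w means that w is real and nonnegative. *)
Definition positive_operator (A : E -> E) : Prop :=
  bounded_operator A /\ forall f, H f -> 0 <= dot (A f) f.

Definition op_sqrt (A : E -> E) : E -> E :=
  xget (idfun : E -> E) [set S | positive_operator S /\ forall f, H f -> S (S f) = A f].

Definition op_ker (A : E -> E) : set E := [set f | H f /\ A f = 0].

Definition ortho_compl (N : set E) : set E :=
  [set f | H f /\ forall g, N g -> dot f g = 0].

Definition range_space (A : E -> E) : set E := A @` H.

(* The representative in H (-) Ker A of an element of the range space A H. *)
Definition range_lift (A : E -> E) (x : E) : E :=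
  xget 0 [set f | ortho_compl (op_ker A) f /\ A f = x].

Definition range_dot (A : E -> E) (x y : E) : R[i] :=
  dot (range_lift A x) (range_lift A y).

Definition range_norm (A : E -> E) (x : E) : R :=
  Num.sqrt (complex.Re (range_dot A x x)).

End HilbertOperators.

Section Bergman.
Context {R : realType}.
Local Notation C := R[i].
Local Notation E := (C -> C^o).

Definition unit_disk : set C := [set z | Normc.normc z < 1].

Local Notation R2 := (measurableTypeR R * measurableTypeR R)%type.

Definition plane (p : R2) : C := (p.1 : R) +i* (p.2 : R).

Definition plane_disk : set R2 := plane @^-1` unit_disk.

Lemma invpi_ge0 : 0 <= (pi : R)^-1.
Proof. by rewrite invr_ge0 pi_ge0. Qed.

(* Normalized area measure: the unit disk has measure 1. *)
Definition dA : {measure set R2 -> \bar R} :=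
  mscale (NngNum invpi_ge0) (@lebesgue_measure R \x @lebesgue_measure R)%E.

Definition area_integral (f : E) : C :=
  (\int[dA]_(p in plane_disk) complex.Re (f (plane p)))
  +i* (\int[dA]_(p in plane_disk) complex.Im (f (plane p))).

Definition L2 (f : E) : Prop :=
  [/\ measurable_fun plane_disk (fun p => complex.Re (f (plane p))),
      measurable_fun plane_disk (fun p => complex.Im (f (plane p)))
    & (\int[dA]_(p in plane_disk) (Normc.normc (f (plane p)) ^+ 2)%:E < +oo)%E].

Definition L2dot (f g : E) : C := area_integral (fun z => f z * (g z)^*).

(* Every point of the disk has a neighbourhood on which f is the sum of a     *)
(* convergent power series.                                                   *)
Definition analytic_on_disk (f : E) : Prop :=
  forall z0, unit_disk z0 ->
  exists (a : nat -> C) (r : R), 0 < r /\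
  forall z, Normc.normc (z - z0) < r ->
    (series (fun k => a k * (z - z0) ^+ k) : nat -> C^o) @ \oo --> f z.

(* Functions on the disk are represented by their extension by 0 to C, so     *)
(* that equality of functions on the disk is Leibniz equality.                *)
Definition bergman : set E :=
  [set f | [/\ analytic_on_disk f, L2 f & forall z, ~ unit_disk z -> f z = 0]].

Definition bergman_proj (g : E) : E :=
  xget 0 [set p | bergman p /\ forall q, bergman q -> L2dot (g - p) q = 0].

Definition toeplitz (u : E) (h : E) : E := bergman_proj (fun z => u z * h z).

Definition Hinf (b : E) : Prop :=
  analytic_on_disk b /\
  exists M : R, forall z, unit_disk z -> Normc.normc (b z) <= M.

Definition Hinf_norm (b : E) : R := sup [set Normc.normc (b z) | z in unit_disk].

Definition defect_sqrt (b : E) : E -> E :=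
  op_sqrt bergman L2dot
    (fun f => f - toeplitz b (toeplitz (fun z => (b z)^*) f)).

Definition sub_bergman (b : E) : set E := range_space bergman (defect_sqrt b).

Definition sub_bergman_norm (b : E) (f : E) : R :=
  range_norm bergman L2dot (defect_sqrt b) f.

Definition poly_on_disk (p : {poly C}) : E :=
  fun z => if Normc.normc z < 1 then p.[z] else 0.

End Bergman.

(* Main.v *)
(* Let T denote T_b on A^2, D = I - T T^* and S = D^{1/2}.  The inclusion J of
   the Hardy space H^2 into A^2 satisfies J J^* = I - T_z T_z^*, so D is the
   sum over j of T_z^j J E J^* T_z^{*j}, where E is I - T_b T_b^* on H^2.
   Moreover E >= k k^* with k = 1 - conj(b(0)) b; summing over j gives
   sum_j |<f, z^j k>|^2 <= <D f, f>, and since T_b is a contraction of H^2 the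
   left side is at least (1 - |b(0)|)^2 ||J^* f||^2.  Hence, if |b(0)| < 1,
   every x in H^2 satisfies |<x, f>| <= C ||x||_{H^2} ||S f||, so by Douglas'
   lemma H^2 embeds boundedly in A(b).  Now D maps polynomials to bounded
   functions (T^* preserves polynomials), which are limits of polynomials in
   H^2, and D(polynomials) is dense in A(b).  If |b(0)| = 1, b is constant and
   A(b) = 0. *)

Require Import Defs.
From mathcomp Require Import all_boot all_order all_algebra.
From mathcomp Require Import complex.
From mathcomp Require Import all_classical all_reals all_analysis.
From mathcomp Require Import measurable_realfun.
From mathcomp Require Import ring lra.

Set Implicit Arguments.
Unset Strict Implicit.
Unset Printing Implicit Defensive.

Import Order.TTheory GRing.Theory Num.Theory.
Import numFieldNormedType.Exports.

Local Open Scope classical_set_scope.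
Local Open Scope complex_scope.
Local Open Scope ring_scope.

(** Neither H^2 nor operators on it are formed. The element J^* f is the sequence of the <f, z^n>,
    which makes sense for every f in L^2, and H^2 norms are bounds on finite sums of squares. The
    factorization I - T_z T_z^* = J J^* turns into a count: there are m + 1 pairs (n, j) with n + j
    = m, and m + 1 is the weight of z^m. The obstacle is that analyticity is given by local power
    series, whereas coefficients at 0 are needed in the whole disk. The orthogonality of the
    monomials on disks, proved by Green's formula on slices, takes the place of Cauchy's formula; it
    bounds coefficients, and the radius of the series at 0 is enlarged step by step. At the end
    nothing is estimated in A(b) directly. S g minus a polynomial is a sum of three terms x with
    |<x, f>| <= d ||S f|| for all f in A^2, and Douglas' lemma gives a preimage of small norm. One
    of them comes from replacing g by S q: g may be far from the range of S, but g - S q can be made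
    almost orthogonal to it. *)

Local Notation normc := ComplexField.Normc.normc.
Local Notation Re := complex.Re.
Local Notation Im := complex.Im.

(** * Complex-valued integrals *)

Section ComplexFacts.
Context {R : realType}.
Implicit Types (z w : R[i]) (x : R).

Lemma cReD z w : Re (z + w) = Re z + Re w.
Proof. by case: z w => [a b] [c d]. Qed.
Lemma cImD z w : Im (z + w) = Im z + Im w.
Proof. by case: z w => [a b] [c d]. Qed.
Lemma cReN z : Re (- z) = - Re z. Proof. by case: z. Qed.
Lemma cImN z : Im (- z) = - Im z. Proof. by case: z. Qed.
Lemma cReM z w : Re (z * w) = Re z * Re w - Im z * Im w.
Proof. by case: z w => [a b] [c d]. Qed.
Lemma cImM z w : Im (z * w) = Re z * Im w + Im z * Re w.
Proof. by case: z w => [a b] [c d]. Qed.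
Lemma cReJ z : Re z^* = Re z. Proof. by case: z. Qed.
Lemma cImJ z : Im z^* = - Im z. Proof. by case: z. Qed.
Lemma cReC x : Re x%:C = x. Proof. by []. Qed.
Lemma cImC x : Im x%:C = 0. Proof. by []. Qed.

Lemma cReE x (y : R) : Re (x +i* y) = x. Proof. by []. Qed.
Lemma cImE x (y : R) : Im (x +i* y) = y. Proof. by []. Qed.

Definition ReImE := (cReE, cImE, cReD, cImD, cReN, cImN, cReM, cImM, cReJ, cImJ, cReC, cImC).

Lemma complex_ext z w : Re z = Re w -> Im z = Im w -> z = w.
Proof. by case: z w => [a b] [c d] /= -> ->. Qed.

Lemma conjc_invol z : z^*^* = z. Proof. exact: conjcK. Qed.
Lemma conjcD z w : (z + w)^* = z^* + w^*. Proof. exact: rmorphD. Qed.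
Lemma conjcB z w : (z - w)^* = z^* - w^*. Proof. exact: rmorphB. Qed.
Lemma conjcN z : (- z)^* = - z^*. Proof. exact: rmorphN. Qed.
Lemma conjcM z w : (z * w)^* = z^* * w^*. Proof. exact: rmorphM. Qed.
Lemma conjcX z n : (z ^+ n)^* = z^* ^+ n. Proof. exact: rmorphXn. Qed.
Lemma conjc_sum I (r : seq I) (P : pred I) (F : I -> R[i]) :
  (\sum_(i <- r | P i) F i)^* = \sum_(i <- r | P i) (F i)^*.
Proof. exact: rmorph_sum. Qed.

Lemma normc_sqr z : normc z ^+ 2 = Re z ^+ 2 + Im z ^+ 2.
Proof. by case: z => a b /=; rewrite sqr_sqrtr// addr_ge0 ?sqr_ge0. Qed.

Lemma normc_ge0 z : 0 <= normc z.
Proof. by case: z => a b /=; rewrite sqrtr_ge0. Qed.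

Lemma normcM z w : normc (z * w) = normc z * normc w.
Proof. exact: ComplexField.Normc.normcM. Qed.

Lemma normcD z w : normc (z + w) <= normc z + normc w.
Proof. exact: le_normcD. Qed.

Lemma normcN z : normc (- z) = normc z.
Proof. exact: normcN. Qed.

Lemma normcB z w : normc (z - w) = normc (w - z).
Proof. by rewrite -normcN opprB. Qed.

Lemma normc0 : normc (0 : R[i]) = 0. Proof. exact: ComplexField.Normc.normc0. Qed.
Lemma normc1 : normc (1 : R[i]) = 1. Proof. exact: ComplexField.Normc.normc1. Qed.

Lemma normc_eq0 z : (normc z == 0) = (z == 0).
Proof.
apply/eqP/eqP => [|->]; [exact: ComplexField.Normc.eq0_normc|exact: normc0].
Qed.

Lemma normcJ z : normc z^* = normc z.
Proof. by case: z => a b /=; rewrite sqrrN. Qed.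

Lemma normcC x : normc x%:C = `|x|.
Proof. by rewrite /= expr0n/= addr0 sqrtr_sqr. Qed.

Lemma normcX z n : normc (z ^+ n) = normc z ^+ n.
Proof. by elim: n => [|n ih]; rewrite ?normc1// !exprS normcM ih. Qed.

Lemma normc_sum I (r : seq I) (P : pred I) (F : I -> R[i]) :
  normc (\sum_(i <- r | P i) F i) <= \sum_(i <- r | P i) normc (F i).
Proof.
elim/big_rec2: _ => [|i y1 y2 _ h]; first by rewrite normc0.
by apply: le_trans (normcD _ _) _; rewrite lerD2l.
Qed.

Lemma normc_Re z : `|Re z| <= normc z.
Proof. by case: z => a b /=; rewrite -sqrtr_sqr ler_wsqrtr// lerDl sqr_ge0. Qed.

Lemma normc_Im z : `|Im z| <= normc z.
Proof. by case: z => a b /=; rewrite -sqrtr_sqr ler_wsqrtr// lerDr sqr_ge0. Qed.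

Lemma normc_le_ReIm z : normc z <= `|Re z| + `|Im z|.
Proof.
rewrite -ler_sqr ?nnegrE ?normc_ge0 ?addr_ge0// normc_sqr sqrrD !real_normK ?num_real//.
by rewrite lerD2r lerDl mulrn_wge0// mulr_ge0.
Qed.

Lemma mulcJ z : z * z^* = (normc z ^+ 2)%:C.
Proof. by apply: complex_ext; rewrite !ReImE ?normc_sqr; ring. Qed.

Lemma normc_le_sub z w : normc z - normc w <= normc (z - w).
Proof. by rewrite lerBlDr -{1}(subrK w z) normcD. Qed.

Lemma normc_lt_sqr z x : 0 <= x -> (normc z < x) = (Re z ^+ 2 + Im z ^+ 2 < x ^+ 2).
Proof. by move=> x0; rewrite -normc_sqr ltr_sqr// nnegrE normc_ge0. Qed.

End ComplexFacts.

Section ComplexIntegral.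
Context d (T : measurableType d) (R : realType).
Variable mu : {measure set T -> \bar R}.
Implicit Types (D : set T) (f g : T -> R[i]).

Definition cmeas D f :=
  measurable_fun D (fun x => Re (f x)) /\ measurable_fun D (fun x => Im (f x)).

Lemma cmeas_cst D c : cmeas D (fun=> c).
Proof. by split; exact: measurable_cst. Qed.

Lemma cmeasD D f g : cmeas D f -> cmeas D g -> cmeas D (fun x => f x + g x).
Proof.
move=> [f1 f2] [g1 g2]; split.
- by under eq_fun do rewrite cReD; exact: measurable_funD.
- by under eq_fun do rewrite cImD; exact: measurable_funD.
Qed.

Lemma cmeasM D f g : cmeas D f -> cmeas D g -> cmeas D (fun x => f x * g x).
Proof.
move=> [f1 f2] [g1 g2]; split.
- under eq_fun do rewrite cReM.
  by apply: measurable_funB; exact: measurable_funM.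
- under eq_fun do rewrite cImM.
  by apply: measurable_funD; exact: measurable_funM.
Qed.

Lemma cmeasJ D f : cmeas D f -> cmeas D (fun x => (f x)^*).
Proof.
move=> [f1 f2]; split; first by under eq_fun do rewrite cReJ.
under eq_fun do rewrite cImJ.
exact: (@measurableT_comp _ _ _ _ _ _ (@GRing.opp R)).
Qed.

Lemma cmeasX D f n : cmeas D f -> cmeas D (fun x => f x ^+ n).
Proof.
move=> mf; elim: n => [|n ih]; first exact: cmeas_cst.
by under eq_fun do rewrite exprS; exact: cmeasM.
Qed.

Lemma cmeas_sum D I (r : seq I) (F : I -> T -> R[i]) :
  (forall i, cmeas D (F i)) -> cmeas D (fun x => \sum_(i <- r) F i x).
Proof.
move=> mF; elim: r => [|i r ih].
  by under eq_fun do rewrite big_nil; exact: cmeas_cst.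
by under eq_fun do rewrite big_cons; exact: cmeasD.
Qed.

Lemma eq_cmeas D f g : (forall x, D x -> f x = g x) -> cmeas D f -> cmeas D g.
Proof.
move=> fg [f1 f2]; split.
- by apply: eq_measurable_fun f1 => x /set_mem /fg ->.
- by apply: eq_measurable_fun f2 => x /set_mem /fg ->.
Qed.

Lemma cmeasS D E f : measurable E -> D `<=` E -> cmeas E f -> cmeas D f.
Proof. by move=> mE DE [f1 f2]; split; exact: measurable_funS DE _. Qed.

Lemma cmeas_normc2 D f : cmeas D f -> measurable_fun D (fun x => normc (f x) ^+ 2).
Proof.
move=> [f1 f2]; under eq_fun do rewrite normc_sqr.
by apply: measurable_funD; exact: measurable_funX.
Qed.

Definition cintegrable D f :=
  mu.-integrable D (EFin \o (fun x => Re (f x))) /\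
  mu.-integrable D (EFin \o (fun x => Im (f x))).

(** Same shape as [area_integral], so that [L2dot] unfolds to a [cint] over [plane_disk] and the
    lemmas below apply to it by conversion. *)
Definition cint D f : R[i] :=
  (\int[mu]_(x in D) Re (f x)) +i* (\int[mu]_(x in D) Im (f x)).

Lemma eq_cint D f g : (forall x, D x -> f x = g x) -> cint D f = cint D g.
Proof.
by move=> fg; congr (_ +i* _); apply: eq_Rintegral => x /set_mem /fg ->.
Qed.

Lemma eq_cintegrable D f g : measurable D -> (forall x, D x -> f x = g x) ->
  cintegrable D f -> cintegrable D g.
Proof.
move=> mD fg [f1 f2]; split.
- by apply: eq_integrable f1 => // x /set_mem /fg /= ->.
- by apply: eq_integrable f2 => // x /set_mem /fg /= ->.
Qed.

Lemma cintegrableD D f g : measurable D -> cintegrable D f -> cintegrable D g ->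
  cintegrable D (fun x => f x + g x).
Proof.
move=> mD [f1 f2] [g1 g2]; split.
- apply: eq_integrable (integrableD mD f1 g1) => // x _.
  by rewrite /= cReD EFinD.
- apply: eq_integrable (integrableD mD f2 g2) => // x _.
  by rewrite /= cImD EFinD.
Qed.

Lemma cintD D f g : measurable D -> cintegrable D f -> cintegrable D g ->
  cint D (fun x => f x + g x) = cint D f + cint D g.
Proof.
move=> mD [f1 f2] [g1 g2]; apply: complex_ext.
- by rewrite cReD /= -RintegralD//; apply: eq_Rintegral => x _; rewrite cReD.
- by rewrite cImD /= -RintegralD//; apply: eq_Rintegral => x _; rewrite cImD.
Qed.

Lemma cintegrableZ D f c : measurable D -> cintegrable D f ->
  cintegrable D (fun x => c * f x).
Proof.
move=> mD [f1 f2]; split.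
- apply: eq_integrable (integrableD mD (integrableZl mD (Re c) f1)
    (integrableZl mD (- Im c) f2)) => // x _.
  by rewrite /= cReM -!EFinM -EFinD mulNr.
- apply: eq_integrable (integrableD mD (integrableZl mD (Re c) f2)
    (integrableZl mD (Im c) f1)) => // x _.
  by rewrite /= cImM -!EFinM -EFinD.
Qed.

Lemma cintZ D f c : measurable D -> cintegrable D f ->
  cint D (fun x => c * f x) = c * cint D f.
Proof.
move=> mD [f1 f2].
have h (a : R) (g : T -> R) : mu.-integrable D (EFin \o g) ->
    mu.-integrable D (EFin \o (fun x => a * g x)).
  by move=> ig; apply: eq_integrable (integrableZl mD a ig).
apply: complex_ext; rewrite ?cReM ?cImM /=.
- rewrite -!RintegralZl// -RintegralB//; [|exact: h|exact: h].
  by apply: eq_Rintegral => x _; rewrite cReM.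
- rewrite -!RintegralZl// -RintegralD//; [|exact: h|exact: h].
  by apply: eq_Rintegral => x _; rewrite cImM.
Qed.

Lemma cintJ D f : measurable D -> cintegrable D f ->
  cint D (fun x => (f x)^*) = (cint D f)^*.
Proof.
move=> mD [f1 f2]; apply: complex_ext => /=.
- by apply: eq_Rintegral => x _; rewrite cReJ.
- rewrite -mulN1r -RintegralZl//.
  by apply: eq_Rintegral => x _; rewrite cImJ mulN1r.
Qed.

Lemma cint0 D : cint D (fun=> 0) = 0.
Proof.
by apply: complex_ext; rewrite /= /Rintegral integral0_eq.
Qed.

Lemma cintegrable0 D : measurable D -> cintegrable D (fun=> 0).
Proof. by move=> mD; split; exact: integrable0. Qed.

Lemma cintegrable_sum D I (r : seq I) (F : I -> T -> R[i]) : measurable D ->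
  (forall i, cintegrable D (F i)) -> cintegrable D (fun x => \sum_(i <- r) F i x).
Proof.
move=> mD iF; elim: r => [|i r ih].
  apply: eq_cintegrable (cintegrable0 mD) => // x _; by rewrite big_nil.
apply: eq_cintegrable (cintegrableD mD (iF i) ih) => // x _.
by rewrite big_cons.
Qed.

Lemma cint_sum D I (r : seq I) (F : I -> T -> R[i]) : measurable D ->
  (forall i, cintegrable D (F i)) ->
  cint D (fun x => \sum_(i <- r) F i x) = \sum_(i <- r) cint D (F i).
Proof.
move=> mD iF; elim: r => [|i r ih].
  by rewrite big_nil -[RHS](cint0 D); apply: eq_cint => x _; rewrite big_nil.
rewrite big_cons -ih -cintD//; last exact: cintegrable_sum.
by apply: eq_cint => x _; rewrite big_cons.
Qed.

Lemma cintegrable_bounded D f (B : R) : measurable D -> (mu D < +oo)%E ->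
  cmeas D f -> (forall x, D x -> normc (f x) <= B) -> cintegrable D f.
Proof.
move=> mD fD [f1 f2] fB; split; apply: measurable_bounded_integrable => //.
- exists B; split; rewrite ?num_real// => x Bx y Dy /=.
  apply: le_trans (normc_Re _) _; exact: le_trans (fB _ Dy) (ltW Bx).
- exists B; split; rewrite ?num_real// => x Bx y Dy /=.
  apply: le_trans (normc_Im _) _; exact: le_trans (fB _ Dy) (ltW Bx).
Qed.

Lemma cint_normc2 D f :
  cint D (fun x => f x * (f x)^*) = (\int[mu]_(x in D) normc (f x) ^+ 2)%:C.
Proof.
apply: complex_ext => /=.
- by apply: eq_Rintegral => x _; rewrite mulcJ.
- rewrite [LHS](_ : _ = \int[mu]_(x in D) 0); last first.
    by apply: eq_Rintegral => x _; rewrite mulcJ.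
  by rewrite /Rintegral integral0_eq.
Qed.

End ComplexIntegral.

(** * Moments of the disk *)

Section Green.
Context {R : realType}.
Local Notation R2 := (measurableTypeR R * measurableTypeR R)%type.
Local Notation leb := (@lebesgue_measure R).

(** Squares instead of [normc] make this a sublevel set of a polynomial, whose slices are visibly
    intervals; [diskE] is the bridge. *)
Definition disk (r : R) : set R2 := [set p | p.1 ^+ 2 + p.2 ^+ 2 < r ^+ 2].

Lemma measurable_disk r : measurable (disk r).
Proof.
have -> : disk r = setT `&` (fun p : R2 => (p.1 : R) ^+ 2 + (p.2 : R) ^+ 2) @^-1` `]-oo, r ^+ 2[.
  by apply/seteqP; split => p /=; rewrite in_itv/= => //; case.
have m : measurable_fun [set: R2] (fun p : R2 => (p.1 : R) ^+ 2 + (p.2 : R) ^+ 2).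
  apply: measurable_funD; apply: measurable_funX; [exact: measurable_fst|exact: measurable_snd].
exact: m.
Qed.

Lemma disk_sub_square r : 0 <= r -> disk r `<=` `[- r, r] `*` `[- r, r].
Proof.
move=> r0 [x y] /= h; split => /=; rewrite in_itv/= -ler_norml.
- rewrite -ler_sqr ?nnegrE// real_normK ?num_real//.
  by apply: le_trans (ltW h); rewrite lerDl sqr_ge0.
- rewrite -ler_sqr ?nnegrE// real_normK ?num_real//.
  by apply: le_trans (ltW h); rewrite lerDr sqr_ge0.
Qed.

Lemma leb_disk_lty r : 0 <= r -> ((leb \x leb)%E (disk r) < +oo)%E.
Proof.
move=> r0.
apply: (@le_lt_trans _ _ ((leb \x leb)%E (`[- r, r]%classic `*` `[- r, r]%classic))).
  apply: le_measure; rewrite ?inE//.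
  - exact: measurable_disk.
  - by apply: measurableX; exact: measurable_itv.
  - exact: disk_sub_square.
rewrite product_measure1E; [|exact: measurable_itv|exact: measurable_itv].
by rewrite /= !lebesgue_measure_itv; case: ifP => _; rewrite -?EFinB -?EFinM ltry.
Qed.

Lemma leb_disk_gt0 r : 0 < r -> (0 < (leb \x leb)%E (disk r))%E.
Proof.
move=> r0; pose h := r / 2.
apply: (@lt_le_trans _ _ ((leb \x leb)%E (`[0, h]%classic `*` `[0, h]%classic))).
  rewrite product_measure1E; [|exact: measurable_itv|exact: measurable_itv].
  rewrite /= !lebesgue_measure_itv/= lte_fin /h divr_gt0//.
  by rewrite oppr0 adde0 -EFinM lte_fin mulr_gt0// divr_gt0.
apply: le_measure; rewrite ?inE//.
- by apply: measurableX; exact: measurable_itv.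
- exact: measurable_disk.
- move=> [x y] [/=]; rewrite !in_itv/= => /andP[x0 xh] /andP[y0 yh].
  rewrite /disk/=.
  have hx : x ^+ 2 <= h ^+ 2 by rewrite ler_sqr ?nnegrE// (le_trans x0).
  have hy : y ^+ 2 <= h ^+ 2 by rewrite ler_sqr ?nnegrE// (le_trans x0).
  have : 0 < r ^+ 2 by rewrite exprn_gt0.
  by move: hx hy; rewrite /h expr_div_n; lra.
Qed.

Lemma integral_deriv_poly0 (p : {poly R}) (s : R) : 0 < s ->
  p.[s] = 0 -> p.[- s] = 0 -> (\int[leb]_(x in `](- s)%R, s[) (p^`().[x])%:E = 0)%E.
Proof.
move=> s0 ps pns.
have mp (A : set (measurableTypeR R)) (q : {poly R}) : measurable_fun A (fun x => (q.[x])%:E).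
  by apply/measurable_EFinP; exact: measurable_poly.
rewrite -(@integral_itv_bndoo R (- s) s (fun x => (p^`().[x])%:E) true false); last exact: mp.
rewrite (@continuous_FTC2 _ _ (horner p)).
- by rewrite ps pns subee.
- by rewrite gtrN.
- by apply: continuous_subspaceT; exact: continuous_horner.
- split=> [x _| |].
  + exact: derivable_horner.
  + by apply: cvg_at_right_filter; exact: continuous_horner.
  + by apply: cvg_at_left_filter; exact: continuous_horner.
- by move=> x _; rewrite derivE.
Qed.

(** The slice at height y is empty or the interval ]-s, s[ with s^2 = r^2 - y^2. Its ends lie on the
    circle, where p vanishes, so the fundamental theorem of calculus gives 0. *)
Lemma slice_integral0 (r y : R) (p : {poly R}) : 0 <= r ->
  (forall x, x ^+ 2 + y ^+ 2 = r ^+ 2 -> p.[x] = 0) ->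
  (\int[leb]_(x in [set x | (x ^+ 2 + y ^+ 2 < r ^+ 2)%R]) (p^`().[x])%:E = 0)%E.
Proof.
move=> r0 p0; have [yr|ry] := ltP (y ^+ 2) (r ^+ 2); last first.
  rewrite (_ : [set x | _] = set0) ?integral_set0//.
  apply/seteqP; split => x //= h; have := sqr_ge0 x.
  by move: h ry; lra.
pose s := Num.sqrt (r ^+ 2 - y ^+ 2).
have s2 : s ^+ 2 = r ^+ 2 - y ^+ 2 by rewrite sqr_sqrtr// subr_ge0 ltW.
have s0 : 0 < s by rewrite sqrtr_gt0 subr_gt0.
rewrite (_ : [set x | _] = `]- s, s[%classic).
  apply: integral_deriv_poly0 => //; apply: p0; rewrite ?sqrrN s2; ring.
apply/seteqP; split => x /=; rewrite in_itv/= -ltr_norml.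
- by move=> h; rewrite -ltr_sqr ?nnegrE ?(ltW s0)// real_normK ?num_real// s2; lra.
- by rewrite -ltr_sqr ?nnegrE ?(ltW s0)// real_normK ?num_real// s2; lra.
Qed.

Lemma disk_integrable r (g : R2 -> R) (B : R) : 0 <= r ->
  measurable_fun (disk r) g -> (forall p, disk r p -> `|g p| <= B) ->
  (leb \x leb)%E.-integrable (disk r) (EFin \o g).
Proof.
move=> r0 mg gB; apply: measurable_bounded_integrable => //.
- exact: measurable_disk.
- exact: leb_disk_lty.
- exists B; split; rewrite ?num_real// => x Bx y Dy /=.
  exact: le_trans (gB _ Dy) (ltW Bx).
Qed.

(** Half of Green's theorem: [P y] is a primitive of g along the line at height y, and Fubini
    integrates slice by slice. The integrand is extended by 0 because the disk is not a product. *)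
Lemma green1 r (P : R -> {poly R}) (g : R2 -> R) (B : R) : 0 <= r ->
  measurable_fun (disk r) g -> (forall p, disk r p -> `|g p| <= B) ->
  (forall p, disk r p -> g p = (P p.2)^`().[p.1]) ->
  (forall x y, x ^+ 2 + y ^+ 2 = r ^+ 2 -> (P y).[x] = 0) ->
  (\int[(leb \x leb)%E]_(p in disk r) (g p)%:E = 0)%E.
Proof.
move=> r0 mg gB gP P0.
have ig := disk_integrable r0 mg gB.
move: (ig); rewrite (integrable_mkcond _ (measurable_disk r)) => iT.
rewrite integral_mkcond -(integral21_prod_meas1 iT).
rewrite integral0_eq// => y _; rewrite /fubini_G.
rewrite -[RHS](slice_integral0 r0 (P0^~ y)) [RHS]integral_mkcond.
apply: eq_integral => x _; rewrite !patchE.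
case: ifPn; rewrite ?inE => h; case: ifPn; rewrite ?inE//.
- by move=> _ /=; rewrite gP.
- by move=> h'; rewrite notin_setE in h'.
- by move=> h'; rewrite notin_setE in h.
Qed.

Lemma green2 r (P : R -> {poly R}) (g : R2 -> R) (B : R) : 0 <= r ->
  measurable_fun (disk r) g -> (forall p, disk r p -> `|g p| <= B) ->
  (forall p, disk r p -> g p = (P p.1)^`().[p.2]) ->
  (forall x y, x ^+ 2 + y ^+ 2 = r ^+ 2 -> (P x).[y] = 0) ->
  (\int[(leb \x leb)%E]_(p in disk r) (g p)%:E = 0)%E.
Proof.
move=> r0 mg gB gP P0.
have ig := disk_integrable r0 mg gB.
move: (ig); rewrite (integrable_mkcond _ (measurable_disk r)) => iT.
rewrite integral_mkcond -(integral12_prod_meas1 iT).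
rewrite integral0_eq// => x _; rewrite /fubini_F.
have P0' y : y ^+ 2 + x ^+ 2 = r ^+ 2 -> (P x).[y] = 0.
  by rewrite addrC; exact: P0.
rewrite -[RHS](slice_integral0 r0 P0') [RHS]integral_mkcond.
apply: eq_integral => y _; rewrite !patchE.
case: ifPn; rewrite ?inE => h; case: ifPn; rewrite ?inE//.
- by move=> _ /=; rewrite gP.
- by move=> h'; rewrite notin_setE/= addrC in h'.
- by move=> h'; rewrite notin_setE/= /disk /= addrC in h.
Qed.

(** The factor 1/pi is pulled out of the positive and the negative part separately; integrability
    keeps their difference from being oo - oo. *)
Lemma integral_dA (D : set R2) (g : R2 -> R) : measurable D ->
  measurable_fun D g -> (\int[(leb \x leb)%E]_(p in D) (g p)%:E = 0)%E ->
  (leb \x leb)%E.-integrable D (EFin \o g) ->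
  \int[@dA R]_(p in D) g p = 0.
Proof.
move=> mD mg g0 ig.
have mg' : measurable_fun D (EFin \o g) by exact/measurable_EFinP.
rewrite /Rintegral integralE /dA !ge0_integral_mscale//.
- rewrite integralE in g0; rewrite -muleBr ?g0 ?mule0//.
  by apply: fin_num_adde_defr; exact: integrable_pos_fin_num.
- by apply: measurable_funeneg.
- by apply: measurable_funepos.
Qed.

End Green.

Section BoundedFunctions.
Context d (T : measurableType d) (R : realType).
Implicit Types (D : set T) (f g : T -> R[i]).

(** Stable under ring operations and conjugation, and enough for integrability on a set of finite
    measure: this settles every polynomial in z and conj(z) on a disk. *)
Definition cbounded D f := cmeas D f /\ exists B : R, forall x, D x -> normc (f x) <= B.

Lemma cbounded_cst D c : cbounded D (fun=> c).
Proof. by split; [exact: cmeas_cst|exists (normc c)]. Qed.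

Lemma cboundedD D f g : cbounded D f -> cbounded D g -> cbounded D (fun x => f x + g x).
Proof.
move=> [mf [A fA]] [mg [B gB]]; split; first exact: cmeasD.
by exists (A + B) => x Dx; apply: le_trans (normcD _ _) _; rewrite lerD ?fA ?gB.
Qed.

Lemma cboundedM D f g : cbounded D f -> cbounded D g -> cbounded D (fun x => f x * g x).
Proof.
move=> [mf [A fA]] [mg [B gB]]; split; first exact: cmeasM.
by exists (A * B) => x Dx; rewrite normcM ler_pM ?normc_ge0 ?fA ?gB.
Qed.

Lemma cboundedN D f : cbounded D f -> cbounded D (fun x => - f x).
Proof.
by move=> /(cboundedM (cbounded_cst D (-1))); under eq_fun do rewrite mulN1r.
Qed.

Lemma cboundedJ D f : cbounded D f -> cbounded D (fun x => (f x)^*).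
Proof.
move=> [mf [A fA]]; split; first exact: cmeasJ.
by exists A => x Dx; rewrite normcJ fA.
Qed.

Lemma cboundedX D f n : cbounded D f -> cbounded D (fun x => f x ^+ n).
Proof.
move=> bf; elim: n => [|n ih]; first exact: cbounded_cst.
by under eq_fun do rewrite exprS; exact: cboundedM.
Qed.

Lemma cboundedMn D f n : cbounded D f -> cbounded D (fun x => f x *+ n).
Proof.
move=> bf; under eq_fun do rewrite -mulr_natr.
by apply: cboundedM => //; exact: cbounded_cst.
Qed.

Lemma cbounded_sum D I (r : seq I) (F : I -> T -> R[i]) :
  (forall i, cbounded D (F i)) -> cbounded D (fun x => \sum_(i <- r) F i x).
Proof.
move=> bF; elim: r => [|i r ih].
  by under eq_fun do rewrite big_nil; exact: cbounded_cst.
by under eq_fun do rewrite big_cons; exact: cboundedD.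
Qed.

Lemma cbounded_integrable (mu : {measure set T -> \bar R}) D f :
  measurable D -> (mu D < +oo)%E -> cbounded D f -> cintegrable mu D f.
Proof. by move=> mD fD [mf [B fB]]; exact: cintegrable_bounded fB. Qed.

End BoundedFunctions.

Section Moments.
Context {R : realType}.
Local Notation R2 := (measurableTypeR R * measurableTypeR R)%type.
Local Notation C := R[i].
Local Notation mu := (@dA R).

Lemma diskE (r : R) (p : R2) : 0 <= r -> disk r p <-> normc (plane p) < r.
Proof.
by move=> r0; rewrite normc_lt_sqr//= /disk.
Qed.

Lemma plane_diskE : @plane_disk R = disk 1.
Proof.
by apply/seteqP; split => p /(diskE p (@ler01 R)).
Qed.

Lemma measurable_plane_disk : measurable (@plane_disk R).
Proof. by rewrite plane_diskE; exact: measurable_disk. Qed.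

Lemma dA_disk_lty (r : R) : 0 <= r -> (mu (disk r) < +oo)%E.
Proof.
move=> r0; rewrite /dA /mscale/= lte_mul_pinfty ?lee_fin ?invpi_ge0//.
exact: leb_disk_lty.
Qed.

(* That disk_area 1 = 1 is never needed, only that it is positive: the theorem
   does not depend on the normalization of the area measure. *)
Definition disk_area (r : R) : R := fine (mu (disk r)).

Lemma disk_area_gt0 (r : R) : 0 < r -> 0 < disk_area r.
Proof.
move=> r0; rewrite fine_gt0// dA_disk_lty ?ltW// andbT /dA /mscale/=.
by rewrite mule_gt0 ?leb_disk_gt0// lte_fin invr_gt0 pi_gt0.
Qed.

Lemma cmeas_plane (D : set R2) : cmeas D (@plane R).
Proof.
by split => /=; apply: measurable_funTS; [exact: measurable_fst|exact: measurable_snd].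
Qed.

Lemma cbounded_plane (r : R) : 0 <= r -> cbounded (disk r) (@plane R).
Proof.
by move=> r0; split; [exact: cmeas_plane|exists r => p /(diskE p r0)/ltW].
Qed.

Lemma cint_dA0 (r : R) (g : R2 -> C) : 0 <= r -> cbounded (disk r) g ->
  (\int[(@lebesgue_measure R \x @lebesgue_measure R)%E]_(p in disk r) (Re (g p))%:E = 0)%E ->
  (\int[(@lebesgue_measure R \x @lebesgue_measure R)%E]_(p in disk r) (Im (g p))%:E = 0)%E ->
  cint mu (disk r) g = 0.
Proof.
move=> r0 [[m1 m2] [B gB]] h1 h2; have mD := measurable_disk r.
apply: complex_ext => /=; apply: integral_dA => //.
- by apply: (@disk_integrable _ _ _ B) => // p Dp; exact: le_trans (normc_Re _) (gB _ Dp).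
- by apply: (@disk_integrable _ _ _ B) => // p Dp; exact: le_trans (normc_Im _) (gB _ Dp).
Qed.

(** Used with f = [Re] or [Im]: at real points it is the real or imaginary part of q, still a
    polynomial, which reduces the complex Green formulas to the real ones. *)
Definition poly_part (f : C -> R) (q : {poly C}) : {poly R} :=
  \poly_(i < size q) f q`_i.

Section PolyPart.
Variable f : C -> R.
Hypothesis fD : forall z w, f (z + w) = f z + f w.
Hypothesis fZ : forall z x, f (z * x%:C) = f z * x.

Let f0 : f 0 = 0.
Proof. by rewrite -(mul0r (0 : R)%:C) fZ mulr0. Qed.

Lemma coef_poly_part q i : (poly_part f q)`_i = f q`_i.
Proof.
by rewrite coef_poly; case: ltnP => // h; rewrite nth_default.
Qed.

Lemma deriv_poly_part q : (poly_part f q)^`() = poly_part f q^`().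
Proof.
apply/polyP => i; rewrite coef_deriv !coef_poly_part coef_deriv.
rewrite -[LHS]mulr_natr -[in RHS]mulr_natr -fZ; congr (f (_ * _)).
by rewrite rmorph_nat.
Qed.

Lemma horner_poly_part q x : (poly_part f q).[x] = f q.[x%:C].
Proof.
rewrite horner_poly horner_coef.
elim/big_rec2: _ => // i y1 y2 _ ->; rewrite fD; congr (_ + _).
by rewrite -rmorphXn fZ.
Qed.

End PolyPart.

Lemma ReZ z (x : R) : Re (z * x%:C) = Re z * x.
Proof. by rewrite cReM cImC mulr0 subr0. Qed.
Lemma ImZ z (x : R) : Im (z * x%:C) = Im z * x.
Proof. by rewrite cImM cImC mulr0 add0r. Qed.

Lemma cgreen1 r (Q : R -> {poly C}) (g : R2 -> C) : 0 <= r ->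
  cbounded (disk r) g ->
  (forall p, disk r p -> g p = (Q p.2)^`().[p.1%:C]) ->
  (forall x y, x ^+ 2 + y ^+ 2 = r ^+ 2 -> (Q y).[x%:C] = 0) ->
  cint mu (disk r) g = 0.
Proof.
move=> r0 bg gQ Q0; case: (bg) => [[m1 m2] [B gB]]; apply: cint_dA0 => //.
- apply: (@green1 _ r (fun y => poly_part (@complex.Re R) (Q y)) (fun p => Re (g p)) B r0) => //.
  + by move=> p Dp; exact: le_trans (normc_Re _) (gB _ Dp).
  + by move=> p Dp; rewrite gQ// (deriv_poly_part ReZ) (horner_poly_part cReD ReZ).
  + by move=> x y xy; rewrite (horner_poly_part cReD ReZ) Q0.
- apply: (@green1 _ r (fun y => poly_part (@complex.Im R) (Q y)) (fun p => Im (g p)) B r0) => //.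
  + by move=> p Dp; exact: le_trans (normc_Im _) (gB _ Dp).
  + by move=> p Dp; rewrite gQ// (deriv_poly_part ImZ) (horner_poly_part cImD ImZ).
  + by move=> x y xy; rewrite (horner_poly_part cImD ImZ) Q0.
Qed.

Lemma cgreen2 r (Q : R -> {poly C}) (g : R2 -> C) : 0 <= r ->
  cbounded (disk r) g ->
  (forall p, disk r p -> g p = (Q p.1)^`().[p.2%:C]) ->
  (forall x y, x ^+ 2 + y ^+ 2 = r ^+ 2 -> (Q x).[y%:C] = 0) ->
  cint mu (disk r) g = 0.
Proof.
move=> r0 bg gQ Q0; case: (bg) => [[m1 m2] [B gB]]; apply: cint_dA0 => //.
- apply: (@green2 _ r (fun y => poly_part (@complex.Re R) (Q y)) (fun p => Re (g p)) B r0) => //.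
  + by move=> p Dp; exact: le_trans (normc_Re _) (gB _ Dp).
  + by move=> p Dp; rewrite gQ// (deriv_poly_part ReZ) (horner_poly_part cReD ReZ).
  + by move=> x y xy; rewrite (horner_poly_part cReD ReZ) Q0.
- apply: (@green2 _ r (fun y => poly_part (@complex.Im R) (Q y)) (fun p => Im (g p)) B r0) => //.
  + by move=> p Dp; exact: le_trans (normc_Im _) (gB _ Dp).
  + by move=> p Dp; rewrite gQ// (deriv_poly_part ImZ) (horner_poly_part cImD ImZ).
  + by move=> x y xy; rewrite (horner_poly_part cImD ImZ) Q0.
Qed.

Definition moment (r : R) (m n : nat) : C :=
  cint mu (disk r) (fun p : R2 => plane p ^+ m * (plane p)^* ^+ n).

Lemma planeE (p : R2) : plane p = p.1%:C + 'i%C * p.2%:C.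
Proof. by apply: complex_ext; rewrite /plane !ReImE; ring. Qed.

Lemma planeJE (p : R2) : (plane p)^* = p.1%:C - 'i%C * p.2%:C.
Proof. by apply: complex_ext; rewrite /plane !ReImE; ring. Qed.

Let bdr (r : R) (p : R2) : C := (r ^+ 2)%:C - plane p * (plane p)^*.

Lemma bdrE r p : bdr r p = (r ^+ 2 - p.1 ^+ 2 - p.2 ^+ 2)%:C.
Proof. by apply: complex_ext; rewrite /plane !ReImE; ring. Qed.

(** [dx] and [dy] are the partial derivatives of z^m conj(z)^n (r^2 - |z|^2). For m = 0 or n = 0 the
    truncated predecessor is harmless, since its term carries the factor 0. *)
Let dx m n r (p : R2) : C := let z := plane p in
  (z ^+ m.-1 * z^* ^+ n *+ m + z ^+ m * z^* ^+ n.-1 *+ n) * bdr r p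
  - z ^+ m * z^* ^+ n * (2 * p.1%:C).

Let dy m n r (p : R2) : C := let z := plane p in
  (z ^+ m.-1 * z^* ^+ n *+ m - z ^+ m * z^* ^+ n.-1 *+ n) * 'i%C * bdr r p
  - z ^+ m * z^* ^+ n * (2 * p.2%:C).

Lemma cbounded_fst r : 0 <= r -> cbounded (disk r) (fun p : R2 => (p.1 : R)%:C).
Proof.
move=> r0; split; last first.
  exists r => p /(diskE p r0)/ltW; apply: le_trans; rewrite normcC; exact: (normc_Re (plane p)).
by split => /=; [apply: measurable_funTS; exact: measurable_fst|exact: measurable_cst].
Qed.

Lemma cbounded_snd r : 0 <= r -> cbounded (disk r) (fun p : R2 => (p.2 : R)%:C).
Proof.
move=> r0; split; last first.
  exists r => p /(diskE p r0)/ltW; apply: le_trans; rewrite normcC; exact: (normc_Im (plane p)).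
by split => /=; [apply: measurable_funTS; exact: measurable_snd|exact: measurable_cst].
Qed.

Lemma cbounded_bdr r : 0 <= r -> cbounded (disk r) (bdr r).
Proof.
move=> r0; apply: cboundedD; first exact: cbounded_cst.
apply: cboundedN; apply: cboundedM; [|apply: cboundedJ]; exact: cbounded_plane.
Qed.

Lemma cbounded_monomial r m n : 0 <= r ->
  cbounded (disk r) (fun p : R2 => plane p ^+ m * (plane p)^* ^+ n).
Proof.
move=> r0; apply: cboundedM; apply: cboundedX; [|apply: cboundedJ]; exact: cbounded_plane.
Qed.

Lemma cbounded_dx m n r : 0 <= r -> cbounded (disk r) (dx m n r).
Proof.
move=> r0; apply: cboundedD.
  apply: cboundedM (cbounded_bdr r0).
  by apply: cboundedD; apply: cboundedMn; exact: cbounded_monomial.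
apply: cboundedN; apply: cboundedM; first exact: cbounded_monomial.
by apply: cboundedM (cbounded_cst _ _) (cbounded_fst r0).
Qed.

Lemma cbounded_dy m n r : 0 <= r -> cbounded (disk r) (dy m n r).
Proof.
move=> r0; apply: cboundedD.
  apply: cboundedM (cbounded_bdr r0); apply: cboundedM (cbounded_cst _ _).
  apply: cboundedD; [|apply: cboundedN]; apply: cboundedMn; exact: cbounded_monomial.
apply: cboundedN; apply: cboundedM; first exact: cbounded_monomial.
by apply: cboundedM (cbounded_cst _ _) (cbounded_snd r0).
Qed.

Lemma cint_dx m n r : 0 <= r -> cint mu (disk r) (dx m n r) = 0.
Proof.
move=> r0.
(* The factors are z, conj(z) and r^2 - |z|^2 at fixed y, as polynomials in x; the last one vanishes
   on the circle. *)
pose Q (y : R) : {poly C} := ('X + ('i%C * y%:C)%:P) ^+ m * ('X - ('i%C * y%:C)%:P) ^+ n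
  * ((r ^+ 2 - y ^+ 2)%:C%:P - 'X ^+ 2).
apply: (@cgreen1 r Q) => //; first exact: cbounded_dx.
- move=> p _; rewrite /Q !(derivM, deriv_exp, derivB, derivD, derivC, derivX, derivXn).
  rewrite !(hornerE, hornerMn, horner_exp) /dx bdrE planeJE planeE.
  by rewrite /= !rmorphB/= !rmorphXn/=; ring.
- move=> x y xy; rewrite /Q !hornerE.
  rewrite (_ : r ^+ 2 - y ^+ 2 = x ^+ 2); last by rewrite -xy addrK.
  by rewrite rmorphXn subrr mulr0.
Qed.

Lemma cint_dy m n r : 0 <= r -> cint mu (disk r) (dy m n r) = 0.
Proof.
move=> r0.
pose Q (x : R) : {poly C} := (x%:C%:P + 'i%C%:P * 'X) ^+ m * (x%:C%:P - 'i%C%:P * 'X) ^+ n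
  * ((r ^+ 2 - x ^+ 2)%:C%:P - 'X ^+ 2).
apply: (@cgreen2 r Q) => //; first exact: cbounded_dy.
- move=> p _; rewrite /Q !(derivM, deriv_exp, derivB, derivD, derivC, derivX, derivXn).
  rewrite !(hornerE, hornerMn, horner_exp) /dy bdrE planeJE planeE.
  by rewrite /= !rmorphB/= !rmorphXn/=; ring.
- move=> x y xy; rewrite /Q !hornerE.
  rewrite (_ : r ^+ 2 - x ^+ 2 = y ^+ 2); last by rewrite -xy addrAC subrr add0r.
  by rewrite rmorphXn subrr mulr0.
Qed.

(** d/dx + i d/dy is twice the d-bar derivative: it annihilates z^m, so only the derivatives of
    conj(z)^n and of r^2 - |z|^2 contribute. *)
Lemma dxdy m n r p : dx m n r p + 'i%C * dy m n r p =
  (2 * n%:R * (r ^+ 2)%:C) * (plane p ^+ m * (plane p)^* ^+ n.-1)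
  + (- 2 * n.+1%:R) * (plane p ^+ m.+1 * (plane p)^* ^+ n).
Proof.
have i2 : 'i%C * 'i%C = -1 :> C by apply: complex_ext; rewrite ?/plane !ReImE; ring.
have px : 2 * (p.1 : R)%:C = plane p + (plane p)^*.
  by rewrite planeJE planeE; ring.
have py : 'i%C * (2 * (p.2 : R)%:C) = plane p - (plane p)^*.
  by rewrite planeJE planeE; ring.
have key (A B M h s u : C) : (A + B) * h - M * s + 'i%C * ((A - B) * 'i%C * h - M * u)
    = 2 * B * h - M * (s + 'i%C * u).
  transitivity ((A + B) * h - M * s + (A - B) * ('i%C * 'i%C) * h - M * ('i%C * u)).
    by ring.
  by rewrite i2; ring.
rewrite /dx /dy /= key px py /bdr.
move: (plane p) (plane p)^* (r ^+ 2)%:C => z w t; rewrite -(mulr_natr _ n).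
case: n => [|n] /=; first by rewrite exprS; ring.
by rewrite !exprS -[in RHS]addn1 natrD; ring.
Qed.

(* Green: the d-bar derivative of z^m zbar^n (r^2 - |z|^2), which vanishes on
   the boundary circle, has integral 0. *)
Lemma moment_rec r m n : 0 <= r ->
  n.+1%:R * moment r m.+1 n = n%:R * (r ^+ 2)%:C * moment r m n.-1.
Proof.
move=> r0; have mD := measurable_disk r; have fD := dA_disk_lty r0.
have im k l : cintegrable mu (disk r) (fun p : R2 => plane p ^+ k * (plane p)^* ^+ l).
  by apply: cbounded_integrable => //; exact: cbounded_monomial.
have : cint mu (disk r) (fun p => dx m n r p + 'i%C * dy m n r p) = 0.
  have iy : cintegrable mu (disk r) (dy m n r).
    by apply: cbounded_integrable => //; exact: cbounded_dy.
  rewrite cintD// ?cintZ// ?cint_dx ?cint_dy ?mulr0 ?addr0//.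
  - by apply: cbounded_integrable => //; exact: cbounded_dx.
  - exact: cintegrableZ.
rewrite (@eq_cint _ _ _ _ _ _ _ (fun p _ => dxdy m n r p)) cintD//; last 2 first.
- exact: cintegrableZ.
- exact: cintegrableZ.
rewrite !cintZ// -/(moment r m n.-1) -/(moment r m.+1 n) => h.
have h2 : (2 : C) != 0 by rewrite pnatr_eq0.
apply: (mulfI h2); move/eqP: h; rewrite addr_eq0 => /eqP h.
by rewrite !mulrA h; ring.
Qed.

Lemma momentJ r m n : 0 <= r -> moment r n m = (moment r m n)^*.
Proof.
move=> r0; have mD := measurable_disk r; have fD := dA_disk_lty r0.
rewrite -cintJ//; last by apply: cbounded_integrable => //; exact: cbounded_monomial.
by apply: eq_cint => p _; rewrite conjcM !conjcX conjc_invol mulrC.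
Qed.

(** The recurrence lowers both exponents together. As n < m, n reaches 0 first, and then the factor
    n on the right-hand side is 0. *)
Lemma moment_gt r m n : 0 <= r -> (n < m)%N -> moment r m n = 0.
Proof.
have nz k : k.+1%:R != 0 :> C by rewrite pnatr_eq0.
move=> r0; elim: n m => [|n ih] [//|m] nm.
- by apply: (mulfI (nz 0%N)); rewrite moment_rec// !mul0r mulr0.
- by apply: (mulfI (nz n.+1)); rewrite moment_rec//= ih// !mulr0.
Qed.

Lemma cint_cst1 (r : R) : cint mu (disk r) (fun=> 1) = (disk_area r)%:C.
Proof.
have mD := measurable_disk r.
by apply: complex_ext; rewrite /cint ?cReE ?cImE Rintegral_cst// ?mul1r ?mul0r.
Qed.

Lemma moment_diag r n : 0 <= r ->
  moment r n n = (disk_area r * r ^+ (2 * n) / n.+1%:R)%:C.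
Proof.
move=> r0; elim: n => [|n ih].
  rewrite muln0 expr0 mulr1 divr1 -cint_cst1//.
  by apply: eq_cint => p _; rewrite !expr0 mulr1.
apply: (@mulfI _ (n.+2%:R : C)); first by rewrite pnatr_eq0.
rewrite moment_rec//= ih -[n.+1%:R](rmorph_nat (real_complex R)).
rewrite -[n.+2%:R](rmorph_nat (real_complex R)) -!rmorphM; congr (_%:C).
rewrite mulnS exprD; set a := disk_area r.
have h1 : n.+1%:R != 0 :> R by rewrite pnatr_eq0.
have h2 : n.+2%:R != 0 :> R by rewrite pnatr_eq0.
set u := n.+1%:R in h1 *; set v := n.+2%:R in h2 *.
by field; apply/andP.
Qed.

Lemma moment_neq r m n : 0 <= r -> m != n -> moment r m n = 0.
Proof.
move=> r0; rewrite neq_ltn => /orP[mn|nm]; last exact: moment_gt.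
by rewrite (momentJ n m r0) moment_gt//; exact: conjc0.
Qed.

Lemma norm2_polynomial r (a : nat -> C) N : 0 <= r ->
  \int[mu]_(p in disk r) normc (\sum_(k < N) a k * plane p ^+ k) ^+ 2 =
  disk_area r * \sum_(k < N) normc (a k) ^+ 2 * r ^+ (2 * k) / k.+1%:R.
Proof.
move=> r0; have mD := measurable_disk r; have fD := dA_disk_lty r0.
have im k l : cintegrable mu (disk r) (fun p : R2 => plane p ^+ k * (plane p)^* ^+ l).
  by apply: cbounded_integrable => //; exact: cbounded_monomial.
apply: complexI; rewrite -cint_normc2.
transitivity (cint mu (disk r) (fun p => \sum_(i < N) \sum_(j < N)
    (a i * (a j)^*) * (plane p ^+ i * (plane p)^* ^+ j))).
  apply: eq_cint => p _; rewrite conjc_sum big_distrlr/=.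
  apply: eq_bigr => i _; apply: eq_bigr => j _.
  by rewrite conjcM conjcX; ring.
rewrite cint_sum//; last first.
  by move=> i; apply: cintegrable_sum => // j; exact: cintegrableZ.
rewrite rmorphM rmorph_sum mulr_sumr; apply: eq_bigr => i _.
rewrite cint_sum//; last by move=> j; exact: cintegrableZ.
rewrite (bigD1 i)//= big1 ?addr0; last first.
  by move=> j ji; rewrite cintZ// -/(moment r i j) moment_neq ?mulr0// eq_sym.
rewrite cintZ// -/(moment r i i) moment_diag// mulcJ -!rmorphM; congr (_%:C).
by ring.
Qed.

End Moments.

(** * Power series *)

Section PowerSeries.
Context {R : realType}.
Local Notation C := R[i].
Implicit Types (a : nat -> C) (z u v l : C).

(** Every x m - e m lies below every x n + e n, so the supremum of the former is within e n of each
    x n. Keeping the rate is what gives explicit tails of power series later. *)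
Lemma real_limit (x e : nat -> R) :
  (forall n m, (n <= m)%N -> `|x m - x n| <= e n) ->
  exists l : R, forall n, `|x n - l| <= e n.
Proof.
move=> xe.
have h n m : x m - e m <= x n + e n.
  have [nm|mn] := leqP n m.
  - have := xe n m nm; have := le_trans (normr_ge0 _) (xe m m (leqnn m)).
    by rewrite ler_norml => ? /andP[_ ?]; lra.
  - have := xe m n (ltnW mn); have := le_trans (normr_ge0 _) (xe n n (leqnn n)).
    by rewrite ler_norml => ? /andP[? _]; lra.
pose A := [set x n - e n | n in setT].
have hA n : ubound A (x n + e n) by move=> _ [m _ <-]; exact: h.
have A0 : A !=set0 by exists (x 0%N - e 0%N); exists 0%N.
have sA : has_sup A by split => //; exists (x 0%N + e 0%N); exact: hA.
exists (sup A) => n; rewrite ler_norml; apply/andP; split.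
- by have := ge_sup A0 (hA n); lra.
- suff : x n - e n <= sup A by lra.
  by apply: ub_le_sup; [exact: sA.2|exists n].
Qed.

(** Real and imaginary parts are treated separately, whence the factor 2, which [ps_tail] and
    [ps_le] inherit. *)
Lemma complex_limit (u : nat -> C) (e : nat -> R) :
  (forall n m, (n <= m)%N -> normc (u m - u n) <= e n) ->
  exists l, forall n, normc (u n - l) <= 2 * e n.
Proof.
move=> ue.
have [|x hx] := @real_limit (fun n => Re (u n)) e.
  by move=> n m nm; rewrite -cReN -cReD; exact: le_trans (normc_Re _) (ue _ _ nm).
have [|y hy] := @real_limit (fun n => Im (u n)) e.
  by move=> n m nm; rewrite -cImN -cImD; exact: le_trans (normc_Im _) (ue _ _ nm).
exists (x +i* y) => n; apply: le_trans (normc_le_ReIm _) _.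
rewrite !ReImE; move: (hx n) (hy n); lra.
Qed.

Lemma cvg0_Ml (c : R) (e : nat -> R) : e @ \oo --> (0 : R) ->
  (fun n => c * e n) @ \oo --> (0 : R).
Proof. by move=> h; rewrite -(mulr0 c); apply: cvgM => //; exact: cvg_cst. Qed.

(** Convergence in C through a real sequence, so that squeezing and rates stay in [R]; [cvgCP]
    identifies it with the limit in [analytic_on_disk]. *)
Definition cvgC (u : nat -> C) l := (fun n => normc (u n - l)) @ \oo --> (0 : R).

Lemma cvgC_le (u : nat -> C) l (e : nat -> R) : (forall n, normc (u n - l) <= e n) ->
  e @ \oo --> (0 : R) -> cvgC u l.
Proof.
move=> ue e0; apply: (squeeze_cvgr _ (@cvg_cst _ (0 : R) _ _ _) e0).
by apply: nearW => n; rewrite normc_ge0 ue.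
Qed.

Lemma cvgC_norm (u : nat -> C) l (A : C) (B : R) : cvgC u l ->
  (\forall n \near \oo, normc (A - u n) <= B) -> normc (A - l) <= B.
Proof.
move=> ul uB; rewrite -[leRHS]addr0.
apply: (@cvgr_to_ge _ \oo _ _ (fun n => B + normc (u n - l))).
- by apply: cvgD => //; exact: cvg_cst.
- apply: filterS uB => n uB /=.
  rewrite (_ : A - l = (A - u n) + (u n - l)); last by ring.
  by apply: le_trans (normcD _ _) _; rewrite lerD2r.
Qed.

Lemma cvgC_unique (u : nat -> C) l l' : cvgC u l -> cvgC u l' -> l = l'.
Proof.
move=> ul ul'; apply/eqP; rewrite -subr_eq0 -normc_eq0 eq_le normc_ge0 andbT.
apply/ler_addgt0Pl => e e0; rewrite addr0.
apply: (cvgC_norm ul'); near=> n; rewrite normcB.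
by apply: ltW; near: n; apply: (cvgr_lt (0 : R)).
Unshelve. all: by end_near. Qed.

Lemma cvgCP (u : nat -> C^o) (l : C^o) : u @ \oo --> l <-> cvgC u l.
Proof.
split=> [/cvgrPdist_lt ul|ul].
- apply/cvgrPdist_lt => e e0.
  have := ul e%:C; rewrite ltcR => /(_ e0); apply: filterS => n h.
  by rewrite sub0r normrN ger0_norm ?normc_ge0// normcB -ltcR; exact: h.
- apply/cvgrPdist_lt => e e0.
  have ee : e = (Re e)%:C by case: e e0 => x y; rewrite ltcE/= => /andP[/eqP-> _].
  have e0' : 0 < Re e by move: e0; rewrite ltcE => /andP[].
  move/cvgrPdist_lt : ul => /(_ _ e0'); apply: filterS => n.
  rewrite sub0r normrN ger0_norm ?normc_ge0// normcB => h.
  by rewrite ee; change ((normc (l - u n))%:C < (Re e)%:C); rewrite ltcR.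
Qed.

Lemma eq_cvgC (u v : nat -> C) l : u =1 v -> cvgC u l -> cvgC v l.
Proof. by move=> /funext ->. Qed.

Lemma cvgC_cst l : cvgC (fun=> l) l.
Proof. by rewrite /cvgC; under eq_fun do rewrite subrr normc0; exact: cvg_cst. Qed.

Lemma cvgCD (u v : nat -> C) l l' : cvgC u l -> cvgC v l' ->
  cvgC (fun n => u n + v n) (l + l').
Proof.
move=> ul vl; apply: (@cvgC_le _ _ (fun n => normc (u n - l) + normc (v n - l'))).
  by move=> n; rewrite opprD addrACA normcD.
by rewrite -[0 : R]addr0; apply: cvgD.
Qed.

Lemma cvgCZ (u : nat -> C) l c : cvgC u l -> cvgC (fun n => c * u n) (c * l).
Proof.
move=> ul; apply: (@cvgC_le _ _ (fun n => normc c * normc (u n - l))).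
  by move=> n; rewrite -mulrBr normcM.
exact: cvg0_Ml.
Qed.

Definition psum a N z := \sum_(k < N) a k * z ^+ k.

(* Junk value 0 where the series diverges. *)
Definition ps a z : C := xget 0 [set l | cvgC (psum a ^~ z) l].

Lemma psE a z l : cvgC (psum a ^~ z) l -> ps a z = l.
Proof.
move=> h; apply: (cvgC_unique _ h).
exact: (@xgetPex _ 0 [set l | cvgC (psum a ^~ z) l] (ex_intro _ l h)).
Qed.

(** Stands in for the radius of convergence: it gives convergence for |z| < rho with geometric
    tails, and the constant M can be followed through recentring. *)
Definition ps_bound a (rho M : R) := forall k, normc (a k) * rho ^+ k <= M.

Lemma ps_bound_ge0 a rho M : ps_bound a rho M -> 0 <= M.
Proof. by move=> /(_ 0%N); apply: le_trans; rewrite expr0 mulr1 normc_ge0. Qed.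

Lemma ps_boundW a rho rho' M : 0 <= rho' <= rho -> ps_bound a rho M -> ps_bound a rho' M.
Proof.
move=> /andP[h0 h] aM k; apply: le_trans (aM k); rewrite ler_wpM2l ?normc_ge0//.
by rewrite lerXn2r// nnegrE// (le_trans h0).
Qed.

Lemma geometric_tail (x : nat -> R) (M q : R) N L : 0 <= q -> q < 1 -> 0 <= M ->
  (forall k, x k <= M * q ^+ k) -> \sum_(N <= k < L) x k <= M * q ^+ N / (1 - q).
Proof.
move=> q0 q1 M0 xM; have [NL|LN] := leqP N L; last first.
  by rewrite big_geq ?(ltnW LN)// divr_ge0 ?mulr_ge0 ?exprn_ge0// subr_ge0 ltW.
rewrite ler_pdivlMr ?subr_gt0//.
have : \sum_(N <= k < L) x k * (1 - q) <= M * (q ^+ N - q ^+ L).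
  elim: L NL => [|L ih]; first by rewrite leqn0 => /eqP ->; rewrite big_geq// subrr mulr0.
  rewrite leq_eqVlt => /orP[/eqP <-|]; first by rewrite big_geq// subrr mulr0.
  rewrite ltnS => NL; rewrite big_nat_recr//= .
  apply: (@le_trans _ _ (M * (q ^+ N - q ^+ L) + M * q ^+ L * (1 - q))).
    by rewrite lerD ?ih// ler_wpM2r ?xM// subr_ge0 ltW.
  by rewrite exprS le_eqVlt; apply/orP; left; apply/eqP; ring.
rewrite -mulr_suml => /le_trans; apply.
by rewrite ler_wpM2l// gerBl exprn_ge0.
Qed.

Lemma psum_sub a N L z : (N <= L)%N ->
  psum a L z - psum a N z = \sum_(N <= k < L) a k * z ^+ k.
Proof.
move=> NL; rewrite /psum -!(big_mkord xpredT (fun k => a k * z ^+ k)).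
by rewrite (@big_cat_nat _ _ _ N)//= addrAC subrr add0r.
Qed.

Lemma psum_tail a rho M r N L z : 0 < rho -> ps_bound a rho M -> normc z <= r ->
  r < rho -> (N <= L)%N ->
  normc (psum a L z - psum a N z) <= M * (r / rho) ^+ N / (1 - r / rho).
Proof.
move=> rho0 aM zr rrho NL; rewrite psum_sub//.
have r0 : 0 <= r by apply: le_trans zr; exact: normc_ge0.
apply: le_trans (normc_sum _ _ _) _.
apply: geometric_tail => [| | |k].
- by rewrite divr_ge0// ltW.
- by rewrite ltr_pdivrMr// mul1r.
- exact: ps_bound_ge0 aM.
- rewrite normcM normcX expr_div_n mulrA ler_pdivlMr ?exprn_gt0//.
  rewrite mulrAC; apply: ler_pM => //.
  + by rewrite mulr_ge0 ?normc_ge0 ?exprn_ge0// ltW.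
  + by rewrite exprn_ge0// normc_ge0.
  + by rewrite lerXn2r// nnegrE normc_ge0.
Qed.

Lemma tail_cvg0 (M q : R) : 0 <= q -> q < 1 ->
  (fun N => 2 * (M * q ^+ N / (1 - q))) @ \oo --> (0 : R).
Proof.
move=> q0 q1; have : (fun N => (2 * (M / (1 - q))) * q ^+ N) @ \oo --> (0 : R).
  by apply: cvg0_Ml; apply: cvg_expr; rewrite ger0_norm.
by apply: cvg_trans; apply: near_eq_cvg; apply: nearW => N; ring.
Qed.

Lemma ps_tail a rho M r N z : 0 < rho -> ps_bound a rho M -> normc z <= r ->
  r < rho -> normc (psum a N z - ps a z) <= 2 * (M * (r / rho) ^+ N / (1 - r / rho)).
Proof.
move=> rho0 aM zr rrho.
have r0 : 0 <= r by apply: le_trans zr; exact: normc_ge0.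
have [|l hl] := @complex_limit (psum a ^~ z) (fun N => M * (r / rho) ^+ N / (1 - r / rho)).
  by move=> n m nm; exact: psum_tail.
rewrite (@psE _ _ l); first exact: hl.
apply: cvgC_le hl _.
by apply: tail_cvg0; rewrite ?divr_ge0 ?(ltW rho0)// ltr_pdivrMr// mul1r.
Qed.

Lemma ps_cvg a rho M z : ps_bound a rho M -> normc z < rho ->
  cvgC (psum a ^~ z) (ps a z).
Proof.
move=> aM zrho; have rho0 : 0 < rho by exact: le_lt_trans (normc_ge0 _) zrho.
apply: cvgC_le (fun N => ps_tail N rho0 aM (lexx _) zrho) _.
by apply: tail_cvg0; rewrite ?divr_ge0 ?normc_ge0 ?(ltW rho0)// ltr_pdivrMr// mul1r.
Qed.

Lemma ps_le a rho M r z : 0 < rho -> ps_bound a rho M -> normc z <= r ->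
  r < rho -> normc (ps a z) <= 2 * (M / (1 - r / rho)).
Proof.
move=> rho0 aM zr rrho; have := ps_tail 0 rho0 aM zr rrho.
by rewrite /psum big_ord0 sub0r normcN expr0 mulr1.
Qed.

Lemma psum0 a N : psum a N.+1 0 = a 0%N.
Proof.
rewrite /psum big_ord_recl expr0 mulr1 big1 ?addr0// => i _.
by rewrite /= exprS mul0r mulr0.
Qed.

Lemma psD a b rho M M' z : ps_bound a rho M -> ps_bound b rho M' -> normc z < rho ->
  ps (fun k => a k + b k) z = ps a z + ps b z.
Proof.
move=> ha hb zr; apply: psE.
apply: eq_cvgC (cvgCD (ps_cvg ha zr) (ps_cvg hb zr)) => n.
by rewrite /psum -big_split; apply: eq_bigr => i _; rewrite mulrDl.
Qed.

Lemma psZ a c rho M z : ps_bound a rho M -> normc z < rho ->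
  ps (fun k => c * a k) z = c * ps a z.
Proof.
move=> ha zr; apply: psE.
apply: eq_cvgC (cvgCZ c (ps_cvg ha zr)) => n.
by rewrite /psum mulr_sumr; apply: eq_bigr => i _; rewrite mulrA.
Qed.

Lemma ps_boundD a b rho M M' : 0 <= rho -> ps_bound a rho M -> ps_bound b rho M' ->
  ps_bound (fun k => a k + b k) rho (M + M').
Proof.
move=> r0 ha hb k; apply: (@le_trans _ _ ((normc (a k) + normc (b k)) * rho ^+ k)).
  by rewrite ler_wpM2r ?exprn_ge0// normcD.
by rewrite mulrDl lerD.
Qed.

Lemma ps_boundZ a c rho M : ps_bound a rho M ->
  ps_bound (fun k => c * a k) rho (normc c * M).
Proof. by move=> ha k; rewrite normcM -mulrA ler_wpM2l ?normc_ge0. Qed.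

Lemma cvg_ps_bound a z l : cvgC (psum a ^~ z) l -> exists M, ps_bound a (normc z) M.
Proof.
move=> /cvgrPdist_lt /(_ 1 ltr01)[N _ hN].
have hN' n : (N <= n)%N -> normc (psum a n z - l) < 1.
  by move=> /hN /=; rewrite sub0r normrN ger0_norm ?normc_ge0.
(* From N on, a term is the difference of two partial sums within 1 of the limit, hence the 2; the
   finite sum takes care of the earlier terms. *)
exists (2 + \sum_(k < N) normc (a k) * normc z ^+ k) => k.
have h0 i : 0 <= normc (a i) * normc z ^+ i by rewrite mulr_ge0 ?exprn_ge0 ?normc_ge0.
have [Nk|kN] := leqP N k; last first.
  rewrite (bigD1 (Ordinal kN))//= addrCA lerDl.
  by apply: addr_ge0 => //; apply: sumr_ge0 => i _; exact: h0.
apply: (@le_trans _ _ 2); last by rewrite lerDl; apply: sumr_ge0 => i _; exact: h0.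
rewrite -normcX -normcM.
have -> : a k * z ^+ k = (psum a k.+1 z - l) - (psum a k z - l).
  by rewrite /psum big_ord_recr/=; ring.
apply: le_trans (normcD _ _) _; rewrite normcN.
have := hN' _ Nk; have := hN' k.+1 (leqW Nk); lra.
Qed.

(* Compared with Cauchy's estimate this loses a factor sqrt (k + 1), but it
   comes for free from the orthogonality of the monomials on the disk. *)
Lemma cauchy_estimate a rho M r B : 0 < r -> r < rho -> ps_bound a rho M ->
  (forall z, normc z < r -> normc (ps a z) <= B) ->
  forall k, normc (a k) ^+ 2 * r ^+ (2 * k) / k.+1%:R <= B ^+ 2.
Proof.
move=> r0 rrho aM aB k; have rho0 := lt_trans r0 rrho.
have B0 : 0 <= B by apply: le_trans (aB 0 _); rewrite ?normc_ge0// normc0.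
pose e N := 2 * (M * (r / rho) ^+ N / (1 - r / rho)).
have e0 : e @ \oo --> (0 : R).
  by apply: tail_cvg0; rewrite ?divr_ge0 ?(ltW rho0) ?(ltW r0)// ltr_pdivrMr// mul1r.
have SB N z : normc z < r -> normc (psum a N z) <= B + e N.
  move=> zr; rewrite -(subrK (ps a z) (psum a N z)).
  apply: le_trans (normcD _ _) _; rewrite addrC lerD ?aB//.
  exact: ps_tail (ltW zr) rrho.
have mD := measurable_disk r; have fD := dA_disk_lty (ltW r0).
have bS N : cbounded (disk r) (fun p => psum a N (plane p)).
  apply: cbounded_sum => i; apply: cboundedM (cbounded_cst _ _) _.
  by apply: cboundedX; exact: cbounded_plane (ltW r0).
(* Times the area, the left-hand side is one of the nonnegative terms of the squared norm of the
   N-th partial sum, which is at most the area times the squared sup bound. *)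
have h N : (k < N)%N -> normc (a k) ^+ 2 * r ^+ (2 * k) / k.+1%:R <= (B + e N) ^+ 2.
  move=> kN; have A0 := disk_area_gt0 r0.
  rewrite -(ler_pM2l A0).
  apply: (@le_trans _ _ (\int[@dA R]_(p in disk r) normc (psum a N (plane p)) ^+ 2)).
    rewrite norm2_polynomial ?(ltW r0)// ler_wpM2l ?(ltW A0)//.
    rewrite (bigD1 (Ordinal kN))//= lerDl; apply: sumr_ge0 => i _.
    by rewrite divr_ge0// mulr_ge0 ?exprn_ge0 ?normc_ge0// ltW.
  have -> : disk_area r * (B + e N) ^+ 2 = \int[@dA R]_(p in disk r) (B + e N) ^+ 2.
    by rewrite Rintegral_cst// mulrC.
  have i1 : (@dA R).-integrable (disk r) (EFin \o (fun p => normc (psum a N (plane p)) ^+ 2)).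
    apply: measurable_bounded_integrable => //.
    - by apply: cmeas_normc2; exact: (bS N).1.
    - have [_ [B' hB']] := bS N; exists (B' ^+ 2); split; rewrite ?num_real// => x Bx y Dy /=.
      rewrite ger0_norm ?sqr_ge0//; apply: le_trans (ltW Bx).
      by rewrite lerXn2r ?nnegrE ?normc_ge0 ?hB'// (le_trans (normc_ge0 _) (hB' _ Dy)).
  apply: le_Rintegral => //.
    apply: measurable_bounded_integrable => //.
    exists ((B + e N) ^+ 2); split; rewrite ?num_real// => x Bx y _ /=.
    by rewrite ger0_norm ?sqr_ge0// ltW.
  move=> p /(diskE p (ltW r0)) pr; rewrite lerXn2r ?nnegrE ?normc_ge0 ?SB//.
  exact: le_trans (normc_ge0 _) (SB N _ pr).
have lim : (fun N => (B + e N) ^+ 2) @ \oo --> B ^+ 2.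
  have : (fun N => B + e N) @ \oo --> B.
    by rewrite -[X in _ --> X]addr0; apply: cvgD => //; exact: cvg_cst.
  by move=> hh; exact: (cvgM hh hh).
apply: (cvgr_to_ge lim).
by exists k.+1 => // N /= kN; exact: h.
Qed.

(** Cauchy's estimate with bound 0 for the difference, on radius r / 2 because that estimate needs a
    radius strictly below [rho]. *)
Lemma ps_inj a b rho M M' r : 0 < r -> r <= rho -> ps_bound a rho M -> ps_bound b rho M' ->
  (forall z, normc z < r -> ps a z = ps b z) -> a = b.
Proof.
move=> r0 rrho aM bM ab; apply/funext => k.
have rho0 := lt_le_trans r0 rrho.
have bN := ps_boundZ (-1) bM.
have dM := ps_boundD (ltW rho0) aM bN.
have := @cauchy_estimate _ rho _ (r / 2) 0 _ _ dM.
have r20 : 0 < r / 2 by rewrite divr_gt0.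
have r2 : r / 2 < r by lra.
move=> /(_ r20 (lt_le_trans r2 rrho)).
have h z : normc z < r / 2 -> normc (ps (fun k => a k + -1 * b k) z) <= 0.
  move=> zr; have zrho : normc z < rho by apply: lt_trans zr _; exact: lt_le_trans rrho.
  rewrite (psD aM bN)// (psZ _ bM)// ab ?(lt_trans zr)//.
  by rewrite mulN1r subrr normc0.
move=> /(_ h k); rewrite expr0n/= => hk.
apply/eqP; rewrite -subr_eq0 -normc_eq0 -sqrf_eq0 eq_le sqr_ge0 andbT -mulN1r.
have p0 : 0 < (r / 2) ^+ (2 * k) / k.+1%:R by rewrite divr_gt0// exprn_gt0.
by rewrite -(ler_pM2r p0) mul0r mulrA.
Qed.

End PowerSeries.

(** * Re-expansion of a power series at another centre *)

Section Recenter.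
Context {R : realType}.
Local Notation C := R[i].
Implicit Types (a : nat -> C) (z u v l : C).

Lemma cvgC_sum I (r : seq I) (u : I -> nat -> C) (l : I -> C) :
  (forall i, cvgC (u i) (l i)) ->
  cvgC (fun n => \sum_(i <- r) u i n) (\sum_(i <- r) l i).
Proof.
move=> ul; elim: r => [|i r ih].
  rewrite big_nil; apply: eq_cvgC (cvgC_cst _) => n; by rewrite big_nil.
rewrite big_cons; apply: eq_cvgC (cvgCD (ul i) ih) => n; by rewrite big_cons.
Qed.

(** The number L of terms does not depend on n, so this sum can be exchanged with a sum over n. *)
Lemma exprDn_wide (K : comPzRingType) (x y : K) n L : (n < L)%N ->
  (x + y) ^+ n = \sum_(k < L) x ^+ (n - k) * y ^+ k *+ 'C(n, k).
Proof.
move=> nL; rewrite exprDn (big_ord_widen L (fun i => x ^+ (n - i) * y ^+ i *+ 'C(n, i)))//.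
rewrite big_mkcond; apply: eq_bigr => i _; case: ifPn => //.
by rewrite -leqNgt => ni; rewrite bin_small.
Qed.

Lemma binomial_sum_le (x y : R) n N : 0 <= x -> 0 <= y ->
  \sum_(k < N) x ^+ (n - k) * y ^+ k *+ 'C(n, k) <= (x + y) ^+ n.
Proof.
move=> x0 y0; rewrite (@exprDn_wide _ _ _ _ (n.+1 + N))// ?leq_addr//.
rewrite addnC -!(big_mkord xpredT (fun k => x ^+ (n - k) * y ^+ k *+ 'C(n, k))).
rewrite [leRHS](@big_cat_nat _ _ _ N)//= ?leq_addr// lerDl.
by apply: sumr_ge0 => i _; rewrite mulrn_wge0// mulr_ge0// exprn_ge0.
Qed.

Lemma binomial_term_le (x y : R) n k : 0 <= x -> 0 <= y ->
  x ^+ (n - k) * y ^+ k *+ 'C(n, k) <= (x + y) ^+ n.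
Proof.
move=> x0 y0; apply: le_trans (binomial_sum_le n k.+1 x0 y0).
rewrite big_ord_recr/= lerDr; apply: sumr_ge0 => i _.
by rewrite mulrn_wge0// mulr_ge0// exprn_ge0.
Qed.

(** The k-th Taylor coefficient at u, the k-th derivative over k!, is itself a power series in u;
    these are its coefficients. *)
Definition recenter_coef a k m := a (m + k)%N *+ 'C(m + k, k).

Definition recenter a u k := ps (recenter_coef a k) u.

(** The k-th Taylor coefficient at u of the polynomial [psum a L]; the binomial coefficient kills
    the indices j < k, where j - k is truncated. *)
Let T a L k u := \sum_(j < L) a j *+ 'C(j, k) * u ^+ (j - k).

Lemma normcMn z n : normc (z *+ n) = normc z *+ n.
Proof.
by rewrite -mulr_natr -[n%:R](rmorph_nat (real_complex R)) normcM normcC normr_nat mulr_natr.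
Qed.

Lemma recenter_coef_bound a rho M x y k : 0 <= x -> 0 < y -> x + y <= rho ->
  ps_bound a rho M -> ps_bound (recenter_coef a k) x (M / y ^+ k).
Proof.
move=> x0 y0 xy aM m; rewrite /recenter_coef normcMn ler_pdivlMr ?exprn_gt0//.
apply: le_trans (aM (m + k)%N).
rewrite -mulrA mulrnAl -mulrnAr ler_wpM2l ?normc_ge0//.
have := binomial_term_le (m + k) k x0 (ltW y0); rewrite addnK => h.
apply: le_trans h _; rewrite lerXn2r// ?nnegrE ?addr_ge0 ?(ltW y0)//.
by apply: le_trans xy; rewrite addr_ge0// ltW.
Qed.

Lemma recenter_partial_cvg a rho M u k : ps_bound a rho M -> normc u < rho ->
  cvgC (fun L => T a L k u) (recenter a u k).
Proof.
move=> aM ur; rewrite /cvgC -(cvg_shiftn k (fun L => normc (T a L k u - recenter a u k))).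
pose x := (normc u + rho) / 2.
have ux : normc u < x by rewrite /x; lra.
have xrho : x < rho by rewrite /x; lra.
have hb : ps_bound (recenter_coef a k) x (M / (rho - x) ^+ k).
  apply: (@recenter_coef_bound a rho) => //; rewrite ?subr_gt0//.
  - exact: le_trans (normc_ge0 u) (ltW ux).
  - by rewrite addrC subrK.
have := ps_cvg hb ux; apply: eq_cvgC; elim => [|L ih].
  rewrite /psum big_ord0 /T big1// => i _; rewrite bin_small// mulr0n mul0r//.
rewrite /psum big_ord_recr /T addSn big_ord_recr/= -/(T _ _ _ _) -ih addnK.
by rewrite /recenter_coef.
Qed.

(** For every k, C(j, k) |u|^(j-k) s^k <= (|u| + s)^j. So the Taylor coefficients at u times s^k are
    all dominated by the sum of |a_j| (|u| + s)^j, a geometric series. *)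
Lemma recenter_bound a rho M u s : ps_bound a rho M -> 0 <= s -> normc u + s < rho ->
  ps_bound (recenter a u) s (M / (1 - (normc u + s) / rho)).
Proof.
move=> aM s0 us k.
have ur : normc u < rho by apply: le_lt_trans us; rewrite lerDl.
have rho0 : 0 < rho by exact: le_lt_trans (normc_ge0 _) ur.
have us0 : 0 <= normc u + s by rewrite addr_ge0// normc_ge0.
have -> : normc (recenter a u k) * s ^+ k = normc (0 - (s ^+ k)%:C * recenter a u k).
  by rewrite sub0r normcN normcM normcC ger0_norm ?exprn_ge0// mulrC.
apply: (cvgC_norm (cvgCZ (s ^+ k)%:C (recenter_partial_cvg k aM ur))); apply: nearW => L.
rewrite sub0r normcN normcM normcC ger0_norm ?exprn_ge0//.
apply: (@le_trans _ _ (\sum_(0 <= j < L) normc (a j) * (normc u + s) ^+ j)).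
  rewrite big_mkord mulrC; apply: (@le_trans _ _
      (\sum_(j < L) normc (a j *+ 'C(j, k) * u ^+ (j - k)) * s ^+ k)).
    by rewrite -mulr_suml ler_wpM2r ?exprn_ge0// normc_sum.
  apply: ler_sum => j _; rewrite normcM normcMn normcX -mulrA mulrnAl -mulrnAr.
  by rewrite ler_wpM2l ?normc_ge0// binomial_term_le// normc_ge0.
have := @geometric_tail _ (fun j => normc (a j) * (normc u + s) ^+ j) M
   ((normc u + s) / rho) 0 L; rewrite expr0 mulr1; apply.
- by rewrite divr_ge0// ltW.
- by rewrite ltr_pdivrMr// mul1r.
- exact: ps_bound_ge0 aM.
- move=> j; rewrite expr_div_n mulrA ler_pdivlMr ?exprn_gt0// mulrAC.
  by rewrite ler_wpM2r ?exprn_ge0.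
Qed.

(** For j < N the binomial expansion of (u + v)^j only has k < N. Hence the double sum over k < N
    and j < L differs from [psum a N (u + v)] by terms with N <= j < L, a geometric tail; then L
    tends to infinity at fixed N. *)
Lemma recenter_cvg a rho M u v : ps_bound a rho M -> normc u + normc v < rho ->
  cvgC (psum (recenter a u) ^~ v) (ps a (u + v)).
Proof.
move=> aM uvr; set r := normc u + normc v in uvr.
have r0 : 0 <= r by rewrite addr_ge0// normc_ge0.
have rho0 : 0 < rho by exact: le_lt_trans uvr.
have ur : normc u < rho by apply: le_lt_trans uvr; rewrite lerDl normc_ge0.
pose e N := M * (r / rho) ^+ N / (1 - r / rho).
have q0 : 0 <= r / rho by rewrite divr_ge0// ltW.
have q1 : r / rho < 1 by rewrite ltr_pdivrMr// mul1r.
have key N L : (N <= L)%N ->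
    normc (psum a N (u + v) - \sum_(k < N) v ^+ k * T a L k u) <= e N.
  move=> NL.
  have -> : psum a N (u + v) = \sum_(k < N) v ^+ k * T a N k u.
    under [RHS]eq_bigr do rewrite /T mulr_sumr.
    rewrite exchange_big/=; apply: eq_bigr => j _.
    rewrite (@exprDn_wide _ u v j N)// mulr_sumr; apply: eq_bigr => k _.
    by rewrite -(mulr_natr (a j)) -(mulr_natr (u ^+ _ * _)); ring.
  rewrite -sumrB.
  have -> : \sum_(k < N) (v ^+ k * T a N k u - v ^+ k * T a L k u) =
      - \sum_(N <= j < L) a j * (\sum_(k < N) u ^+ (j - k) * v ^+ k *+ 'C(j, k)).
    under [in RHS]eq_bigr do rewrite mulr_sumr.
    rewrite exchange_big/= -sumrN; apply: eq_bigr => k _.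
    rewrite /T -!(big_mkord xpredT (fun j => a j *+ 'C(j, k) * u ^+ (j - k))).
    rewrite [X in _ - _ * X](@big_cat_nat _ _ _ N)//= mulrDr opprD addrA subrr sub0r.
    congr (- _); rewrite mulr_sumr; apply: eq_bigr => j _.
    by rewrite -(mulr_natr (a j)) -(mulr_natr (u ^+ _ * _)); ring.
  rewrite normcN; apply: le_trans (normc_sum _ _ _) _.
  apply: (@le_trans _ _ (\sum_(N <= j < L) normc (a j) * r ^+ j)).
    apply: ler_sum => j _; rewrite normcM ler_wpM2l ?normc_ge0//.
    apply: le_trans (normc_sum _ _ _) _.
    apply: le_trans (binomial_sum_le j N (normc_ge0 u) (normc_ge0 v)).
    by apply: ler_sum => k _; rewrite normcMn normcM !normcX.
  apply: geometric_tail => //; first exact: ps_bound_ge0 aM.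
  move=> j; rewrite expr_div_n mulrA ler_pdivlMr ?exprn_gt0// mulrAC.
  by rewrite ler_wpM2r ?exprn_ge0.
apply: (@cvgC_le _ _ _ (fun N => 2 * (e N) + normc (psum a N (u + v) - ps a (u + v)))).
  move=> N.
  have h : normc (psum a N (u + v) - psum (recenter a u) N v) <= e N.
    have hc : cvgC (fun L => \sum_(k < N) v ^+ k * T a L k u) (psum (recenter a u) N v).
      rewrite /psum; under eq_bigr do rewrite mulrC.
      by apply: cvgC_sum => i; apply: cvgCZ; exact: (recenter_partial_cvg i aM ur).
    apply: (cvgC_norm hc); exists N => // L /= NL; exact: key.
  rewrite (_ : _ - _ = - (psum a N (u + v) - psum (recenter a u) N v)
    + (psum a N (u + v) - ps a (u + v))); last by ring.
  apply: le_trans (normcD _ _) _; rewrite normcN lerD2r; apply: (le_trans h).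
  by have := le_trans (normc_ge0 _) h; lra.
rewrite -[X in _ --> X]addr0; apply: cvgD; first exact: tail_cvg0.
by apply: (ps_cvg aM); apply: le_lt_trans uvr; exact: normcD.
Qed.

Lemma recenter_ps a rho M u v : ps_bound a rho M -> normc u + normc v < rho ->
  ps (recenter a u) v = ps a (u + v).
Proof. by move=> aM uv; apply: psE; exact: recenter_cvg aM uv. Qed.

End Recenter.

(** * From local expansions to one Taylor series on the whole disk *)

Section GlobalExpansion.
Context {R : realType}.
Local Notation C := R[i].
Variable f : C -> C^o.

(** One number d is both the radius and, inverted, the bound. The property is then monotone in d,
    and compactness can provide a single d for many centres. *)
Definition expands_at (d : R) (z0 : C) := exists a,
  ps_bound a d d^-1 /\ forall z, normc (z - z0) < d -> f z = ps a (z - z0).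

Lemma expands_atW d d' z0 : 0 < d' -> d' <= d -> expands_at d z0 -> expands_at d' z0.
Proof.
move=> d0 dd [a [ad fa]]; exists a; split => [k|z zd].
  apply: (@le_trans _ _ d^-1); last by rewrite lef_pV2// posrE// (lt_le_trans d0).
  by apply: (ps_boundW _ ad); rewrite (ltW d0).
by apply: fa; exact: lt_le_trans zd dd.
Qed.

Hypothesis fA : analytic_on_disk f.

Lemma analytic_local z0 : normc z0 < 1 -> exists a rho M, [/\ 0 < rho, ps_bound a rho M
  & forall z, normc (z - z0) < rho -> f z = ps a (z - z0)].
Proof.
move=> z01; have [a [r [r0 fz]]] := fA z01.
have c z : normc (z - z0) < r -> cvgC (psum a ^~ (z - z0)) (f z).
  move=> zr; have /cvgCP := fz z zr; apply: eq_cvgC => n.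
  by rewrite /series/= /psum big_mkord.
pose rho := r / 2; have rho0 : 0 < rho by rewrite /rho; lra.
have [M aM] : exists M, ps_bound a rho M.
  have zr : normc (z0 + rho%:C - z0) < r.
    by rewrite addrAC subrr add0r normcC gtr0_norm// /rho; lra.
  have := cvg_ps_bound (c _ zr).
  by rewrite addrAC subrr add0r normcC gtr0_norm.
exists a, rho, M; split => // z zrho; apply/esym/psE/c.
by apply: lt_trans zrho _; rewrite /rho; lra.
Qed.

Lemma expands_at_near z0 : normc z0 < 1 -> exists e : R, 0 < e /\
  forall d z1, 0 < d -> d < e -> normc (z1 - z0) < e -> expands_at d z1.
Proof.
move=> /analytic_local[a [rho [M [rho0 aM fa]]]].
have M0 := ps_bound_ge0 aM.
have M1 : 0 < 2 * M + 1 by lra.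
(* rho / 4 keeps |z1 - z0| + d below rho / 2, so recentring at most doubles M; the other entry makes
   d^-1 exceed that bound. *)
pose e := Num.min (rho / 4) (2 * M + 1)^-1.
have e0 : 0 < e by rewrite lt_min invr_gt0 M1 andbT; lra.
have erho : e <= rho / 4 by rewrite ge_min lexx.
exists e; split => // d z1 d0 de z1e; exists (recenter a (z1 - z0)).
have h : normc (z1 - z0) + d < rho / 2 by lra.
split => [k|z zd].
  have hr : normc (z1 - z0) + d < rho by lra.
  apply: le_trans (recenter_bound aM (ltW d0) hr k) _.
  have q : (normc (z1 - z0) + d) / rho <= 2^-1.
    by rewrite ler_pdivrMr//; lra.
  apply: (@le_trans _ _ (2 * M + 1)); last first.
    rewrite -[leLHS]invrK lef_pV2 ?posrE ?invr_gt0//.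
    by apply: le_trans (ltW de) _; rewrite ge_min lexx orbT.
  rewrite ler_pdivrMr; last by lra.
  by apply: (@le_trans _ _ ((2 * M + 1) * 2^-1)); [lra|rewrite ler_pM2l//; lra].
rewrite (recenter_ps aM); last by lra.
rewrite (_ : z1 - z0 + (z - z1) = z - z0); last by ring.
apply: fa; rewrite (_ : z - z0 = (z - z1) + (z1 - z0)); last by ring.
by apply: le_lt_trans (normcD _ _) _; lra.
Qed.

(** Near each point of the closed disk all small d work, so compactness, in the form of near
    coverings along d -> 0+, yields a common d. *)
Lemma expands_uniformly r : 0 <= r -> r < 1 -> exists d, 0 < d /\
  forall z, normc z <= r -> expands_at d z.
Proof.
move=> r0 r1.
pose K : set (R * R)%type := [set p | p.1 ^+ 2 + p.2 ^+ 2 <= r ^+ 2].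
have cK : compact K.
  apply: (@subclosed_compact _ K (`[- r, r] `*` `[- r, r])).
  - have -> : K = (fun p : R * R => p.1 ^+ 2 + p.2 ^+ 2) @^-1` [set x | x <= r ^+ 2] by [].
    apply: closed_comp; last exact: closed_le.
    move=> p _; have h1 : (fun q : R * R => q.1) @ p --> p.1 by exact: cvg_fst.
    have h2 : (fun q : R * R => q.2) @ p --> p.2 by exact: cvg_snd.
    exact: (cvgD (cvgM h1 h1) (cvgM h2 h2)).
  - by apply: compact_setX; exact: segment_compact.
  - move=> [x y] /= h; split => /=; rewrite in_itv/= -ler_norml.
    + rewrite -ler_sqr ?nnegrE// real_normK ?num_real//.
      by apply: le_trans h; rewrite lerDl sqr_ge0.
    + rewrite -ler_sqr ?nnegrE// real_normK ?num_real//.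
      by apply: le_trans h; rewrite lerDr sqr_ge0.
move/compact_near_coveringP : cK => /(_ R (0^'+) (fun d p => expands_at d (p.1 +i* p.2)) _).
case.
  move=> p Kp; have p1 : normc (p.1 +i* p.2) < 1.
    apply: le_lt_trans r1; rewrite -ler_sqr ?nnegrE ?normc_ge0//.
    by rewrite normc_sqr.
  have [e [e0 he]] := expands_at_near p1.
  near=> q d => /=; apply: he.
  - by near: d; exact: nbhs_right_gt.
  - by near: d; exact: nbhs_right_lt.
  - apply: le_lt_trans (normc_le_ReIm _) _; rewrite !ReImE.
    rewrite [e]splitr ltrD//.
    + near: q; have h1 : (fun q : R * R => q.1) @ p --> p.1 by exact: cvg_fst.
      by apply: (cvgr_distC_lt _ _ h1); rewrite divr_gt0.
    + near: q; have h2 : (fun q : R * R => q.2) @ p --> p.2 by exact: cvg_snd.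
      by apply: (cvgr_distC_lt _ _ h2); rewrite divr_gt0.
Unshelve. all: try by end_near.
move=> e /= e0 he; exists (e / 2); split; first by rewrite divr_gt0.
move=> z zr; have := he (e / 2); rewrite /= sub0r normrN ger0_norm ?divr_ge0 ?(ltW e0)//.
have -> : e / 2 < e by lra.
move=> /(_ isT); rewrite divr_gt0// => /(_ isT (Re z, Im z)) /=.
case: z zr => x y zr; apply.
by rewrite /K/=; have := normc_sqr (x +i* y); rewrite !ReImE => <-; rewrite lerXn2r// nnegrE normc_ge0.
Qed.

(** Each of the n + 1 terms of 1 + q + ... + q^n is at least q^n. It absorbs the polynomial loss in
    the Cauchy estimate by a slight decrease of the radius. *)
Lemma expr_geometric_le (q : R) n : 0 <= q -> q < 1 -> n.+1%:R * q ^+ n <= (1 - q)^-1.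
Proof.
move=> q0 q1; have h1 : 0 < 1 - q by rewrite subr_gt0.
rewrite -[leRHS]mul1r ler_pdivlMr//.
apply: (@le_trans _ _ (1 - q ^+ n.+1)); last by rewrite gerBl exprn_ge0.
rewrite -[leRHS](_ : (1 - q) * \sum_(i < n.+1) q ^+ i = _); last first.
  have := subrXX (1 : R) q n.+1; rewrite expr1n => ->.
  by congr (_ * _); apply: eq_bigr => i _; rewrite expr1n mul1r.
rewrite mulrC ler_pM2l// -[n.+1%:R]mulr_natl mulr1.
rewrite -[X in X%:R]card_ord -sumr_const mulr_suml; apply: ler_sum => i _.
by rewrite mul1r; apply: ler_wiXn2l; rewrite ?(ltW q1)// -ltnS.
Qed.

Definition is_expansion a (rho : R) :=
  (forall s, 0 < s < rho -> exists M, ps_bound a s M) /\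
  forall z, normc z < rho -> f z = ps a z.

(* The Taylor coefficients c_k(z0) = sum_m C(m + k, k) a_{m+k} z0^m are at most
   1 / d^{k+1} for all |z0| < rho; the Cauchy estimate for these series in z0
   bounds C(n, k) |a_n| rho^{n-k} d^k, and summing over k against 2^-k gives
   the radius rho + d / 2, up to the loss from working inside |z0| < rho. *)
Lemma extend_expansion a d rho : 0 < d -> d <= rho ->
  (forall z, normc z < rho -> expands_at d z) ->
  is_expansion a rho -> is_expansion a (rho + d / 4).
Proof.
move=> d0 drho fd [aM fa].
(* Cauchy's estimate is applied on |z0| < x, and a bound on [a] is taken at y > x to leave room. The
   choice of x makes x + d / 2 the announced radius rho + d / 4. *)
pose x := rho - d / 4; pose y := rho - d / 8.
have x0 : 0 < x by rewrite /x; lra.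
have y0 : 0 < y by rewrite /y; lra.
have [M yM] : exists M, ps_bound a y M by apply: aM; rewrite y0 /y; lra.
have near z0 : normc z0 < x -> ps_bound (recenter a z0) d d^-1 /\
    forall z, normc (z - z0) < d -> f z = ps (recenter a z0) (z - z0).
  move=> z0x; have z0rho : normc z0 < rho by move: z0x; rewrite /x; lra.
  have [a' [a'd fa']] := fd _ z0rho.
  (* Both series represent f near z0, so by uniqueness of coefficients the recentred series inherits
     the bound d^-1 of the given expansion. *)
  suff <- : a' = recenter a z0 by split.
  pose s := Num.min d ((y - normc z0) / 2).
  have s0 : 0 < s by rewrite lt_min d0 divr_gt0// subr_gt0; move: z0x; rewrite /x /y; lra.
  have sd : s <= d by rewrite ge_min lexx.
  have sy : normc z0 + s < y.
    have : s <= (y - normc z0) / 2 by rewrite ge_min lexx orbT.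
    by move: z0x; rewrite /x /y; lra.
  have rb := recenter_bound yM (ltW s0) sy.
  apply: (@ps_inj _ _ _ s _ _ s s0 (lexx _) _ rb).
    by apply: ps_boundW a'd; rewrite (ltW s0) sd.
  move=> w ws; rewrite (recenter_ps yM); last by move: sy; lra.
  have := fa' (z0 + w); rewrite addrAC subrr add0r => <-; last exact: lt_le_trans sd.
  apply: fa; apply: le_lt_trans (normcD _ _) _.
  by move: sy; rewrite /y; lra.
have coef n k : normc (a (n + k)%N) * x ^+ n * d ^+ k *+ 'C(n + k, k) <= n.+1%:R / d.
  have B z : normc z < x -> normc (ps (recenter_coef a k) z) <= d^-1 / d ^+ k.
    by move=> zx; rewrite ler_pdivlMr ?exprn_gt0//; exact: (near z zx).1.
  pose x' := (x + y) / 2.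
  have xx' : x < x' by rewrite /x' /x /y; lra.
  have bb : ps_bound (recenter_coef a k) x' (M / (y - x') ^+ k).
    apply: (recenter_coef_bound k _ _ _ yM); last by rewrite addrC subrK.
    - exact: ltW (lt_trans x0 xx').
    - by rewrite subr_gt0 /x' /x /y; lra.
  have := cauchy_estimate x0 xx' bb B n.
  rewrite ler_pdivrMr// mulnC exprM -exprMn => h.
  have {}h : normc (recenter_coef a k n) * x ^+ n <= n.+1%:R * (d^-1 / d ^+ k).
    rewrite -ler_sqr ?nnegrE ?mulr_ge0 ?invr_ge0 ?exprn_ge0 ?normc_ge0 ?(ltW x0) ?(ltW d0)//.
    apply: le_trans h _; rewrite [in leRHS]exprMn [leLHS]mulrC ler_wpM2r ?sqr_ge0//.
    by rewrite expr2 ler_peMl// ler1n.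
  move: h; rewrite /recenter_coef normcMn mulrA ler_pdivlMr ?exprn_gt0//.
  by rewrite (mulrnAl (normc _)) (mulrnAl (_ * _)).
have coef' n : normc (a n) * (x + d / 2) ^+ n <= 2 * n.+1%:R / d.
  rewrite (@exprDn_wide _ _ _ _ n.+1)// mulr_sumr.
  apply: (@le_trans _ _ (\sum_(0 <= k < n.+1) n.+1%:R / d * 2^-1 ^+ k)).
    rewrite big_mkord; apply: ler_sum => k _.
    have kn : (k <= n)%N by rewrite -ltnS.
    have := coef (n - k)%N k; rewrite subnK// => h.
    rewrite expr_div_n mulrA -mulrnAl mulrA -exprVn ler_wpM2r ?exprn_ge0//.
    rewrite mulrnAr mulrA; apply: le_trans h _.
    by rewrite ler_wpM2r ?invr_ge0 ?(ltW d0)// ler_nat ltnS leq_subr.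
  have := @geometric_tail _ (fun k => n.+1%:R / d * 2^-1 ^+ k) (n.+1%:R / d) 2^-1 0 n.+1.
  rewrite expr0 mulr1 => h; apply: le_trans (h _ _ _ _) _ => //; first by lra.
    by rewrite divr_ge0// ltW.
  by rewrite le_eqVlt; apply/orP; left; apply/eqP; field; rewrite gt_eqF.
have xd : x + d / 2 = rho + d / 4 by rewrite /x; lra.
rewrite -xd.
have aM' s : 0 < s < x + d / 2 -> exists M, ps_bound a s M.
  move=> /andP[s0 sx]; pose t := x + d / 2.
  have t0 : 0 < t by exact: lt_trans sx.
  exists (2 / d * (1 - s / t)^-1) => n.
  have -> : s = t * (s / t) by rewrite mulrC divfK// gt_eqF.
  rewrite exprMn mulrA.
  apply: (@le_trans _ _ (2 * n.+1%:R / d * (s / t) ^+ n)).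
    by rewrite ler_wpM2r ?exprn_ge0 ?divr_ge0 ?(ltW s0) ?(ltW t0)//; exact: coef'.
  rewrite (_ : 2 * n.+1%:R / d * _ = 2 / d * (n.+1%:R * (s / t) ^+ n)); last by ring.
  rewrite ler_wpM2l ?divr_ge0 ?(ltW d0)//.
  have -> : t * (s / t) / t = s / t by rewrite mulrC mulrA mulVf ?mul1r// gt_eqF.
  apply: expr_geometric_le; first by rewrite divr_ge0 ?(ltW s0) ?(ltW t0).
  by rewrite ltr_pdivrMr// mul1r.
split => // z zx.
have [zrho|rhoz] := ltP (normc z) rho; first exact: fa.
have z0 : 0 < normc z by apply: lt_le_trans rhoz; lra.
(* w = t z lies on the ray of z at radius rho - d / 2 < x, less than d away from z. Being on the ray
   gives |w| + |z - w| = |z|, so [recenter_ps] applies within the new radius. *)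
pose t := (rho - d / 2) / normc z.
have t0 : 0 < t by rewrite divr_gt0//; lra.
have tz : t * normc z = rho - d / 2 by rewrite divfK// gt_eqF.
pose w := t%:C * z.
have nw : normc w = rho - d / 2 by rewrite normcM normcC gtr0_norm.
have nzw : normc (z - w) = normc z - (rho - d / 2).
  have -> : z - w = (1 - t)%:C * z by rewrite /w rmorphB rmorph1; ring.
  rewrite normcM normcC ger0_norm; first by rewrite mulrBl mul1r tz.
  by rewrite subr_ge0 ler_pdivrMr// mul1r; lra.
have [_ ->] : ps_bound (recenter a w) d d^-1 /\
    forall z, normc (z - w) < d -> f z = ps (recenter a w) (z - w).
  by apply: near; rewrite nw /x; lra.
  pose s := (normc z + (x + d / 2)) / 2.
  have [|M' aM''] := aM' s; first by rewrite /s; lra.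
  rewrite (recenter_ps aM''); last by rewrite nw nzw /s; lra.
  by rewrite addrCA subrr addr0.
by rewrite nzw; lra.
Qed.

(** On |z| <= r the width d is uniform, so each extension gains the same amount d' / 4 and finitely
    many reach r. The coefficients are always those of the expansion at 0, hence the same for all
    r. *)
Lemma global_expansion : exists a, is_expansion a 1.
Proof.
have n0 : normc (0 : C) < 1 by rewrite normc0.
have [a [rho [M [rho0 aM fa]]]] := analytic_local n0; exists a.
have base : is_expansion a rho.
  split=> [s /andP[s0 sr]|z zr].
    by exists M; apply: ps_boundW aM; rewrite (ltW s0) (ltW sr).
  by have := fa z; rewrite subr0; exact.
have W x y : x <= y -> is_expansion a y -> is_expansion a x.
  move=> xy [h1 h2]; split=> [s /andP[s0 sx]|z zx]; last exact/h2/(lt_le_trans zx).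
  by apply: h1; rewrite s0 (lt_le_trans sx).
suff main r : 0 < r -> r < 1 -> is_expansion a r.
  split=> [s /andP[s0 s1]|z z1].
    by apply: (main ((s + 1) / 2) _ _).1; lra.
  have := normc_ge0 z => z0.
  by apply: (main ((normc z + 1) / 2) _ _).2; lra.
move=> r0 r1; have [d [d0 hd]] := expands_uniformly (ltW r0) r1.
pose d' := Num.min d rho.
have d'0 : 0 < d' by rewrite lt_min d0.
have d'd : d' <= d by rewrite ge_min lexx.
have d'rho : d' <= rho by rewrite ge_min lexx orbT.
have hd' z : normc z <= r -> expands_at d' z.
  by move=> zr; exact: expands_atW (hd z zr).
have step j : exists2 x, Num.min r (d' + j%:R * (d' / 4)) <= x & d' <= x /\ is_expansion a x.
  elim: j => [|j [x hx [dx ax]]].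
    exists d'; first by rewrite mul0r addr0 ge_min lexx orbT.
    by split => //; exact: W base.
  have [xr|rx] := leP x r; last first.
    by exists x => //; rewrite ge_min (ltW rx).
  exists (x + d' / 4).
    rewrite ge_min; apply/orP.
    move: hx; rewrite ge_min => /orP[rx|hx]; [left|right]; first by lra.
    by rewrite -addn1 natrD mulrDl mul1r addrA lerD2r.
  split; first by lra.
  apply: extend_expansion => // z zx; apply: hd'; exact: le_trans (ltW zx) xr.
have [j hj] : exists j : nat, r <= d' + j%:R * (d' / 4).
  have d4 : 0 < d' / 4 by rewrite divr_gt0.
  exists (Num.truncn (r / (d' / 4))).+1.
  have := truncnS_gt (r / (d' / 4)); rewrite ltr_pdivrMr// => /ltW h.
  by apply: le_trans h _; rewrite lerDr ltW.
have [x hx [_ ax]] := step j; apply: W ax; apply: le_trans hx.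
by rewrite le_min lexx.
Qed.

End GlobalExpansion.

(** * The Bergman space *)

Section RealLimits.
Context {R : realType}.

Lemma cvg_realX (u : nat -> R) (l : R) n : u @ \oo --> l -> (fun k => u k ^+ n) @ \oo --> l ^+ n.
Proof.
move=> ul; elim: n => [|n ih]; first exact: cvg_cst.
by under eq_fun do rewrite exprS; rewrite exprS; exact: (cvgM ul ih).
Qed.

Lemma cvg_real_sum I (r : seq I) (u : I -> nat -> R) (l : I -> R) :
  (forall i, u i @ \oo --> l i) ->
  (fun n => \sum_(i <- r) u i n) @ \oo --> \sum_(i <- r) l i.
Proof.
move=> ul; elim: r => [|i r ih].
  by under eq_fun do rewrite big_nil; rewrite big_nil; exact: cvg_cst.
by under eq_fun do rewrite big_cons; rewrite big_cons; exact: (cvgD (ul i) ih).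
Qed.

End RealLimits.

Section DiskSeries.
Context {R : realType}.
Local Notation C := R[i].
Local Notation E := (C -> C^o).
Local Notation R2 := (measurableTypeR R * measurableTypeR R)%type.
Local Notation mu := (@dA R).
Local Notation D := (@plane_disk R).
Implicit Types (a : nat -> C) (f : E).

Definition disk_coefs a := forall s, 0 < s < 1 -> exists M, ps_bound a s M.

Definition ps_on_disk a : E := fun z => if normc z < 1 then ps a z else 0.

(** Partial sums of the squared A^2 norm of the series, without the factor [disk_area 1]. *)
Definition bergman_sum a N : R := \sum_(k < N) normc (a k) ^+ 2 / k.+1%:R.

Definition sq_integral f := (\int[mu]_(p in D) (normc (f (plane p)) ^+ 2)%:E)%E.

Lemma bergman_sum_nd a N L : (N <= L)%N -> bergman_sum a N <= bergman_sum a L.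
Proof.
move=> NL; rewrite /bergman_sum -!(big_mkord xpredT (fun k => normc (a k) ^+ 2 / k.+1%:R)).
rewrite (@big_cat_nat _ _ _ N 0 L)//= lerDl; apply: sumr_ge0 => i _.
by rewrite divr_ge0 ?sqr_ge0.
Qed.

Lemma bergman_sumS a N : bergman_sum a N.+1 = bergman_sum a N + normc (a N) ^+ 2 / N.+1%:R.
Proof. by rewrite /bergman_sum big_ord_recr. Qed.

Lemma bergman_sum_ge0 a N : 0 <= bergman_sum a N.
Proof. by apply: sumr_ge0 => i _; rewrite divr_ge0 ?sqr_ge0. Qed.

Lemma bergman_disk_coefs a (B : R) : (forall N, bergman_sum a N <= B) -> disk_coefs a.
Proof.
move=> aB s /andP[s0 s1]; have B0 : 0 <= B := le_trans (bergman_sum_ge0 a 0) (aB 0%N).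
(* Cruder than the growth sqrt (k + 1) that the hypothesis gives, but [expr_geometric_le] handles k
   + 1 directly. *)
have ak k : normc (a k) <= (1 + B) * k.+1%:R.
  rewrite -ler_sqr ?nnegrE ?normc_ge0 ?mulr_ge0 ?addr_ge0//.
  have := aB k.+1; rewrite bergman_sumS => h.
  have : normc (a k) ^+ 2 / k.+1%:R <= B.
    by apply: le_trans h; rewrite lerDr bergman_sum_ge0.
  rewrite ler_pdivrMr// => /le_trans; apply.
  have k1 : 1 <= k.+1%:R :> R by rewrite ler1n.
  rewrite exprMn; apply: ler_pM => //.
    have -> : (1 + B) ^+ 2 = 1 + 2 * B + B ^+ 2 by ring.
    by have := sqr_ge0 B; lra.
  by rewrite expr2 ler_peMl// (le_trans _ k1).
exists ((1 + B) * (1 - s)^-1) => k.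
apply: (@le_trans _ _ ((1 + B) * (k.+1%:R * s ^+ k))).
  by rewrite mulrA ler_wpM2r ?exprn_ge0 ?(ltW s0).
by rewrite ler_wpM2l ?addr_ge0// expr_geometric_le// ltW.
Qed.

Lemma disk_coefs_cvg a z : disk_coefs a -> normc z < 1 -> cvgC (psum a ^~ z) (ps a z).
Proof.
move=> ha z1; have z0 := normc_ge0 z.
have [|M hM] := ha ((normc z + 1) / 2); first by apply/andP; split; lra.
by apply: (ps_cvg hM); lra.
Qed.

Lemma cmeas_psum a n (A : set R2) : cmeas A (fun p => psum a n (plane p)).
Proof.
apply: cmeas_sum => i; apply: cmeasM; first exact: cmeas_cst.
by apply: cmeasX; exact: cmeas_plane.
Qed.

Lemma cvgC_Re (u : nat -> C) (l : C) : cvgC u l ->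
  (fun n => Re (u n)) @ \oo --> Re l /\ (fun n => Im (u n)) @ \oo --> Im l.
Proof.
move=> /cvgrPdist_lt ul; split; apply/cvgrPdist_lt => e /ul; apply: filterS => n.
- rewrite sub0r normrN ger0_norm ?normc_ge0//; apply: le_lt_trans.
  by rewrite normcB -cReN -cReD; exact: normc_Re.
- rewrite sub0r normrN ger0_norm ?normc_ge0//; apply: le_lt_trans.
  by rewrite normcB -cImN -cImD; exact: normc_Im.
Qed.

Lemma cvgC_normc (u : nat -> C) (l : C) : cvgC u l -> (fun n => normc (u n)) @ \oo --> normc l.
Proof.
move=> /cvgrPdist_lt ul; apply/cvgrPdist_lt => e /ul; apply: filterS => n.
rewrite sub0r normrN ger0_norm ?normc_ge0//; apply: le_lt_trans.
rewrite ler_norml; have := normc_le_sub (u n) l; have := normc_le_sub l (u n).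
by rewrite (normcB l); lra.
Qed.

Lemma cmeas_ps a : disk_coefs a -> cmeas D (fun p => ps a (plane p)).
Proof.
move=> ha; split.
- apply: (@measurable_fun_cvg _ _ _ _ (fun n (p : R2) => Re (psum a n (plane p)))).
    by move=> n; exact: (cmeas_psum a n D).1.
  by move=> p Dp; exact: (cvgC_Re (disk_coefs_cvg ha Dp)).1.
- apply: (@measurable_fun_cvg _ _ _ _ (fun n (p : R2) => Im (psum a n (plane p)))).
    by move=> n; exact: (cmeas_psum a n D).2.
  by move=> p Dp; exact: (cvgC_Re (disk_coefs_cvg ha Dp)).2.
Qed.

Lemma ps_on_diskE a z : normc z < 1 -> ps_on_disk a z = ps a z.
Proof. by rewrite /ps_on_disk => ->. Qed.

Lemma cmeas_ps_on_disk a : disk_coefs a -> cmeas D (fun p => ps_on_disk a (plane p)).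
Proof.
by move=> /cmeas_ps; apply: eq_cmeas => p Dp; rewrite ps_on_diskE.
Qed.

Lemma analytic_ps_on_disk a : disk_coefs a -> analytic_on_disk (ps_on_disk a).
Proof.
move=> ha z0 z01; exists (recenter a z0), (1 - normc z0).
split => [|z zr]; first by rewrite subr_gt0.
apply/cvgCP.
have z1 : normc z < 1.
  by rewrite -(subrK z0 z); apply: le_lt_trans (normcD _ _) _; rewrite -ltrBrDr.
rewrite ps_on_diskE//.
pose s := (normc z0 + normc (z - z0) + 1) / 2.
have h0 := normc_ge0 z0; have h1 := normc_ge0 (z - z0).
have [|M hM] := ha s; first by rewrite /s; apply/andP; split; lra.
have := @recenter_cvg _ a s M z0 (z - z0) hM; rewrite addrCA subrr addr0 => h.
apply: eq_cvgC (h _) => [n|]; last by rewrite /s; lra.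
by rewrite /series/= /psum big_mkord.
Qed.

Lemma dA_diskE (r : R) : 0 <= r -> mu (disk r) = (disk_area r)%:E.
Proof. by move=> r0; rewrite fineK// ge0_fin_numE ?measure_ge0// dA_disk_lty. Qed.

Lemma sq_integral_psum_disk r a n : 0 <= r ->
  (\int[mu]_(p in disk r) (normc (psum a n (plane p)) ^+ 2)%:E)%E
  = (disk_area r * \sum_(k < n) normc (a k) ^+ 2 * r ^+ (2 * k) / k.+1%:R)%:E.
Proof.
move=> r0; rewrite -norm2_polynomial//.
rewrite /Rintegral fineK// ge0_fin_numE; last first.
  by apply: integral_ge0 => p _; rewrite lee_fin sqr_ge0.
have [_ [M hM]] : cbounded (disk r) (fun p => psum a n (plane p)).
  apply: cbounded_sum => i; apply: cboundedM; first exact: cbounded_cst.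
  by apply: cboundedX; exact: cbounded_plane.
have mD := measurable_disk r.
apply: (@le_lt_trans _ _ (\int[mu]_(p in disk r) (M ^+ 2)%:E)%E).
  apply: ge0_le_integral => //.
  - by move=> p _; rewrite lee_fin sqr_ge0.
  - by apply/measurable_EFinP/cmeas_normc2/cmeas_psum.
  - move=> p Dp; rewrite lee_fin lerXn2r ?nnegrE ?normc_ge0 ?hM//.
    exact: le_trans (normc_ge0 _) (hM _ Dp).
rewrite integral_cst// lte_mul_pinfty ?lee_fin ?sqr_ge0//.
exact: dA_disk_lty.
Qed.

Lemma sq_integral_psum a n : (\int[mu]_(p in D) (normc (psum a n (plane p)) ^+ 2)%:E)%E
  = (disk_area 1 * bergman_sum a n)%:E.
Proof.
rewrite plane_diskE sq_integral_psum_disk//; congr (_ * _)%:E; apply: eq_bigr => k _.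
by rewrite expr1n mulr1.
Qed.

(** Fatou's lemma for the partial sums, whose squared norms are known exactly by orthogonality. *)
Lemma sq_integral_le a (B : R) : (forall N, bergman_sum a N <= B) ->
  (sq_integral (ps_on_disk a) <= (disk_area 1 * B)%:E)%E.
Proof.
move=> aB; have ha := bergman_disk_coefs aB.
pose g n (p : R2) := (normc (psum a n (plane p)) ^+ 2)%:E.
have -> : sq_integral (ps_on_disk a) = (\int[mu]_(p in D) limn_einf (g^~ p))%E.
  apply: eq_integral => p /set_mem Dp; rewrite ps_on_diskE//.
  have h : (g ^~ p) @ \oo --> (normc (ps a (plane p)) ^+ 2)%:E.
    apply: cvg_EFin; first exact: nearW.
    have hc := cvgC_normc (disk_coefs_cvg ha Dp).
    exact: (cvgM hc hc).
  by rewrite is_cvg_limn_einfE; [apply/esym/cvg_lim|apply/cvg_ex; eexists; exact: h].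
apply: le_trans (fatou _ _ _ _) _ => //.
- exact: measurable_plane_disk.
- by move=> n; apply/measurable_EFinP/cmeas_normc2/cmeas_psum.
- by move=> n p _; rewrite lee_fin sqr_ge0.
rewrite limn_einf_lim; apply: lime_le; first exact: is_cvg_einfs.
apply: nearW => n; apply: (@le_trans _ _ (\int[mu]_(p in D) g n p)%E).
  by apply: ereal_inf_lbound; exists n => /=.
rewrite /g sq_integral_psum lee_fin ler_wpM2l// ltW// disk_area_gt0//.
Qed.

Lemma disk_area_cvg : (fun n => disk_area (1 - n.+1%:R^-1)) @ \oo --> (disk_area 1 : R).
Proof.
pose F n : set R2 := disk (1 - n.+1%:R^-1).
have e0 n : 0 <= 1 - n.+1%:R^-1 :> R by rewrite subr_ge0 invf_le1// ler1n.
have UF : \bigcup_n F n = disk 1.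
  apply/seteqP; split => [p [n _ /(diskE _ (e0 n)) h]|p /(diskE _ (@ler01 R)) h].
    apply/(diskE _ (@ler01 R)); apply: lt_le_trans h _.
    by rewrite gerBl.
  have p0 : 0 < 1 - normc (plane p) by rewrite subr_gt0.
  exists (Num.truncn (1 - normc (plane p))^-1) => //.
  apply/(diskE _ (e0 _)); rewrite ltrBrDl -ltrBrDr invf_plt ?posrE//.
  exact: truncnS_gt.
have ndF : nondecreasing_seq F.
  move=> m n mn; apply/subsetPset => p /(diskE _ (e0 m)) h; apply/(diskE _ (e0 n)).
  apply: lt_le_trans h _; rewrite lerD2l lerN2 lef_pV2 ?posrE//.
  by rewrite ler_nat.
have := nondecreasing_cvg_mu (mu := mu) (fun n => measurable_disk _) _ ndF.
rewrite UF => /(_ (measurable_disk _)) h.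
apply: fine_cvg; rewrite fineK; first exact: h.
rewrite ge0_fin_numE ?measure_ge0//; exact: dA_disk_lty.
Qed.

(** On a smaller disk of radius r the partial sums converge uniformly, so the inequality with
    weights r^(2 k) holds in the limit; then r tends to 1. *)
Lemma sq_integral_ge a N : disk_coefs a -> (sq_integral (ps_on_disk a) < +oo)%E ->
  disk_area 1 * bergman_sum a N <= fine (sq_integral (ps_on_disk a)).
Proof.
move=> ha fI; set I := fine _.
have mf := cmeas_ps_on_disk ha.
have main r : 0 < r -> r < 1 ->
    disk_area r * \sum_(k < N) normc (a k) ^+ 2 * r ^+ (2 * k) / k.+1%:R <= I.
  move=> r0 r1; pose rho := (r + 1) / 2.
  have rrho : r < rho by rewrite /rho; lra.
  have rho1 : rho < 1 by rewrite /rho; lra.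
  have rho0 : 0 < rho by exact: lt_trans rrho.
  have [|M hM] := ha rho; first by rewrite rho0.
  pose e n := 2 * (M * (r / rho) ^+ n / (1 - r / rho)).
  have e0 : e @ \oo --> (0 : R).
    apply: tail_cvg0; first by rewrite divr_ge0// ltW.
    by rewrite ltr_pdivrMr// mul1r.
  (* [K] bounds |f| on the smaller disk and [e n] its distance to the n-th partial sum S_n, so
     |S_n|^2 <= |f|^2 + e n (2 K + e n). *)
  pose K := 2 * (M / (1 - r / rho)).
  have mD := measurable_disk r; have fD := dA_disk_lty (ltW r0).
  have DD : disk r `<=` D.
    by move=> p /(diskE p (ltW r0)) h; rewrite /plane_disk/= /unit_disk/=; exact: lt_trans r1.
  have le n : (N <= n)%N -> disk_area r * \sum_(k < N) normc (a k) ^+ 2 * r ^+ (2 * k) / k.+1%:R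
     <= I + disk_area r * (e n * (2 * K + e n)).
    move=> Nn.
    apply: (@le_trans _ _
        (disk_area r * \sum_(k < n) normc (a k) ^+ 2 * r ^+ (2 * k) / k.+1%:R)).
      rewrite ler_wpM2l//; first by rewrite ltW// disk_area_gt0.
      rewrite -!(big_mkord xpredT (fun k => normc (a k) ^+ 2 * r ^+ (2 * k) / k.+1%:R)).
      rewrite [leRHS](@big_cat_nat _ _ _ N)//= lerDl; apply: sumr_ge0 => i _.
      by rewrite divr_ge0// mulr_ge0 ?sqr_ge0// exprn_ge0// ltW.
    have eK0 : 0 <= e n * (2 * K + e n).
      have M0 := ps_bound_ge0 hM.
      have q0 : 0 <= r / rho by rewrite divr_ge0// ltW.
      have q1 : 0 <= 1 - r / rho by rewrite subr_ge0 ler_pdivrMr// mul1r ltW.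
      have en0 : 0 <= e n by rewrite mulr_ge0// divr_ge0// mulr_ge0// exprn_ge0.
      by rewrite mulr_ge0// addr_ge0// mulr_ge0// mulr_ge0// divr_ge0.
    rewrite -lee_fin -sq_integral_psum_disk ?(ltW r0)//.
    apply: (@le_trans _ _ (\int[mu]_(p in disk r)
        ((normc (ps_on_disk a (plane p)) ^+ 2)%:E + cst (e n * (2 * K + e n))%:E p))%E).
      apply: ge0_le_integral => //.
      - by move=> p _; rewrite lee_fin sqr_ge0.
      - by apply/measurable_EFinP/cmeas_normc2/cmeas_psum.
      - apply: emeasurable_funD; last exact: measurable_cst.
        apply/measurable_EFinP/cmeas_normc2; apply: cmeasS DD mf; exact: measurable_plane_disk.
      - move=> p Dp; rewrite -EFinD lee_fin.
        have pr : normc (plane p) < r by exact/(diskE p (ltW r0)).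
        rewrite ps_on_diskE; last exact: lt_trans r1.
        have h1 := ps_tail n rho0 hM (ltW pr) rrho; rewrite -/(e n) in h1.
        have h2 := ps_le rho0 hM (ltW pr) rrho; rewrite -/K in h2.
        have h3 := normc_le_sub (psum a n (plane p)) (ps a (plane p)).
        have h4 : normc (psum a n (plane p)) <= normc (ps a (plane p)) + e n by lra.
        have h5 := normc_ge0 (ps a (plane p)); have h6 := normc_ge0 (psum a n (plane p)).
        have h7 : 0 <= e n := le_trans (normc_ge0 _) h1.
        move: h1 h2 h3 h4 h5 h6 h7; clear eK0.
        move: (normc (ps a (plane p))) (normc (psum a n (plane p))) (e n) K => x y t k.
        move=> _ xk _ yxt x0 y0 t0.
        apply: (@le_trans _ _ ((x + t) ^+ 2)); first by rewrite lerXn2r ?nnegrE ?addr_ge0.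
        rewrite (_ : (x + t) ^+ 2 = x ^+ 2 + t * (2 * x + t)); last by ring.
        by rewrite lerD2l ler_wpM2l// lerD2r ler_wpM2l.
    rewrite ge0_integralD//; last 2 first.
    - by move=> p _; rewrite lee_fin sqr_ge0.
    - apply/measurable_EFinP/cmeas_normc2; apply: cmeasS DD mf; exact: measurable_plane_disk.
    rewrite EFinD; apply: leeD.
      rewrite fineK; last by rewrite ge0_fin_numE// integral_ge0// => p _; rewrite lee_fin sqr_ge0.
      apply: ge0_subset_integral => //.
      - exact: measurable_plane_disk.
      - exact/measurable_EFinP/cmeas_normc2.
      - by move=> p _; rewrite lee_fin sqr_ge0.
    by rewrite integral_cst// dA_diskE ?(ltW r0)// -EFinM lee_fin mulrC.
  have : (fun n => I + disk_area r * (e n * (2 * K + e n))) @ \oo -->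
      I + disk_area r * (0 * (2 * K + 0)).
    have h : (fun n => 2 * K + e n) @ \oo --> 2 * K + 0 by apply: cvgD => //; exact: cvg_cst.
    apply: cvgD; first exact: cvg_cst.
    by apply: cvgM; [exact: cvg_cst|exact: (cvgM e0 h)].
  rewrite mul0r mulr0 addr0 => lim.
  by apply: (cvgr_to_ge lim); exists N => // n /= Nn; exact: le.
pose r n : R := 1 - n.+2%:R^-1.
have rlim : r @ \oo --> (1 : R).
  rewrite -[X in _ --> X]subr0; apply: cvgB; first exact: cvg_cst.
  have := @cvg_harmonic R; rewrite -cvg_shiftS; exact.
have alim : (fun n => disk_area (r n)) @ \oo --> (disk_area 1 : R).
  have := disk_area_cvg; rewrite -cvg_shiftS; exact.
have slim : (fun n => \sum_(k < N) normc (a k) ^+ 2 * r n ^+ (2 * k) / k.+1%:R) @ \oo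
    --> bergman_sum a N.
  apply: cvg_real_sum => k.
  have : (fun n => normc (a k) ^+ 2 * r n ^+ (2 * k) / k.+1%:R) @ \oo -->
      normc (a k) ^+ 2 * 1 ^+ (2 * k) / k.+1%:R.
    apply: cvgM; last exact: cvg_cst.
    by apply: cvgM; [exact: cvg_cst|exact: cvg_realX].
  by rewrite expr1n mulr1.
apply: (cvgr_to_le (cvgM alim slim)); apply: nearW => n; apply: main.
- by rewrite subr_gt0 invf_lt1// ltr1n.
- by rewrite gtrBl.
Qed.

End DiskSeries.

(** * The inner product of L^2(dA) *)

Section L2Space.
Context {R : realType}.
Local Notation C := R[i].
Local Notation E := (C -> C^o).
Local Notation R2 := (measurableTypeR R * measurableTypeR R)%type.
Local Notation mu := (@dA R).
Local Notation D := (@plane_disk R).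
Implicit Types (f g h u : E).

Let mD := @measurable_plane_disk R.

Lemma L2P f : L2 f <-> cmeas D (fun p => f (plane p)) /\ (sq_integral f < +oo)%E.
Proof. by split => [[? ? ?]|[[? ?] ?]]; split. Qed.

Lemma L2_cmeas f : L2 f -> cmeas D (fun p => f (plane p)).
Proof. by move=> /L2P[]. Qed.

Lemma L2_le f g h (k : R) : 0 <= k -> L2 f -> L2 g -> cmeas D (fun p => h (plane p)) ->
  (forall z, normc z < 1 -> normc (h z) ^+ 2 <= k * (normc (f z) ^+ 2 + normc (g z) ^+ 2)) ->
  L2 h.
Proof.
move=> k0 /L2P[mf fI] /L2P[mg gI] mh hk; apply/L2P; split => //.
have mf2 : measurable_fun D (fun p => (normc (f (plane p)) ^+ 2)%:E).
  exact/measurable_EFinP/cmeas_normc2.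
have mg2 : measurable_fun D (fun p => (normc (g (plane p)) ^+ 2)%:E).
  exact/measurable_EFinP/cmeas_normc2.
apply: (@le_lt_trans _ _ (\int[mu]_(p in D)
   (k%:E * ((normc (f (plane p)) ^+ 2)%:E + (normc (g (plane p)) ^+ 2)%:E)))%E).
  apply: ge0_le_integral => //.
  - by move=> p _; rewrite lee_fin sqr_ge0.
  - exact/measurable_EFinP/cmeas_normc2.
  - by apply: emeasurable_funM => //; exact: emeasurable_funD.
  - by move=> p Dp; rewrite -EFinD -EFinM lee_fin; exact: hk.
rewrite ge0_integralZl//; last 2 first.
- exact: emeasurable_funD.
- by move=> p _; rewrite -EFinD lee_fin addr_ge0 ?sqr_ge0.
rewrite lte_mul_pinfty// ge0_integralD//; try by move=> p _; rewrite lee_fin sqr_ge0.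
exact: lte_add_pinfty.
Qed.

Lemma sqr_sum_le (x y : R) : (x + y) ^+ 2 <= 2 * (x ^+ 2 + y ^+ 2).
Proof. by have := sqr_ge0 (x - y); rewrite sqrrB sqrrD; lra. Qed.

Lemma L2D f g : L2 f -> L2 g -> L2 (f + g).
Proof.
move=> Lf Lg; apply: (@L2_le f g _ 2) => //.
  by apply: cmeasD; exact: L2_cmeas.
move=> z _; apply: le_trans (sqr_sum_le _ _).
by rewrite lerXn2r ?nnegrE ?addr_ge0 ?normc_ge0// normcD.
Qed.

Lemma L2_mull u f (B : R) : cmeas D (fun p => u (plane p)) ->
  (forall z, normc z < 1 -> normc (u z) <= B) -> L2 f -> L2 (fun z => u z * f z).
Proof.
move=> mu' uB Lf; apply: (@L2_le f f _ (B ^+ 2)) => //; first exact: sqr_ge0.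
  by apply: cmeasM => //; exact: L2_cmeas.
move=> z z1; rewrite normcM exprMn.
apply: (@le_trans _ _ (B ^+ 2 * normc (f z) ^+ 2)).
  rewrite ler_wpM2r ?sqr_ge0// lerXn2r ?nnegrE ?normc_ge0 ?uB//.
  exact: le_trans (normc_ge0 _) (uB _ z1).
by rewrite ler_wpM2l ?sqr_ge0// lerDl sqr_ge0.
Qed.

Lemma L2Z c f : L2 f -> L2 (c *: f).
Proof.
move=> Lf; apply: (@L2_mull (fun=> c) f (normc c)) => //; exact: cmeas_cst.
Qed.

Lemma L2B f g : L2 f -> L2 g -> L2 (f - g).
Proof. by move=> Lf Lg; rewrite -scaleN1r; apply: L2D => //; exact: L2Z. Qed.

Lemma L2_0 : L2 (0 : E).
Proof.
apply/L2P; split; first exact: cmeas_cst.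
by rewrite /sq_integral integral0_eq// => p _; rewrite normc0 expr0n.
Qed.

Lemma L2_prod_integrable f g : L2 f -> L2 g ->
  cintegrable mu D (fun p => f (plane p) * (g (plane p))^*).
Proof.
move=> Lf Lg; have mfg := cmeasM (L2_cmeas Lf) (cmeasJ (L2_cmeas Lg)).
have i1 h : L2 h -> mu.-integrable D (fun p => (normc (h (plane p)) ^+ 2)%:E).
  move=> /L2P[mh hI]; apply/integrableP; split.
    by apply/measurable_EFinP/cmeas_normc2.
  by under eq_integral do rewrite gee0_abs ?lee_fin ?sqr_ge0//.
have ifg := integrableD mD (i1 _ Lf) (i1 _ Lg).
have key (z w : C) : normc (z * w^*) <= normc z ^+ 2 + normc w ^+ 2.
  rewrite normcM normcJ; have := sqr_ge0 (normc z - normc w); rewrite sqrrB.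
  have := sqr_ge0 (normc z); have := sqr_ge0 (normc w).
  by have := normc_ge0 z; have := normc_ge0 w; nra.
split.
- apply: (le_integrable mD _ _ ifg).
    by apply/measurable_EFinP; exact: mfg.1.
  move=> p _ /=; rewrite lee_fin [leRHS]ger0_norm ?addr_ge0 ?sqr_ge0//.
  exact: le_trans (normc_Re _) (key _ _).
- apply: (le_integrable mD _ _ ifg).
    by apply/measurable_EFinP; exact: mfg.2.
  move=> p _ /=; rewrite lee_fin [leRHS]ger0_norm ?addr_ge0 ?sqr_ge0//.
  exact: le_trans (normc_Im _) (key _ _).
Qed.

Lemma L2dotDl f g h : L2 f -> L2 g -> L2 h -> L2dot (f + g) h = L2dot f h + L2dot g h.
Proof.
move=> Lf Lg Lh; rewrite -[RHS](cintD mD (L2_prod_integrable Lf Lh) (L2_prod_integrable Lg Lh)).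
by apply: eq_cint => p _; rewrite -mulrDl.
Qed.

Lemma L2dotZl c f h : L2 f -> L2 h -> L2dot (c *: f) h = c * L2dot f h.
Proof.
move=> Lf Lh; rewrite -[RHS](cintZ c mD (L2_prod_integrable Lf Lh)).
by apply: eq_cint => p _; rewrite mulrA.
Qed.

Lemma L2dotJ f g : L2 f -> L2 g -> (L2dot f g)^* = L2dot g f.
Proof.
move=> Lf Lg; rewrite -(cintJ mD (L2_prod_integrable Lf Lg)).
by apply: eq_cint => p _; rewrite conjcM conjc_invol mulrC.
Qed.

Lemma L2dotDr f g h : L2 f -> L2 g -> L2 h -> L2dot h (f + g) = L2dot h f + L2dot h g.
Proof.
by move=> Lf Lg Lh; rewrite -L2dotJ ?L2dotDl ?conjcD ?L2dotJ//; exact: L2D.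
Qed.

Lemma L2dotZr c f h : L2 f -> L2 h -> L2dot h (c *: f) = c^* * L2dot h f.
Proof. by move=> Lf Lh; rewrite -L2dotJ ?L2dotZl ?conjcM ?L2dotJ//; exact: L2Z. Qed.

Lemma L2dotBl f g h : L2 f -> L2 g -> L2 h -> L2dot (f - g) h = L2dot f h - L2dot g h.
Proof.
by move=> Lf Lg Lh; rewrite -scaleN1r L2dotDl ?L2dotZl ?mulN1r//; exact: L2Z.
Qed.

Lemma L2dotBr f g h : L2 f -> L2 g -> L2 h -> L2dot h (f - g) = L2dot h f - L2dot h g.
Proof. by move=> Lf Lg Lh; rewrite -L2dotJ ?L2dotBl ?conjcB ?L2dotJ//; exact: L2B. Qed.

Lemma L2dot_suml I (r : seq I) (F : I -> E) h : (forall i, L2 (F i)) -> L2 h ->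
  L2 (\sum_(i <- r) F i) /\ L2dot (\sum_(i <- r) F i) h = \sum_(i <- r) L2dot (F i) h.
Proof.
move=> LF Lh; elim: r => [|i r [ih1 ih2]].
  rewrite !big_nil; split; first exact: L2_0.
  by rewrite -(scale0r (0 : E)) L2dotZl ?mul0r//; exact: L2_0.
by rewrite !big_cons L2dotDl// ih2; split => //; exact: L2D.
Qed.

Lemma eq_L2dot f f' g g' : (forall z, normc z < 1 -> f z = f' z) ->
  (forall z, normc z < 1 -> g z = g' z) -> L2dot f g = L2dot f' g'.
Proof. by move=> ff gg; apply: eq_cint => p Dp; rewrite ff// gg. Qed.

Definition nrm2 f : R := fine (sq_integral f).

Lemma L2dot_nrm2 f : L2dot f f = (nrm2 f)%:C.
Proof. exact: (cint_normc2 mu D (fun p => f (plane p))). Qed.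

Lemma nrm2_ge0 f : 0 <= nrm2 f.
Proof.
by apply: fine_ge0; apply: integral_ge0 => p _; rewrite lee_fin sqr_ge0.
Qed.

Lemma nrm2Z c f : L2 f -> nrm2 (c *: f) = normc c ^+ 2 * nrm2 f.
Proof.
move=> Lf; have Lcf := L2Z c Lf; apply: complexI.
by rewrite -L2dot_nrm2 L2dotZl// L2dotZr// mulrA mulcJ L2dot_nrm2 -rmorphM.
Qed.

Lemma nrm2D f g : L2 f -> L2 g -> nrm2 (f + g) = nrm2 f + 2 * Re (L2dot f g) + nrm2 g.
Proof.
move=> Lf Lg; have Lfg := L2D Lf Lg.
have <- : Re (L2dot (f + g) (f + g)) = nrm2 (f + g) by rewrite L2dot_nrm2.
rewrite L2dotDl// !L2dotDr// !L2dot_nrm2 -(L2dotJ Lf Lg) !ReImE; ring.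
Qed.

Lemma nrm2B f g : L2 f -> L2 g -> nrm2 (f - g) = nrm2 f - 2 * Re (L2dot f g) + nrm2 g.
Proof.
move=> Lf Lg; rewrite -scaleN1r nrm2D ?nrm2Z ?L2dotZr//; last exact: L2Z.
rewrite normcN normc1 expr1n mul1r; congr (_ + _ + _).
have -> : (-1 : C)^* = -1 by rewrite conjcN; congr (- _); exact: conjc1.
by rewrite mulN1r cReN mulrN.
Qed.

Lemma L2_CauchySchwarz f g : L2 f -> L2 g -> normc (L2dot f g) ^+ 2 <= nrm2 f * nrm2 g.
Proof.
move=> Lf Lg; set s := L2dot f g.
(* Subtracting t s g with t real makes the cross term real without choosing a phase; t = 1 / ||g||^2
   is optimal when g is not null. *)
have key (t : R) : 0 <= nrm2 f - 2 * t * normc s ^+ 2 + t ^+ 2 * normc s ^+ 2 * nrm2 g.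
  have := nrm2_ge0 (f - (t%:C * s) *: g).
  rewrite nrm2B ?nrm2Z ?L2dotZr//; last exact: L2Z.
  rewrite -/s conjcM mulrAC -mulrA mulcJ normcM normcC exprMn real_normK ?num_real//.
  rewrite !ReImE oppr0 mulr0 subr0 => h; apply: le_trans h _.
  by rewrite le_eqVlt; apply/orP; left; apply/eqP; ring.
have g0 := nrm2_ge0 g; have s0 := sqr_ge0 (normc s).
have [gz|gnz] := eqVneq (nrm2 g) 0.
  rewrite gz mulr0 leNgt; apply/negP => s1.
  have ns : normc s != 0 by rewrite -sqrf_eq0 gt_eqF.
  have := key ((nrm2 f + 1) / (2 * normc s ^+ 2)).
  rewrite gz mulr0 addr0 (_ : 2 * _ * _ = nrm2 f + 1); last by field.
  lra.
have gpos : 0 < nrm2 g by rewrite lt_neqAle eq_sym gnz g0.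
have := key (nrm2 g)^-1.
rewrite (_ : _ - _ + _ = nrm2 f - normc s ^+ 2 / nrm2 g); last by field.
by rewrite subr_ge0 ler_pdivrMr.
Qed.

Lemma L2dot_le f g : L2 f -> L2 g ->
  normc (L2dot f g) <= Num.sqrt (nrm2 f) * Num.sqrt (nrm2 g).
Proof.
move=> Lf Lg; rewrite -ler_sqr ?nnegrE ?normc_ge0 ?mulr_ge0 ?sqrtr_ge0//.
rewrite exprMn (sqr_sqrtr (nrm2_ge0 f)) (sqr_sqrtr (nrm2_ge0 g)).
exact: L2_CauchySchwarz.
Qed.

End L2Space.

(** * Orthogonal expansions and the projection onto A^2 *)

Section BergmanSpace.
Context {R : realType}.
Local Notation C := R[i].
Local Notation E := (C -> C^o).
Local Notation mu := (@dA R).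
Local Notation c := (@disk_area R 1).
Implicit Types (a : nat -> C) (f g h q : E) (p : {poly C}).

Let c0 : 0 < c. Proof. exact: disk_area_gt0. Qed.
Let c_neq0 : c != 0. Proof. by rewrite gt_eqF. Qed.
Let succ_neq0 k : k.+1%:R != 0 :> R. Proof. by rewrite pnatr_eq0. Qed.

Lemma add_funE f g z : (f + g) z = f z + g z. Proof. by []. Qed.
Lemma opp_funE f z : (- f) z = - f z. Proof. by []. Qed.
Lemma scale_funE x f z : (x *: f) z = x * f z. Proof. by []. Qed.

Lemma weight_cancel (u A d : R) : u != 0 ->
  u * (A * (d ^+ 2 / u ^+ 2)) = d ^+ 2 * (A / u).
Proof. by move=> u0; field. Qed.

Lemma scale_cancel (d V : R) : d != 0 -> d * (d * (V / d ^+ 2)) = V.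
Proof. by move=> d0; field. Qed.

Lemma ratio_cancel (u d : R) : u != 0 -> d != 0 -> u / d * (d / u) = 1.
Proof. by move=> u0 d0; field; apply/andP. Qed.

Lemma weight_cancel2 (u d X : R) : u != 0 -> d != 0 ->
  d * (u ^+ 2 / d ^+ 2 * X / u * d) = u * X.
Proof. by move=> u0 d0; field; apply/andP. Qed.

Lemma disk_coefsD a a' : disk_coefs a -> disk_coefs a' -> disk_coefs (fun k => a k + a' k).
Proof.
move=> h h' s s01; have [M hM] := h s s01; have [M' hM'] := h' s s01.
by exists (M + M'); apply: ps_boundD => //; case/andP: s01 => /ltW.
Qed.

Lemma disk_coefsZ x a : disk_coefs a -> disk_coefs (fun k => x * a k).
Proof. by move=> h s /h[M hM]; exists (normc x * M); exact: ps_boundZ. Qed.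

Lemma disk_coefs_psE a z l : cvgC (psum a ^~ z) l -> normc z < 1 -> ps_on_disk a z = l.
Proof. by move=> h z1; rewrite ps_on_diskE// (psE h). Qed.

Lemma ps_on_diskD a a' : disk_coefs a -> disk_coefs a' ->
  ps_on_disk (fun k => a k + a' k) = ps_on_disk a + ps_on_disk a'.
Proof.
move=> h h'; apply/funext => z; rewrite add_funE /ps_on_disk; case: ifPn => z1; last by rewrite addr0.
apply: psE; apply: eq_cvgC (cvgCD (disk_coefs_cvg h z1) (disk_coefs_cvg h' z1)) => n.
by rewrite /psum -big_split; apply: eq_bigr => i _; rewrite mulrDl.
Qed.

Lemma ps_on_diskZ x a : disk_coefs a ->
  ps_on_disk (fun k => x * a k) = x *: ps_on_disk a.
Proof.
move=> h; apply/funext => z; rewrite scale_funE /ps_on_disk; case: ifPn => z1; last by rewrite mulr0.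
apply: psE; apply: eq_cvgC (cvgCZ x (disk_coefs_cvg h z1)) => n.
by rewrite /psum mulr_sumr; apply: eq_bigr => i _; rewrite mulrA.
Qed.

(** The passage from local analyticity to one Taylor series at 0; from here on elements of A^2 are
    handled through coefficients. *)
Lemma bergmanP f : bergman f <-> exists a, [/\ disk_coefs a, f = ps_on_disk a & L2 f].
Proof.
split=> [[fA Lf f0]|[a [ha -> La]]].
  have [a [ha fa]] := global_expansion fA; exists a; split => //.
  apply/funext => z; rewrite /ps_on_disk; case: ifPn => z1; first exact: fa.
  by rewrite f0//; exact/negP.
split => //; first exact: analytic_ps_on_disk.
by move=> z z1; rewrite /ps_on_disk; case: ifPn.
Qed.

Lemma bergman_L2 f : bergman f -> L2 f. Proof. by case. Qed.

Lemma bergmanD f g : bergman f -> bergman g -> bergman (f + g).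
Proof.
move=> /bergmanP[a [ha fa Lf]] /bergmanP[a' [ha' ga' Lg]]; apply/bergmanP.
exists (fun k => a k + a' k); split; [exact: disk_coefsD| |exact: L2D].
by rewrite ps_on_diskD// fa ga'.
Qed.

Lemma bergmanZ x f : bergman f -> bergman (x *: f).
Proof.
move=> /bergmanP[a [ha fa Lf]]; apply/bergmanP.
exists (fun k => x * a k); split; [exact: disk_coefsZ| |exact: L2Z].
by rewrite ps_on_diskZ// fa.
Qed.

Lemma bergmanB f g : bergman f -> bergman g -> bergman (f - g).
Proof. by move=> bf bg; rewrite -scaleN1r; apply: bergmanD => //; exact: bergmanZ. Qed.

Lemma psum_poly p n z : (size p <= n)%N -> psum (fun k => p`_k) n z = p.[z].
Proof. by move=> pn; rewrite (horner_coef_wide _ pn). Qed.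

Lemma disk_coefs_poly p : disk_coefs (fun k => p`_k).
Proof.
move=> s /andP[s0 s1]; exists (\sum_(k < size p) normc p`_k) => k.
have [pk|kp] := leqP (size p) k.
  by rewrite nth_default// normc0 mul0r; apply: sumr_ge0 => i _; exact: normc_ge0.
rewrite (bigD1 (Ordinal kp))//=; apply: (@le_trans _ _ (normc p`_k)).
  by rewrite -[leRHS]mulr1 ler_wpM2l ?normc_ge0// exprn_ile1// ltW.
by rewrite lerDl; apply: sumr_ge0 => i _; exact: normc_ge0.
Qed.

Lemma ps_poly p : ps_on_disk (fun k => p`_k) = poly_on_disk p.
Proof.
apply/funext => z; rewrite /ps_on_disk /poly_on_disk; case: ifPn => // z1.
apply: psE; apply: (@cvgC_le _ _ _ (fun n => if (n < size p)%N then
   normc (psum (fun k => p`_k) n z - p.[z]) else 0)).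
  by move=> n; case: ltnP => // pn; rewrite psum_poly// subrr normc0.
apply: cvg_near_cst; exists (size p) => // n /= pn.
by rewrite ltnNge pn.
Qed.

Lemma bergman_sum_poly p N : bergman_sum (fun k => p`_k) N <= bergman_sum (fun k => p`_k) (size p).
Proof.
have [Np|pN] := leqP N (size p); first exact: bergman_sum_nd.
rewrite /bergman_sum -!(big_mkord xpredT (fun k => normc p`_k ^+ 2 / k.+1%:R)).
rewrite (@big_cat_nat _ _ _ (size p) 0 N)//=; last exact: ltnW.
rewrite gerDl big_nat_cond big1// => k /andP[/andP[pk _] _].
by rewrite nth_default// normc0 expr0n mul0r.
Qed.

Lemma L2_bounded_sum a (B : R) : (forall N, bergman_sum a N <= B) -> L2 (ps_on_disk a).
Proof.
move=> aB; apply/L2P; split.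
  by apply: cmeas_ps_on_disk; exact: bergman_disk_coefs aB.
exact: le_lt_trans (sq_integral_le aB) (ltry _).
Qed.

Lemma bergman_bounded_sum a (B : R) : (forall N, bergman_sum a N <= B) ->
  bergman (ps_on_disk a).
Proof.
move=> aB; apply/bergmanP; exists a; split => //; last exact: L2_bounded_sum aB.
exact: bergman_disk_coefs aB.
Qed.

Lemma bergman_poly p : bergman (poly_on_disk p).
Proof. by rewrite -ps_poly; apply: bergman_bounded_sum (bergman_sum_poly p). Qed.

Lemma nrm2_le a (B : R) : (forall N, bergman_sum a N <= B) -> nrm2 (ps_on_disk a) <= c * B.
Proof.
move=> aB; rewrite -lee_fin fineK; first exact: sq_integral_le.
rewrite ge0_fin_numE; first by have /L2P[] := L2_bounded_sum aB.
by apply: integral_ge0 => p _; rewrite lee_fin sqr_ge0.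
Qed.

Lemma nrm2_ge a N : disk_coefs a -> L2 (ps_on_disk a) ->
  c * bergman_sum a N <= nrm2 (ps_on_disk a).
Proof. by move=> ha /L2P[_ h]; exact: sq_integral_ge. Qed.

Lemma poly_on_diskB p p' : poly_on_disk (p - p') = poly_on_disk p - poly_on_disk p'.
Proof.
apply/funext => z; rewrite add_funE opp_funE /poly_on_disk.
by case: ifPn; rewrite ?subr0// hornerD hornerN.
Qed.

Lemma partial_sum_cvg a : disk_coefs a -> L2 (ps_on_disk a) ->
  (fun N => nrm2 (ps_on_disk a - poly_on_disk (\poly_(k < N) a k))) @ \oo --> (0 : R).
Proof.
move=> ha La; pose B := sup (range (bergman_sum a)).
have ub : has_ubound (range (bergman_sum a)).
  exists (nrm2 (ps_on_disk a) / c) => _ [N _ <-].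
  by rewrite ler_pdivlMr// mulrC nrm2_ge.
have lim : bergman_sum a @ \oo --> B.
  by apply: nondecreasing_cvgn => // m n; exact: bergman_sum_nd.
have leB N : bergman_sum a N <= B by apply: ub_le_sup => //; exists N.
have lim0 : (fun N => c * (B - bergman_sum a N)) @ \oo --> (0 : R).
  apply: cvg0_Ml; rewrite -(subrr B); apply: cvgB => //; exact: cvg_cst.
apply: (squeeze_cvgr _ (@cvg_cst _ (0 : R) _ _ _) lim0).
apply: nearW => N; rewrite nrm2_ge0/=.
pose t k := if (k < N)%N then 0 else a k.
have -> : ps_on_disk a - poly_on_disk (\poly_(k < N) a k) = ps_on_disk t.
  rewrite -ps_poly -scaleN1r -ps_on_diskZ; last exact: disk_coefs_poly.
  rewrite -ps_on_diskD//; last by apply: disk_coefsZ; exact: disk_coefs_poly.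
  congr ps_on_disk; apply/funext => k; rewrite coef_poly /t mulN1r.
  by case: ifPn; rewrite ?subrr ?subr0.
apply: nrm2_le => M; rewrite lerBrDr.
have [MN|NM] := leqP M N.
  rewrite [bergman_sum t M](_ : _ = 0) ?add0r//; apply: big1 => i _.
  by rewrite /t (leq_trans (ltn_ord i) MN) normc0 expr0n mul0r.
apply: le_trans (leB M); rewrite le_eqVlt; apply/orP; left; apply/eqP.
rewrite /bergman_sum -(big_mkord xpredT (fun k => normc (t k) ^+ 2 / k.+1%:R)).
rewrite -!(big_mkord xpredT (fun k => normc (a k) ^+ 2 / k.+1%:R)).
rewrite (@big_cat_nat _ _ _ N 0 M)//=; last exact: ltnW.
rewrite [in RHS](@big_cat_nat _ _ _ N 0 M)//=; last exact: ltnW.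
have -> : \sum_(0 <= k < N) normc (t k) ^+ 2 / k.+1%:R = 0.
  rewrite big_nat_cond big1// => k /andP[/andP[_ kN] _].
  by rewrite /t kN normc0 expr0n mul0r.
rewrite add0r.
rewrite addrC; congr (_ + _); rewrite big_nat_cond [RHS]big_nat_cond.
by apply: eq_bigr => k /andP[/andP[Nk _] _]; rewrite /t ltnNge Nk.
Qed.

Definition mono n : E := poly_on_disk 'X^n.

Lemma monoE n z : normc z < 1 -> mono n z = z ^+ n.
Proof. by move=> z1; rewrite /mono /poly_on_disk z1 hornerXn. Qed.

Lemma bergman_mono n : bergman (mono n). Proof. exact: bergman_poly. Qed.

Lemma L2_mono n : L2 (mono n). Proof. exact/bergman_L2/bergman_mono. Qed.

Hint Resolve L2_mono bergman_mono : core.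

Lemma L2dot_mono m n : L2dot (mono m) (mono n) = moment 1 m n.
Proof.
rewrite /moment -plane_diskE; apply: eq_cint => p Dp.
by rewrite !monoE// conjcX.
Qed.

Lemma L2dot_mono_eq n : L2dot (mono n) (mono n) = (c / n.+1%:R)%:C.
Proof. by rewrite L2dot_mono moment_diag// expr1n mulr1. Qed.

Lemma L2dot_mono_neq m n : m != n -> L2dot (mono m) (mono n) = 0.
Proof. by move=> mn; rewrite L2dot_mono moment_neq. Qed.

Lemma poly_on_disk_sum N a :
  poly_on_disk (\poly_(k < N) a k) = \sum_(k < N) a k *: mono k.
Proof.
apply/funext => z; elim: N => [|N ih].
  by rewrite big_ord0 poly_def big_ord0 /poly_on_disk horner0; case: ifP.
rewrite big_ord_recr/= add_funE -ih poly_def big_ord_recr/= -poly_def.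
rewrite scale_funE /mono /poly_on_disk; case: ifP => _.
  by rewrite hornerD hornerZ hornerXn.
by rewrite mulr0 addr0.
Qed.

Lemma L2dot_poly_r g N a : L2 g ->
  L2dot g (poly_on_disk (\poly_(k < N) a k)) = \sum_(k < N) (a k)^* * L2dot g (mono k).
Proof.
move=> Lg; rewrite -L2dotJ//; last exact/bergman_L2/bergman_poly.
rewrite poly_on_disk_sum.
have [_ ->] := L2dot_suml (index_enum 'I_N) (fun i : 'I_N => L2Z (a i) (L2_mono i)) Lg.
rewrite conjc_sum; apply: eq_bigr => k _.
by rewrite L2dotZl// conjcM L2dotJ.
Qed.

Lemma L2dot_poly_mono N a n : (n < N)%N ->
  L2dot (poly_on_disk (\poly_(k < N) a k)) (mono n) = a n * (c / n.+1%:R)%:C.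
Proof.
move=> nN; rewrite poly_on_disk_sum.
have [_ ->] := L2dot_suml (index_enum 'I_N) (fun i : 'I_N => L2Z (a i) (L2_mono i)) (L2_mono n).
rewrite (bigD1 (Ordinal nN))//= big1 ?addr0; first by rewrite L2dotZl// L2dot_mono_eq.
by move=> i iN; rewrite L2dotZl// L2dot_mono_neq ?mulr0.
Qed.

Lemma L2dot_limit g a : L2 g -> disk_coefs a -> L2 (ps_on_disk a) ->
  cvgC (fun N => \sum_(k < N) (a k)^* * L2dot g (mono k)) (L2dot g (ps_on_disk a)).
Proof.
move=> Lg ha La.
apply: (@cvgC_le _ _ _ (fun N => Num.sqrt (nrm2 g) *
  Num.sqrt (nrm2 (ps_on_disk a - poly_on_disk (\poly_(k < N) a k))))).
  move=> N; have Lp := bergman_L2 (bergman_poly (\poly_(k < N) a k)).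
  rewrite -L2dot_poly_r// normcB -L2dotBr//.
  by apply: L2dot_le => //; exact: L2B.
apply: cvg0_Ml; rewrite -sqrtr0.
exact: (cvg_comp _ _ (partial_sum_cvg ha La) (@sqrt_continuous R 0)).
Qed.

Lemma L2dot_coef a n : disk_coefs a -> L2 (ps_on_disk a) ->
  L2dot (ps_on_disk a) (mono n) = a n * (c / n.+1%:R)%:C.
Proof.
move=> ha La; rewrite -L2dotJ//.
have h := L2dot_limit (L2_mono n) ha La.
have -> : L2dot (mono n) (ps_on_disk a) = (a n)^* * (c / n.+1%:R)%:C; last first.
  rewrite conjcM conjc_invol; congr (_ * _); exact: conjc_real.
apply: (cvgC_unique h).
apply: (@cvgC_le _ _ _ (fun N => if (N <= n)%N then
  normc (\sum_(k < N) (a k)^* * L2dot (mono n) (mono k) - (a n)^* * (c / n.+1%:R)%:C) else 0)).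
  move=> N; case: leqP => // nN.
  rewrite (bigD1 (Ordinal nN))//= big1 ?addr0; first by rewrite L2dot_mono_eq subrr normc0.
  by move=> i iN; rewrite L2dot_mono_neq ?mulr0// eq_sym.
apply: cvg_near_cst; exists n.+1 => // N /= nN.
by rewrite leqNgt nN.
Qed.

(** As ||z^n||^2 = c / (n + 1), this is c times the squared norm of the projection of f onto the
    polynomials of degree below N. *)
Definition weighted_sum f N := \sum_(n < N) n.+1%:R * normc (L2dot f (mono n)) ^+ 2 : R.

Lemma weighted_sumE a N : disk_coefs a -> L2 (ps_on_disk a) ->
  weighted_sum (ps_on_disk a) N = c ^+ 2 * bergman_sum a N.
Proof.
move=> ha La; rewrite /weighted_sum /bergman_sum mulr_sumr; apply: eq_bigr => n _.
rewrite L2dot_coef// normcM normcC exprMn real_normK ?num_real// expr_div_n.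
by apply: weight_cancel; rewrite pnatr_eq0.
Qed.

Lemma weighted_sum_le f N : bergman f -> weighted_sum f N <= c * nrm2 f.
Proof.
move=> /bergmanP[a [ha -> La]]; rewrite weighted_sumE// expr2 -mulrA ler_pM2l//.
exact: nrm2_ge.
Qed.

Lemma nrm2_le_weighted f (V : R) : bergman f -> (forall N, weighted_sum f N <= V) ->
  c * nrm2 f <= V.
Proof.
move=> /bergmanP[a [ha -> La]] hV.
have h N : bergman_sum a N <= V / c ^+ 2.
  by rewrite ler_pdivlMr ?exprn_gt0// mulrC -weighted_sumE.
have := nrm2_le h; rewrite -(ler_pM2l c0) => /le_trans; apply.
by rewrite scale_cancel.
Qed.

Lemma bessel g N : L2 g -> weighted_sum g N <= c * nrm2 g.
Proof.
move=> Lg; pose a k := (k.+1%:R / c)%:C * L2dot g (mono k).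
pose s := poly_on_disk (\poly_(k < N) a k).
have bs : bergman s by exact: bergman_poly.
have Ls := bergman_L2 bs.
pose W := weighted_sum g N / c.
have gs : L2dot g s = W%:C.
  rewrite L2dot_poly_r// /W /weighted_sum mulr_suml rmorph_sum; apply: eq_bigr => k _.
  rewrite /a conjcM -mulrA [X in _ * X]mulrC mulcJ.
  rewrite (_ : _%:C^* = (k.+1%:R / c)%:C); last exact: conjc_real.
  by rewrite -rmorphM; congr (_%:C); ring.
have ss : nrm2 s = W.
  apply: complexI; rewrite -L2dot_nrm2 L2dot_poly_r// -gs L2dot_poly_r//.
  apply: eq_bigr => k _; congr (_ * _); rewrite L2dot_poly_mono// /a mulrAC -rmorphM.
  by rewrite ratio_cancel// mul1r.
have := nrm2_ge0 (g - s); rewrite nrm2B// gs ss cReC.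
rewrite (_ : _ - _ + _ = nrm2 g - W); last by ring.
by rewrite subr_ge0 /W ler_pdivrMr// mulrC.
Qed.

(** The projection is built from its coefficients (k + 1) / c <g, z^k>, which Bessel's inequality
    makes those of an element of A^2. Orthogonality to the monomials extends to A^2 by
    [L2dot_limit]. *)
Lemma bergman_proj_exists g : L2 g -> exists p : E, bergman p /\
  forall q, bergman q -> L2dot (g - p) q = 0.
Proof.
move=> Lg; pose a k := (k.+1%:R / c)%:C * L2dot g (mono k).
have aB N : bergman_sum a N <= nrm2 g / c.
  rewrite ler_pdivlMr// -(ler_pM2l c0); apply: le_trans (bessel N Lg).
  rewrite /bergman_sum /weighted_sum mulr_suml mulr_sumr; apply: ler_sum => k _.
  rewrite /a normcM normcC exprMn real_normK ?num_real// expr_div_n.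
  by rewrite weight_cancel2.
have bp := bergman_bounded_sum aB; have Lp := bergman_L2 bp.
have ha := bergman_disk_coefs aB.
exists (ps_on_disk a); split => // _ /bergmanP[a' [ha' -> La']].
have := L2dot_limit (L2B Lg Lp) ha' La' => /cvgC_unique; apply.
apply: eq_cvgC (cvgC_cst 0) => N; apply/esym/big1 => k _.
rewrite L2dotBl// L2dot_coef// /a.
by rewrite mulrAC -rmorphM ratio_cancel// mul1r subrr mulr0.
Qed.

Lemma bergman_projP g : L2 g -> bergman (bergman_proj g) /\
  forall q, bergman q -> L2dot (bergman_proj g) q = L2dot g q.
Proof.
move=> Lg; have [p hp] := bergman_proj_exists Lg.
have [h1 h2] := @xgetPex _ 0 [set p : E | bergman p /\ forall q, bergman q -> L2dot (g - p) q = 0]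
  (ex_intro _ p hp).
split => // q bq; apply/esym/eqP; rewrite -subr_eq0 -L2dotBl//; first exact/eqP/h2.
all: exact: bergman_L2.
Qed.

End BergmanSpace.

(** * Comparison with the Hardy space *)

Section Multiplier.
Context {R : realType}.
Local Notation C := R[i].
Local Notation E := (C -> C^o).
Local Notation mu := (@dA R).
Local Notation c := (@disk_area R 1).
Implicit Types (a : nat -> C) (f g h q : E).

Let c0 : 0 < c. Proof. exact: disk_area_gt0. Qed.
Let c_neq0 : c != 0. Proof. by rewrite gt_eqF. Qed.
Hint Resolve L2_mono bergman_mono : core.

Lemma bergman0 : bergman (0 : E).
Proof. by rewrite -(scale0r (mono 0)); apply: bergmanZ; exact: bergman_mono. Qed.

Definition shift n a k : C := if (k < n)%N then 0 else a (k - n)%N.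

Lemma disk_coefs_shift n a : disk_coefs a -> disk_coefs (shift n a).
Proof.
move=> ha s s01; have [M hM] := ha s s01; have /andP[s0 s1] := s01.
exists M => k; rewrite /shift; case: ltnP => [_|nk].
  by rewrite normc0 mul0r (ps_bound_ge0 hM).
apply: le_trans (hM (k - n)%N); rewrite ler_wpM2l ?normc_ge0//.
by apply: ler_wiXn2l; rewrite ?(ltW s0) ?(ltW s1)// leq_subr.
Qed.

Lemma ps_on_disk_shift n a : disk_coefs a ->
  ps_on_disk (shift n a) = (fun z => mono n z * ps_on_disk a z).
Proof.
move=> ha; apply/funext => z; rewrite /ps_on_disk; case: ifPn => z1; last by rewrite mulr0.
rewrite monoE//; apply: psE.
rewrite /cvgC -(cvg_shiftn n (fun N => normc (psum (shift n a) N z - z ^+ n * ps a z))).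
apply: (@eq_cvgC _ (fun N => z ^+ n * psum a N z)); last first.
  by apply: cvgCZ; exact: disk_coefs_cvg.
elim => [|N ih].
  rewrite /psum big_ord0 mulr0 big1// => i _.
  by rewrite /shift ltn_ord mul0r.
rewrite addSn /psum !big_ord_recr/= -/(psum a N z) -/(psum (shift n a) (N + n) z) -ih.
by rewrite mulrDr /shift ltnNge leq_addl/= addnK exprD; congr (_ + _); ring.
Qed.

Lemma bergman_sum_shift n a N :
  bergman_sum (shift n a) (N + n) = \sum_(k < N) normc (a k) ^+ 2 / (k + n).+1%:R.
Proof.
elim: N => [|N ih].
  rewrite big_ord0 /bergman_sum big1// => i _.
  by rewrite /shift ltn_ord normc0 expr0n mul0r.
by rewrite addSn bergman_sumS ih big_ord_recr/= /shift ltnNge leq_addl/= addnK.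
Qed.

Lemma nrm2_mono_le f g : cmeas (@plane_disk R) (fun p => f (plane p)) -> L2 g ->
  (forall z, normc z < 1 -> normc (f z) <= normc (g z)) -> nrm2 f <= nrm2 g.
Proof.
move=> mf Lg fg; have /L2P[mg gI] := Lg.
have le : (sq_integral f <= sq_integral g)%E.
  apply: ge0_le_integral => //.
  - exact: measurable_plane_disk.
  - by move=> p _; rewrite lee_fin sqr_ge0.
  - exact/measurable_EFinP/cmeas_normc2.
  - exact/measurable_EFinP/cmeas_normc2.
  - by move=> p Dp; rewrite lee_fin lerXn2r ?nnegrE ?normc_ge0// fg.
have ge0 h : (0 <= sq_integral h)%E.
  by apply: integral_ge0 => p _; rewrite lee_fin sqr_ge0.
by apply: fine_le => //; rewrite ge0_fin_numE//; exact: le_lt_trans le gI.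
Qed.

Variable b : E.
Hypothesis bA : analytic_on_disk b.
Hypothesis b1 : forall z, normc z < 1 -> normc (b z) <= 1.

Lemma cmeas_multiplier : cmeas (@plane_disk R) (fun p => b (plane p)).
Proof.
have [be [hbe bE]] := global_expansion bA.
by apply: eq_cmeas (cmeas_ps hbe) => p Dp; rewrite bE.
Qed.

Definition bmono n : E := fun z => b z * mono n z.

Lemma bmono_expansion : exists be, [/\ disk_coefs be, be 0%N = b 0 &
  forall n, bmono n = ps_on_disk (shift n be)].
Proof.
have [be [hbe bE]] := global_expansion bA; exists be; split => //.
  rewrite bE ?normc0//; apply/esym/psE.
  apply: (@cvgC_le _ _ _ (fun N => if (N == 0)%N then normc (psum be N 0 - be 0%N) else 0)).
    by case => [|N]//=; rewrite psum0 subrr normc0.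
  by apply: cvg_near_cst; exists 1%N => // -[].
move=> n; rewrite ps_on_disk_shift//; apply/funext => z; rewrite /bmono mulrC.
rewrite /ps_on_disk /mono /poly_on_disk; case: ifPn => z1; last by rewrite !mul0r.
by rewrite bE.
Qed.

Lemma L2_bmul f : L2 f -> L2 (fun z => b z * f z).
Proof. by apply: (L2_mull cmeas_multiplier b1). Qed.

Lemma L2_bmono n : L2 (bmono n).
Proof. by apply: L2_bmul; exact: L2_mono. Qed.

Lemma bergman_bmono n : bergman (bmono n).
Proof.
have [be [hbe _ bE]] := bmono_expansion; apply/bergmanP.
by exists (shift n be); split; [exact: disk_coefs_shift|exact: bE|exact: L2_bmono].
Qed.

Hint Resolve L2_bmono bergman_bmono : core.

Lemma bmul_poly N a : (fun z => b z * poly_on_disk (\poly_(k < N) a k) z) =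
  \sum_(k < N) a k *: bmono k.
Proof.
apply/funext => z; rewrite poly_on_disk_sum; elim: N => [|N ih].
  by rewrite !big_ord0 mulr0.
by rewrite !big_ord_recr/= !add_funE mulrDr ih !scale_funE /bmono mulrCA.
Qed.

Lemma bergman_bmul_poly N a : bergman (fun z => b z * poly_on_disk (\poly_(k < N) a k) z).
Proof.
rewrite bmul_poly; elim: N => [|N ih].
  by rewrite big_ord0; exact: bergman0.
rewrite big_ord_recr/=; exact: (bergmanD ih (bergmanZ (a N) (bergman_bmono N))).
Qed.

(* The H^2 norm is the limit of (n+1) times the squared A^2 norm of z^n f. *)
Lemma hardy_contraction N a ga K : disk_coefs ga ->
  (fun z => b z * poly_on_disk (\poly_(k < N) a k) z) = ps_on_disk ga ->
  \sum_(k < K) normc (ga k) ^+ 2 <= \sum_(k < N) normc (a k) ^+ 2.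
Proof.
move=> hga bp; set P := poly_on_disk _ in bp.
set X := \sum_(k < K) _; set H := \sum_(k < N) _.
have H0 : 0 <= H by apply: sumr_ge0 => i _; exact: sqr_ge0.
have X0 : 0 <= X by apply: sumr_ge0 => i _; exact: sqr_ge0.
pose pa k := if (k < N)%N then a k else 0.
have PE : P = ps_on_disk pa.
  by rewrite /P -ps_poly; congr ps_on_disk; apply/funext => k; rewrite coef_poly.
have hpa : disk_coefs pa.
  have -> : pa = (fun k => (\poly_(k < N) a k)`_k) by apply/funext => k; rewrite coef_poly.
  exact: disk_coefs_poly.
(* This is ||z^n b P|| <= ||z^n P|| in A^2: on the left the weights of the first K coefficients are
   at least 1 / (K + n + 1), on the right all are at most 1 / (n + 1). *)
have key n : X / (K + n).+1%:R <= H / n.+1%:R.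
  have LP M : bergman_sum (shift n pa) M <= H / n.+1%:R.
    apply: (@le_trans _ _ (bergman_sum (shift n pa) ((M + N) + n))).
      by apply: bergman_sum_nd; rewrite -addnA leq_addr.
    rewrite bergman_sum_shift addnC.
    rewrite -(big_mkord xpredT (fun k => normc (pa k) ^+ 2 / (k + n).+1%:R)).
    rewrite (@big_cat_nat _ _ _ N)//= ?leq_addr//.
    have -> : \sum_(N <= k < N + M) normc (pa k) ^+ 2 / (k + n).+1%:R = 0.
      rewrite big_nat_cond big1// => k /andP[/andP[Nk _] _].
      by rewrite /pa ltnNge Nk normc0 expr0n mul0r.
    rewrite addr0 big_mkord /H mulr_suml; apply: ler_sum => k _.
    rewrite /pa ltn_ord ler_wpM2l ?sqr_ge0// lef_pV2 ?posrE//.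
    by rewrite ler_nat ltnS leq_addl.
  have Lp := L2_bounded_sum LP.
  have le := nrm2_le LP.
  have Lg : L2 (ps_on_disk (shift n ga)).
    rewrite ps_on_disk_shift// -bp.
    have -> : (fun z => mono n z * (b z * P z)) = (fun z => b z * ps_on_disk (shift n pa) z).
      by rewrite ps_on_disk_shift// -PE; apply/funext => z; rewrite mulrCA.
    exact: L2_bmul.
  have ge := nrm2_ge (K + n) (disk_coefs_shift n hga) Lg.
  have mid : nrm2 (ps_on_disk (shift n ga)) <= nrm2 (ps_on_disk (shift n pa)).
    apply: nrm2_mono_le => //; first exact: L2_cmeas.
    move=> z z1; rewrite !ps_on_disk_shift// -bp -PE !normcM mulrCA.
    by rewrite ler_piMl ?mulr_ge0 ?normc_ge0// b1.
  have : c * bergman_sum (shift n ga) (K + n) <= c * (H / n.+1%:R).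
    exact: le_trans ge (le_trans mid le).
  rewrite ler_pM2l// bergman_sum_shift; apply: le_trans.
  rewrite /X mulr_suml; apply: ler_sum => k _.
  rewrite ler_wpM2l ?sqr_ge0// lef_pV2 ?posrE//.
  by rewrite ler_nat ltnS leq_add2r ltnW.
rewrite leNgt; apply/negP => HX.
have d0 : 0 < X - H by rewrite subr_gt0.
(* [key] amounts to (n + 1) (X - H) <= H K, which fails for large n if X > H. *)
pose n := Num.truncn (H * K%:R / (X - H)).
have hn : H * K%:R < n.+1%:R * (X - H) by rewrite -ltr_pdivrMr// truncnS_gt.
have := key n; rewrite ler_pdivrMr// mulrAC ler_pdivlMr//.
by move: hn; rewrite -addnS natrD; lra.
Qed.

(* hcoef f is the sequence of Taylor coefficients of J^* f, where J is the
   inclusion of H^2 in A^2, and hbcoef f that of T_b^* J^* f. *)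
Definition hcoef f n : C := L2dot f (mono n).
Definition hbcoef f n : C := L2dot f (bmono n).
Arguments hcoef f n : simpl never.
Arguments hbcoef f n : simpl never.

(* By duality with hardy_contraction; AM-GM is enough because the squared norm
   of the test polynomial is the left-hand side itself. *)
Lemma hardy_adjoint_contraction f (V : R) : L2 f ->
  (forall M, \sum_(n < M) normc (hcoef f n) ^+ 2 <= V) ->
  forall N, \sum_(n < N) normc (hbcoef f n) ^+ 2 <= V.
Proof.
move=> Lf fV N; set X := \sum_(n < N) _.
have X0 : 0 <= X by apply: sumr_ge0 => i _; exact: sqr_ge0.
have bF := bergman_bmul_poly N (hbcoef f); have LF := bergman_L2 bF.
set F := (fun z => _) in bF LF.
have FX : L2dot f F = X%:C.
  rewrite -L2dotJ// /F bmul_poly.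
  have [_ ->] := L2dot_suml (index_enum 'I_N)
    (fun i : 'I_N => L2Z (hbcoef f i) (L2_bmono i)) Lf.
  rewrite conjc_sum /X rmorph_sum; apply: eq_bigr => k _.
  by rewrite L2dotZl// conjcM L2dotJ// mulrC mulcJ.
have /bergmanP[ga [hga Fga _]] := bF.
have Lga : L2 (ps_on_disk ga) by rewrite -Fga.
have h2 K := hardy_contraction K hga Fga.
have lim := L2dot_limit Lf hga Lga; rewrite -Fga FX in lim.
have : normc (0 - X%:C) <= (X + V) / 2.
  apply: (cvgC_norm lim); apply: nearW => K.
  rewrite sub0r normcN; apply: le_trans (normc_sum _ _ _) _.
  apply: (@le_trans _ _ (\sum_(k < K) (normc (ga k) ^+ 2 + normc (hcoef f k) ^+ 2) / 2)).
    apply: ler_sum => k _; rewrite normcM normcJ -/(hcoef f k).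
    by have := sqr_ge0 (normc (ga k) - normc (hcoef f k)); rewrite sqrrB; lra.
  rewrite -mulr_suml big_split ler_wpM2r ?invr_ge0//.
  exact: (lerD (h2 K) (fV K)).
rewrite sub0r normcN normcC ger0_norm//; lra.
Qed.

Lemma L2_conj_mono f j : L2 f -> L2 (fun z => (mono j z)^* * f z).
Proof.
apply: (@L2_mull _ _ _ 1); first exact/cmeasJ/L2_cmeas/L2_mono.
by move=> z z1; rewrite normcJ monoE// normcX exprn_ile1 ?normc_ge0// ltW.
Qed.

Lemma L2dot_conj_mono f g j :
  L2dot (fun z => (mono j z)^* * f z) g = L2dot f (fun z => mono j z * g z).
Proof. by apply: eq_cint => p _; rewrite conjcM; ring. Qed.

(** On coefficients, multiplication by conj(z)^j is the j-th power of the backward shift. The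
    product leaves A^2, which is why [hcoef] and [hbcoef] are used on all of L^2. *)
Lemma hcoef_conj_mono f j n : hcoef (fun z => (mono j z)^* * f z) n = hcoef f (n + j).
Proof.
rewrite /hcoef L2dot_conj_mono; apply: eq_L2dot => // z z1.
by rewrite !monoE// exprD mulrC.
Qed.

Lemma hbcoef_conj_mono f j n : hbcoef (fun z => (mono j z)^* * f z) n = hbcoef f (n + j).
Proof.
rewrite /hbcoef L2dot_conj_mono; apply: eq_L2dot => // z z1.
by rewrite /bmono !monoE// exprD; ring.
Qed.

Lemma hcoef_mono0 n : hcoef (mono 0) n = if n == 0%N then c%:C else 0.
Proof.
rewrite /hcoef; case: eqVneq => [->|n0]; first by rewrite L2dot_mono_eq divr1.
by rewrite L2dot_mono_neq// eq_sym.
Qed.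

Lemma hbcoef_mono0 n : hbcoef (mono 0) n = if n == 0%N then (b 0)^* * c%:C else 0.
Proof.
have [be [hbe be0 bE]] := bmono_expansion.
rewrite /hbcoef -L2dotJ//.
rewrite bE L2dot_coef; [|exact: disk_coefs_shift|by rewrite -bE].
rewrite divr1 /shift; case: n => [|n] /=.
  rewrite subn0 be0 conjcM; congr (_ * _); exact: conjc_real.
by rewrite mul0r; exact: conjc0.
Qed.

(* Apply the contraction to the backward shift of order j minus the constant
   t = v_j - b(0) w_j: this is the inequality D >= k k^* for the kernel k of
   H(b) at the origin. *)
Lemma defect_kernel_ineq f j (V : R) : L2 f ->
  (forall M, \sum_(n < M) normc (hcoef f (n + j)) ^+ 2 <= V) ->
  forall N, \sum_(n < N) normc (hbcoef f (n + j)) ^+ 2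
    + normc (hcoef f j - b 0 * hbcoef f j) ^+ 2 <= V.
Proof.
move=> Lf fV N; set v := hcoef f j; set w := hbcoef f j; set t := v - _.
pose fj : E := fun z => (mono j z)^* * f z.
have Lfj : L2 fj by exact: L2_conj_mono.
have L0 := L2_mono (R := R) 0.
have L0t := L2Z (t / c%:C) L0.
pose f' := fj - (t / c%:C) *: mono 0.
have Lf' : L2 f' by exact: L2B.
have cC : c%:C != 0 :> C by rewrite (inj_eq (@complexI R)).
have hv n : hcoef f' n = hcoef f (n + j) - (if n == 0%N then t else 0).
  rewrite {1}/hcoef L2dotBl//.
  rewrite -/(hcoef fj n) hcoef_conj_mono; congr (_ - _).
  rewrite L2dotZl//.
  rewrite -/(hcoef (mono 0) n) hcoef_mono0.
  by case: ifP; rewrite ?mulr0// divfK.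
have hw n : hbcoef f' n = hbcoef f (n + j) - (if n == 0%N then t * (b 0)^* else 0).
  rewrite {1}/hbcoef L2dotBl//.
  rewrite -/(hbcoef fj n) hbcoef_conj_mono; congr (_ - _).
  rewrite L2dotZl// -/(hbcoef (mono 0) n) hbcoef_mono0.
  by case: ifP; rewrite ?mulr0// mulrCA divfK// mulrC.
pose V' := V - normc v ^+ 2 + normc (v - t) ^+ 2.
have V'P M : \sum_(n < M) normc (hcoef f' n) ^+ 2 <= V'.
  have s0 := sqr_ge0 (normc (v - t)).
  case: M => [|M].
    have := fV 1%N; rewrite big_ord0 big_ord1 add0n -/v /V' => h.
    by rewrite addr_ge0// subr_ge0.
  have -> : \sum_(n < M.+1) normc (hcoef f' n) ^+ 2 =
      normc (v - t) ^+ 2 + \sum_(i < M) normc (hcoef f (i.+1 + j)) ^+ 2.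
    rewrite big_ord_recl hv add0n; congr (_ + _).
    by apply: eq_bigr => i _; rewrite hv subr0.
  have := fV M.+1; rewrite big_ord_recl add0n -/v.
  by rewrite /V' => h; rewrite addrC lerD2r lerBrDl.
(* Since v - t = b(0) w, the cross terms cancel; the surplus |t|^2 |b(0)|^2 is dropped. *)
have alg Y : normc (w - t * (b 0)^*) ^+ 2 + Y <= V' -> normc w ^+ 2 + Y + normc t ^+ 2 <= V.
  have -> : V = V' + normc v ^+ 2 - normc (v - t) ^+ 2 by rewrite /V'; ring.
  have id : normc (w - t * (b 0)^*) ^+ 2 - normc (v - t) ^+ 2 + normc v ^+ 2 =
      normc w ^+ 2 + normc t ^+ 2 + normc t ^+ 2 * normc (b 0) ^+ 2.
    by rewrite !normc_sqr /t !ReImE; ring.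
  have : 0 <= normc t ^+ 2 * normc (b 0) ^+ 2 by rewrite mulr_ge0 ?sqr_ge0.
  by move: id; lra.
have h M : normc (w - t * (b 0)^*) ^+ 2 + \sum_(n < M) normc (hbcoef f (n.+1 + j)) ^+ 2 <= V'.
  have := hardy_adjoint_contraction Lf' V'P M.+1.
  have -> : \sum_(n < M.+1) normc (hbcoef f' n) ^+ 2 =
      normc (w - t * (b 0)^*) ^+ 2 + \sum_(i < M) normc (hbcoef f (i.+1 + j)) ^+ 2.
    rewrite big_ord_recl hw add0n; congr (_ + _).
    by apply: eq_bigr => i _; rewrite hw subr0.
  exact.
case: N => [|N].
  rewrite big_ord0 add0r; apply: le_trans (alg _ (h 0%N)).
  by rewrite big_ord0 addr0 lerDr sqr_ge0.
by rewrite big_ord_recl/= add0n -/w; exact: alg (h N).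
Qed.

(** On the left, x m occurs only for j <= m and at most once for each, hence at most m + 1 times:
    this is where the weights of A^2 come from. *)
Lemma diagonal_sum_le (x : nat -> R) J M : (forall n, 0 <= x n) ->
  \sum_(j < J) \sum_(n < M) x (n + j)%N <= \sum_(m < M + J) m.+1%:R * x m.
Proof.
move=> x0; have h (j : 'I_J) :
    \sum_(n < M) x (n + j)%N <= \sum_(m < M + J) (j <= m)%:R * x m.
  rewrite -(big_mkord xpredT (fun n => x (n + j)%N)).
  rewrite -(big_mkord xpredT (fun m => (j <= m)%:R * x m)).
  rewrite -{1}(addnK j M) -(big_addn 0 _ j xpredT x) add0n.
  rewrite (@big_cat_nat _ _ _ (M + j)%N _ (M + J)%N)//=; last by rewrite leq_add2l ltnW.
  rewrite (@big_cat_nat _ _ _ j 0%N (M + j)%N)//= ?leq_addl// -addrA.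
  rewrite [X in X <= _](_ : _ = \sum_(j <= i < M + j) (j <= i)%:R * x i); last first.
    rewrite big_nat_cond [RHS]big_nat_cond; apply: eq_bigr => i /andP[/andP[ji _] _].
    by rewrite ji mul1r.
  rewrite addrCA lerDl addr_ge0//; apply: sumr_ge0 => i _; exact: mulr_ge0.
apply: le_trans (ler_sum _ (fun j _ => h j)) _.
rewrite exchange_big/=; apply: ler_sum => m _; rewrite -mulr_suml ler_wpM2r//.
rewrite -natr_sum ler_nat.
have [Jm|mJ] := leqP J m.+1.
  apply: leq_trans Jm; rewrite -[leqRHS]card_ord -sum1_card; apply: leq_sum => j _.
  exact: leq_b1.
rewrite (bigID (fun j : 'I_J => (j < m.+1)%N))/= [X in (_ + X)%N]big1 ?addn0; last first.
  by move=> j; rewrite ltnS => /negbTE ->.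
rewrite -(big_ord_widen J (fun j => nat_of_bool (j <= m)%N) (ltnW mJ)).
rewrite -[leqRHS]card_ord -sum1_card; apply: leq_sum => j _; exact: leq_b1.
Qed.

(** For m < K every j <= m contributes x m with n = m - j < K, so all m + 1 occurrences survive the
    truncation. *)
Lemma diagonal_sum_ge (x : nat -> R) K J : (forall n, 0 <= x n) -> (K <= J)%N ->
  \sum_(m < K) m.+1%:R * x m <= \sum_(j < J) \sum_(n < K) x (n + j)%N.
Proof.
move=> x0 KJ.
apply: (@le_trans _ _ (\sum_(j < K) \sum_(n < K) x (n + j)%N)); last first.
  rewrite -!(big_mkord xpredT (fun j => \sum_(n < K) x (n + j)%N)).
  rewrite [leRHS](@big_cat_nat _ _ _ K)//= lerDl; apply: sumr_ge0 => j _.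
  by apply: sumr_ge0 => n _.
have h (j : 'I_K) : \sum_(m < K) (j <= m)%:R * x m <= \sum_(n < K) x (n + j)%N.
  rewrite -(big_mkord xpredT (fun m => (j <= m)%:R * x m)).
  rewrite -(big_mkord xpredT (fun n => x (n + j)%N)).
  rewrite -[leRHS](_ : \sum_(0 + j <= i < K + j) x i = _); last by rewrite big_addn addnK.
  rewrite add0n (@big_cat_nat _ _ _ j)//=; last exact: ltnW.
  rewrite big_nat_cond big1 ?add0r; last first.
    by move=> i /andP[/andP[_ ij] _]; rewrite leqNgt ij mul0r.
  rewrite [leRHS](@big_cat_nat _ _ _ K)//= ?leq_addr//; last exact: ltnW.
  rewrite -[leLHS]addr0 lerD//; last by apply: sumr_ge0.
  by apply: ler_sum => i _; rewrite ler_piMl// lern1 leq_b1.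
apply: le_trans (ler_sum _ (fun j _ => h j)).
rewrite exchange_big/=; apply: ler_sum => m _; rewrite -mulr_suml ler_wpM2r//.
rewrite -natr_sum ler_nat.
rewrite (bigID (fun j : 'I_K => (j < m.+1)%N))/=; apply: leq_trans (leq_addr _ _).
rewrite -(big_ord_widen K (fun j => nat_of_bool (j <= m)%N) (ltn_ord m)).
rewrite -[leqLHS]card_ord -sum1_card; apply: leq_sum => j _.
by have := ltn_ord j; rewrite ltnS => ->.
Qed.

(** Partial sums of the squared H^2 norm of the j-th backward shift of [hcoef f]; their supremum
    over M serves as V in [defect_kernel_ineq]. *)
Let U f j M := \sum_(n < M) normc (hcoef f (n + j)) ^+ 2.

Let U_nd f j M M' : (M <= M')%N -> U f j M <= U f j M'.
Proof.
move=> MM; rewrite /U -!(big_mkord xpredT (fun n => normc (hcoef f (n + j)) ^+ 2)).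
by rewrite [leRHS](@big_cat_nat _ _ _ M)//= lerDl; apply: sumr_ge0 => n _; exact: sqr_ge0.
Qed.

Let U_sum_le f J M : L2 f -> \sum_(j < J) U f j M <= c * nrm2 f.
Proof.
move=> Lf; apply: le_trans (bessel (M + J) Lf).
by apply: (@diagonal_sum_le (fun n => normc (hcoef f n) ^+ 2)) => n; exact: sqr_ge0.
Qed.

Let U_ub f j : L2 f -> has_ubound (range (U f j)).
Proof.
move=> Lf; exists (c * nrm2 f) => _ [M _ <-]; apply: le_trans (U_sum_le j.+1 M Lf).
rewrite big_ord_recr lerDr; apply: sumr_ge0 => i _.
by apply: sumr_ge0 => n _; exact: sqr_ge0.
Qed.

Let U_cvg f j : L2 f -> U f j @ \oo --> sup (range (U f j)).
Proof.
move=> Lf; apply: nondecreasing_cvgn; last exact: U_ub.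
by move=> m n; exact: U_nd.
Qed.

Let U_le_sup f j M : L2 f -> U f j M <= sup (range (U f j)).
Proof. by move=> Lf; apply: ub_le_sup; [exact: U_ub|exists M]. Qed.

(* ||f||_{A^2}^2 = sum_j ||backward shift^j (J^* f)||_{H^2}^2 up to the factor c,
   and the same for g = T_b^* f: sum the kernel inequality over j. *)
Lemma defect_sum_ineq f g J : L2 f -> bergman g -> (forall n, hcoef g n = hbcoef f n) ->
  \sum_(j < J) normc (hcoef f j - b 0 * hbcoef f j) ^+ 2 <= c * (nrm2 f - nrm2 g).
Proof.
move=> Lf bg gf; set T := \sum_(j < J) _.
suff h K : weighted_sum g K <= c * nrm2 f - T.
  by have := nrm2_le_weighted bg h; rewrite mulrBr lerBrDr -lerBrDl.
(* At least K, so that all diagonals below K are complete, and at least J, so that T is part of the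
   sum. *)
rewrite lerBrDr; pose J' := maxn J K.
pose t j := normc (hcoef f j - b 0 * hbcoef f j) ^+ 2.
apply: (@le_trans _ _ (\sum_(j < J') (\sum_(n < K) normc (hbcoef f (n + j)) ^+ 2 + t j))).
  rewrite big_split/= lerD//.
    have -> : weighted_sum g K = \sum_(m < K) m.+1%:R * normc (hbcoef f m) ^+ 2.
      by apply: eq_bigr => m _; rewrite -gf.
    apply: (@diagonal_sum_ge (fun n => normc (hbcoef f n) ^+ 2)); last exact: leq_maxr.
    by move=> n; exact: sqr_ge0.
  rewrite /T -!(big_mkord xpredT t) [leRHS](@big_cat_nat _ _ _ J)//= ?leq_maxl//.
  by rewrite lerDl; apply: sumr_ge0 => n _; exact: sqr_ge0.
apply: (@le_trans _ _ (\sum_(j < J') sup (range (U f j)))).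
  apply: ler_sum => j _; apply: defect_kernel_ineq => // M; exact: U_le_sup.
have lim : (fun M => \sum_(j < J') U f j M) @ \oo --> \sum_(j < J') sup (range (U f j)).
  by apply: cvg_real_sum => j; exact: U_cvg.
by apply: (cvgr_to_le lim); apply: nearW => M; exact: U_sum_le.
Qed.

Lemma sqr_add_le (x y s : R) : 0 < s ->
  (x + y) ^+ 2 <= (1 + s^-1) * x ^+ 2 + (1 + s) * y ^+ 2.
Proof.
move=> s0; rewrite -subr_ge0.
have -> : (1 + s^-1) * x ^+ 2 + (1 + s) * y ^+ 2 - (x + y) ^+ 2 = s^-1 * (x - s * y) ^+ 2.
  by field; rewrite gt_eqF.
by rewrite mulr_ge0 ?sqr_ge0// invr_ge0 ltW.
Qed.

(** Write v = (v - b(0) w) + b(0) w. The first part is controlled by [defect_sum_ineq], the second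
    by |b(0)|^2 V, as w is no longer than v. The supremum V is finite by Bessel's inequality, so its
    multiple can be absorbed. *)
Lemma hardy_norm_le_defect : normc (b 0) < 1 -> exists kappa : R, 0 < kappa /\
  forall f g J, L2 f -> bergman g -> (forall n, hcoef g n = hbcoef f n) ->
  \sum_(j < J) normc (hcoef f j) ^+ 2 <= kappa * (nrm2 f - nrm2 g).
Proof.
move=> b01; pose be := normc (b 0) ^+ 2.
have be0 : 0 <= be by exact: sqr_ge0.
have be1 : be < 1 by rewrite /be expr_lt1// normc_ge0.
(* Small enough for (1 + s) be < 1; the coefficient left to V is then d = (1 - be) (1 - be / 2). *)
pose s := (1 - be) / 2; have s0 : 0 < s by rewrite /s; lra.
pose d := 1 - (1 + s) * be; have d0 : 0 < d by rewrite /d /s; nra.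
exists ((1 + s^-1) * c / d); split.
  by rewrite divr_gt0// mulr_gt0// addr_gt0// invr_gt0.
move=> f g J Lf bg gf; set D := nrm2 f - nrm2 g.
pose V := sup (range (U f 0)).
have hV M : \sum_(n < M) normc (hcoef f n) ^+ 2 <= V.
  apply: le_trans (U_le_sup 0 M Lf); apply: ler_sum => n _; by rewrite addn0.
apply: le_trans (hV J) _.
have key M : U f 0 M <= (1 + s^-1) * (c * D) + (1 + s) * be * V.
  apply: (@le_trans _ _ (\sum_(j < M) ((1 + s^-1) * normc (hcoef f j - b 0 * hbcoef f j) ^+ 2
      + (1 + s) * be * normc (hbcoef f j) ^+ 2))).
    apply: ler_sum => j _; rewrite addn0.
    rewrite -{1}(subrK (b 0 * hbcoef f j) (hcoef f j)) /be -[(1 + s) * _ * _]mulrA -exprMn -normcM.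
    apply: le_trans (sqr_add_le _ _ s0).
    by rewrite lerXn2r ?nnegrE ?addr_ge0 ?normc_ge0// normcD.
  rewrite big_split/= -!mulr_sumr lerD// ler_wpM2l//.
  - by rewrite addr_ge0// invr_ge0 ltW.
  - exact: defect_sum_ineq.
  - by rewrite mulr_ge0// addr_ge0// ltW.
  - exact: hardy_adjoint_contraction.
have VD : V <= (1 + s^-1) * (c * D) + (1 + s) * be * V.
  by apply: (cvgr_to_le (@U_cvg f 0 Lf)); apply: nearW => M; exact: key.
rewrite mulrAC ler_pdivlMr// /d mulrBr mulr1 lerBlDr; apply: le_trans VD _.
by rewrite le_eqVlt; apply/orP; left; apply/eqP; ring.
Qed.

End Multiplier.

(** * The defect operator and its action on polynomials *)

Section ToeplitzDefect.
Context {R : realType}.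
Local Notation C := R[i].
Local Notation E := (C -> C^o).
Local Notation c := (@disk_area R 1).
Implicit Types (f g h q x : E).

Let c0 : 0 < c. Proof. exact: disk_area_gt0. Qed.
Let c_neq0 : c != 0. Proof. by rewrite gt_eqF. Qed.

Lemma bergman_eq0 x : bergman x -> (forall n, hcoef x n = 0) -> x = 0.
Proof.
move=> /bergmanP[a [ha -> La]] h.
have a0 n : a n = 0.
  have := h n; rewrite /hcoef L2dot_coef// => /eqP.
  rewrite mulf_eq0 => /orP[/eqP //|].
  have h1 : n.+1%:R != 0 :> R by rewrite pnatr_eq0.
  by rewrite (inj_eq (@complexI R) _ 0) mulf_eq0 invr_eq0 (negbTE h1) (negbTE c_neq0).
apply/funext => z; rewrite /ps_on_disk; case: ifP => // _.
apply: psE; apply: eq_cvgC (cvgC_cst 0) => N.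
by rewrite /psum big1// => i _; rewrite a0 mul0r.
Qed.

Lemma bergman_orth_eq0 x : bergman x -> (forall f, bergman f -> L2dot x f = 0) -> x = 0.
Proof. by move=> bx h; apply: bergman_eq0 => // n; apply: h; exact: bergman_mono. Qed.

Lemma bergman_nrm2_eq0 x : bergman x -> nrm2 x <= 0 -> x = 0.
Proof.
move=> bx x0; apply: bergman_orth_eq0 => // f bf; apply/eqP; rewrite -normc_eq0.
have Lx := bergman_L2 bx; have Lf := bergman_L2 bf.
have nx : nrm2 x = 0 by apply/eqP; rewrite eq_le x0 nrm2_ge0.
have := L2_CauchySchwarz Lx Lf; rewrite nx mul0r => h.
by rewrite -sqrf_eq0 eq_le h sqr_ge0.
Qed.

Lemma amgm_opt (y A B : R) : 0 <= A -> 0 <= B ->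
  (forall l, 0 < l -> 2 * y <= l * A + l^-1 * B) -> y <= Num.sqrt (A * B).
Proof.
move=> A0 B0 h; have [y0|y0] := leP y 0; first exact: le_trans y0 (sqrtr_ge0 _).
rewrite -(ger0_norm (ltW y0)) -sqrtr_sqr ler_wsqrtr//.
have [Az|Anz] := eqVneq A 0.
  exfalso; have l0 : 0 < (B + 1) / y by rewrite divr_gt0// ltr_wpDl.
  have := h _ l0; rewrite Az mulr0 add0r invf_div mulrAC ler_pdivlMr ?ltr_wpDl//.
  nra.
have Ap : 0 < A by rewrite lt_neqAle eq_sym Anz.
(* At l = y / A the first term is y itself, which leaves y <= A B / y, that is y^2 <= A B. *)
have := h (y / A); rewrite divr_gt0// => /(_ isT).
rewrite divfK// invf_div => h1.
have : y <= A / y * B by lra.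
by rewrite mulrAC ler_pdivlMr// expr2.
Qed.

Lemma finite_CauchySchwarz (x v : nat -> C) (r : seq nat) (A B : R) :
  \sum_(k <- r) normc (x k) ^+ 2 <= A -> \sum_(k <- r) normc (v k) ^+ 2 <= B ->
  normc (\sum_(k <- r) x k * v k) <= Num.sqrt (A * B).
Proof.
move=> xA vB.
have A0 : 0 <= A by apply: le_trans xA; apply: sumr_ge0 => k _; exact: sqr_ge0.
have B0 : 0 <= B by apply: le_trans vB; apply: sumr_ge0 => k _; exact: sqr_ge0.
apply: amgm_opt => // l l0.
apply: (@le_trans _ _ (2 * \sum_(k <- r) normc (x k) * normc (v k))).
  rewrite ler_wpM2l//; apply: le_trans (normc_sum _ _ _) _.
  by apply: ler_sum => k _; rewrite normcM.
apply: (@le_trans _ _ (l * \sum_(k <- r) normc (x k) ^+ 2 + l^-1 * \sum_(k <- r) normc (v k) ^+ 2)).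
  rewrite !mulr_sumr -big_split/=; apply: ler_sum => k _; rewrite -subr_ge0.
  have -> : l * normc (x k) ^+ 2 + l^-1 * normc (v k) ^+ 2 - 2 * (normc (x k) * normc (v k)) =
    l^-1 * (l * normc (x k) - normc (v k)) ^+ 2 by field; rewrite gt_eqF.
  by rewrite mulr_ge0 ?sqr_ge0// invr_ge0 ltW.
by apply: lerD; rewrite ler_wpM2l ?invr_ge0 ?(ltW l0).
Qed.

(** Truncation of the Taylor series where its H^2 tail is at most e. Cauchy-Schwarz on the tail sees
    f only through V, so one p serves every f. *)
Lemma hardy_approx (a : nat -> C) (X e : R) : disk_coefs a -> L2 (ps_on_disk a) ->
  (forall N, \sum_(n < N) normc (a n) ^+ 2 <= X) -> 0 < e ->
  exists p : {poly C}, forall f (V : R), L2 f ->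
    (forall J, \sum_(j < J) normc (hcoef f j) ^+ 2 <= V) ->
    normc (L2dot (ps_on_disk a - poly_on_disk p) f) <= e * Num.sqrt V.
Proof.
move=> ha La aX e0.
pose s N := \sum_(n < N) normc (a n) ^+ 2.
have ub : has_ubound (range s) by exists X => _ [N _ <-]; exact: aX.
have lim : s @ \oo --> sup (range s).
  apply: nondecreasing_cvgn => // m n mn.
  rewrite /s -!(big_mkord xpredT (fun n => normc (a n) ^+ 2)).
  by rewrite [leRHS](@big_cat_nat _ _ _ m)//= lerDl; apply: sumr_ge0 => k _; exact: sqr_ge0.
have [N hN] : exists N, sup (range s) - s N <= e ^+ 2.
  move/cvgrPdist_le : lim => /(_ (e ^+ 2)); rewrite exprn_gt0// => /(_ isT)[N _ hN].
  by exists N; exact: le_trans (ler_norm _) (hN N (leqnn N)).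
exists (\poly_(k < N) a k) => f V Lf fV.
have bp := bergman_poly (\poly_(k < N) a k); have Lp := bergman_L2 bp.
rewrite -normcJ L2dotJ//; last exact: L2B.
rewrite L2dotBr// L2dot_poly_r// normcB.
apply: (cvgC_norm (@L2dot_limit _ f a Lf ha La)); exists N => // M /= NM.
rewrite -!(big_mkord xpredT (fun k => (a k)^* * L2dot f (mono k))).
rewrite [X in _ - X](@big_cat_nat _ _ _ N)//= opprD addrA subrr sub0r normcN.
have V0 : 0 <= V by apply: le_trans (fV 0%N); rewrite big_ord0.
rewrite -(ger0_norm (ltW e0)) -sqrtr_sqr -sqrtrM ?sqr_ge0//.
apply: finite_CauchySchwarz.
  under eq_bigr do rewrite normcJ.
  apply: le_trans hN; rewrite lerBrDl.
  have -> : s N + \sum_(N <= k < M) normc (a k) ^+ 2 = s M.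
    by rewrite /s -!(big_mkord xpredT (fun n => normc (a n) ^+ 2)) [RHS](@big_cat_nat _ _ _ N).
  by apply: ub_le_sup => //; exists M.
apply: le_trans (fV M).
rewrite -(big_mkord xpredT (fun n => normc (hcoef f n) ^+ 2)).
rewrite [leRHS](@big_cat_nat _ _ _ N)//= lerDr; apply: sumr_ge0 => k _; exact: sqr_ge0.
Qed.

Variable b : E.
Hypothesis bA : analytic_on_disk b.
Hypothesis b1 : forall z, normc z < 1 -> normc (b z) <= 1.

Let L2b h : L2 h -> L2 (fun z => b z * h z). Proof. exact: L2_bmul. Qed.

Lemma L2_conj_bmul h : L2 h -> L2 (fun z => (b z)^* * h z).
Proof.
by apply: (L2_mull (B := 1) (cmeasJ (cmeas_multiplier bA))) => z z1; rewrite normcJ b1.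
Qed.

Lemma toeplitzP h : L2 h -> bergman (toeplitz b h) /\
  forall q, bergman q -> L2dot (toeplitz b h) q = L2dot (fun z => b z * h z) q.
Proof. by move=> Lh; exact: (bergman_projP (L2b Lh)). Qed.

Lemma toeplitz_conjP h : L2 h -> bergman (toeplitz (fun z => (b z)^*) h) /\
  forall q, bergman q -> L2dot (toeplitz (fun z => (b z)^*) h) q = L2dot h (fun z => b z * q z).
Proof.
move=> Lh; have [h1 h2] := bergman_projP (L2_conj_bmul Lh); split => // q bq.
rewrite [LHS]h2//; by apply: eq_cint => p _; rewrite conjcM; ring.
Qed.

(* The two Toeplitz operators are kept abstract below: only these properties
   matter, and unfolding bergman_proj during unification is prohibitive. *)
Variables Tb Ts : E -> E.
Hypothesis TbP : forall h, L2 h -> bergman (Tb h) /\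
  forall q, bergman q -> L2dot (Tb h) q = L2dot (fun z => b z * h z) q.
Hypothesis TsP : forall h, L2 h -> bergman (Ts h) /\
  forall q, bergman q -> L2dot (Ts h) q = L2dot h (fun z => b z * q z).

Lemma toeplitz_bergman h : L2 h -> bergman (Tb h). Proof. by move=> /TbP[]. Qed.

Lemma toeplitz_conj_bergman h : L2 h -> bergman (Ts h). Proof. by move=> /TsP[]. Qed.

Lemma toeplitz_dot h q : L2 h -> bergman q ->
  L2dot (Tb h) q = L2dot (fun z => b z * h z) q.
Proof. by move=> /TbP[_]; exact. Qed.

Lemma toeplitz_conj_dot h q : L2 h -> bergman q ->
  L2dot (Ts h) q = L2dot h (fun z => b z * q z).
Proof. by move=> /TsP[_]; exact. Qed.

Lemma hcoef_toeplitz_conj h n : L2 h -> hcoef (Ts h) n = hbcoef b h n.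
Proof. move=> Lh; exact: (toeplitz_conj_dot Lh (bergman_mono n)). Qed.

Lemma toeplitz_adjoint f g : bergman f -> bergman g ->
  L2dot (Tb f) g = L2dot f (Ts g).
Proof.
move=> bf bg; have Lf := bergman_L2 bf; have Lg := bergman_L2 bg.
have bTs := toeplitz_conj_bergman Lg; have LTs := bergman_L2 bTs.
rewrite toeplitz_dot// -(L2dotJ LTs)// toeplitz_conj_dot// L2dotJ//.
exact: L2b.
Qed.

Definition defect f := f - Tb (Ts f).

Lemma bergman_defect f : bergman f -> bergman (defect f).
Proof.
move=> bf; apply: (bergmanB bf); apply: toeplitz_bergman.
exact: (bergman_L2 (toeplitz_conj_bergman (bergman_L2 bf))).
Qed.

Lemma defect_dot f g : bergman f -> bergman g ->
  L2dot (defect f) g = L2dot f g - L2dot (Ts f) (Ts g).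
Proof.
move=> bf bg; have Lf := bergman_L2 bf; have Lg := bergman_L2 bg.
have bTs := toeplitz_conj_bergman Lf; have LTs := bergman_L2 bTs.
rewrite /defect L2dotBl//; last exact/bergman_L2/toeplitz_bergman.
by rewrite toeplitz_adjoint.
Qed.

(** b z^n vanishes to order n at 0, hence is orthogonal to polynomials of lower degree; this is why
    the adjoint of T_b preserves polynomials. *)
Lemma hbcoef_poly (p : {poly C}) n : (size p <= n)%N -> hbcoef b (poly_on_disk p) n = 0.
Proof.
move=> pn; have [be [hbe _ bE]] := bmono_expansion bA.
have Lb k : L2 (bmono b k) by exact: L2_bmono.
have -> : p = \poly_(k < size p) p`_k.
  by apply/polyP => k; rewrite coef_poly; case: ltnP => // h; rewrite nth_default.
rewrite /hbcoef -L2dotJ//; last exact/bergman_L2/bergman_poly.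
rewrite L2dot_poly_r// big1 ?conjc0 => [|i _].
  exact: conjc0.
rewrite bE L2dot_coef; [|exact: disk_coefs_shift|by rewrite -bE].
by rewrite /shift (leq_trans (ltn_ord i) pn) mul0r mulr0.
Qed.

Lemma toeplitz_conj_poly (p : {poly C}) : exists r : {poly C}, Ts (poly_on_disk p) = poly_on_disk r.
Proof.
have bq := bergman_poly p; have Lq := bergman_L2 bq.
have bT := toeplitz_conj_bergman Lq; have := bT => /bergmanP[a [ha aE La]].
exists (\poly_(k < size p) a k); rewrite aE -ps_poly; congr ps_on_disk; apply/funext => k.
rewrite coef_poly; case: ltnP => // pk.
have := hcoef_toeplitz_conj k Lq; rewrite hbcoef_poly// /hcoef aE L2dot_coef -?aE// => /eqP.
rewrite mulf_eq0 => /orP[/eqP //|].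
have h1 : k.+1%:R != 0 :> R by rewrite pnatr_eq0.
by rewrite (inj_eq (@complexI R) _ 0) mulf_eq0 invr_eq0 (negbTE h1) (negbTE c_neq0).
Qed.

(** If r is the polynomial T_b^* p, then D p and p - b r have the same inner products with A^2. By
    [hardy_contraction] the coefficients of p - b r are square summable, so it is approximable in
    H^2. *)
Lemma defect_poly_approx (p : {poly C}) (e : R) : 0 < e ->
  exists p' : {poly C}, forall f (V : R), bergman f ->
    (forall J, \sum_(j < J) normc (hcoef f j) ^+ 2 <= V) ->
    normc (L2dot (defect (poly_on_disk p) - poly_on_disk p') f) <= e * Num.sqrt V.
Proof.
move=> e0; have bq := bergman_poly p; have Lq := bergman_L2 bq.
have [r rE] := toeplitz_conj_poly p.
have Lr := bergman_L2 (bergman_poly r).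
have rP : r = \poly_(k < size r) r`_k.
  by apply/polyP => k; rewrite coef_poly; case: ltnP => // h; rewrite nth_default.
have := bergman_bmul_poly bA b1 (size r) (fun k => r`_k); rewrite -rP => bF.
have /bergmanP[ga [hga gaE LF]] := bF.
have rP' : (fun z => b z * poly_on_disk (\poly_(k < size r) r`_k) z) = ps_on_disk ga.
  by rewrite -rP.
have hard K := hardy_contraction bA b1 K hga rP'.
pose a k := p`_k + -1 * ga k.
have ha : disk_coefs a.
  by apply: disk_coefsD; [exact: disk_coefs_poly|exact: disk_coefsZ].
have aE : ps_on_disk a = poly_on_disk p - (fun z => b z * poly_on_disk r z).
  rewrite ps_on_diskD ?ps_on_diskZ//; [|exact: disk_coefs_poly|exact: disk_coefsZ].
  by rewrite ps_poly scaleN1r -gaE.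
have La : L2 (ps_on_disk a) by rewrite aE; exact: L2B.
have aX N : \sum_(n < N) normc (a n) ^+ 2 <=
    2 * (\sum_(n < size p) normc p`_n ^+ 2 + \sum_(n < size r) normc r`_n ^+ 2).
  apply: (@le_trans _ _ (2 * (\sum_(n < N) normc p`_n ^+ 2 + \sum_(n < N) normc (ga n) ^+ 2))).
    rewrite -big_split mulr_sumr; apply: ler_sum => n _.
    apply: le_trans (sqr_sum_le _ _); rewrite lerXn2r ?nnegrE ?addr_ge0 ?normc_ge0//.
    by rewrite /a mulN1r -[normc (ga n)]normcN normcD.
  rewrite ler_wpM2l// lerD//.
  rewrite -!(big_mkord xpredT (fun n => normc p`_n ^+ 2)).
  have [Np|pN] := leqP N (size p).
    by rewrite [leRHS](@big_cat_nat _ _ _ N)//= lerDl; apply: sumr_ge0 => k _; exact: sqr_ge0.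
  rewrite (@big_cat_nat _ _ _ (size p))//=; last exact: ltnW.
  rewrite gerDl big_nat_cond big1// => k /andP[/andP[pk _] _].
  by rewrite nth_default// normc0 expr0n.
have [p' hp'] := hardy_approx ha La aX e0; exists p' => f V bf fV.
have Lf := bergman_L2 bf; have Lp' := bergman_L2 (bergman_poly p').
have := hp' f V Lf fV; rewrite L2dotBl// => h.
rewrite L2dotBl//; last exact/bergman_L2/bergman_defect.
suff -> : L2dot (defect (poly_on_disk p)) f = L2dot (ps_on_disk a) f by [].
rewrite aE [RHS](L2dotBl Lq (L2b Lr) Lf).
rewrite /defect rE L2dotBl//; last exact/bergman_L2/toeplitz_bergman.
by rewrite toeplitz_dot.
Qed.

Lemma hardy_le_defect : normc (b 0) < 1 -> exists kappa : R, 0 < kappa /\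
  forall f J, bergman f ->
  \sum_(j < J) normc (hcoef f j) ^+ 2 <= kappa * (nrm2 f - nrm2 (Ts f)).
Proof.
move=> /(hardy_norm_le_defect bA b1)[k [k0 hk]]; exists k; split => // f J bf.
have Lf := bergman_L2 bf; apply: (hk f (Ts f) J Lf (toeplitz_conj_bergman Lf)) => n.
exact: hcoef_toeplitz_conj.
Qed.

(* Equality at the origin in the maximum principle: sum |b_k|^2 <= 1 leaves
   only the constant term. *)
Lemma defect_unimodular f : normc (b 0) = 1 -> bergman f -> nrm2 (Ts f) = nrm2 f.
Proof.
move=> b01 bf; have Lf := bergman_L2 bf.
have [be [hbe be0 bE]] := bmono_expansion bA.
have bmE : (fun z => b z * poly_on_disk (\poly_(k < 1) (fun=> 1) k) z) = ps_on_disk be.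
  have -> : \poly_(k < 1) (fun=> 1 : C) k = 'X^0.
    by apply/polyP => -[|k]; rewrite coef_poly expr0 coefC.
  have -> : be = shift 0 be by apply/funext => k; rewrite /shift subn0.
  by rewrite -bE.
have hard K := hardy_contraction bA b1 K hbe bmE.
have be_eq0 k : be k.+1 = 0.
  have := hard k.+2; rewrite !big_ord1 normc1 expr1n big_ord_recl/= be0 b01 expr1n.
  rewrite gerDl => h; apply/eqP; rewrite -normc_eq0 -sqrf_eq0 eq_le sqr_ge0 andbT.
  apply: le_trans h; rewrite (bigD1 (@ord_max k))//= lerDl.
  by apply: sumr_ge0 => i _; exact: sqr_ge0.
have bc z : normc z < 1 -> b z = b 0.
  move=> z1; have := congr1 (fun F => F z) (bE 0%N).
  rewrite /bmono monoE// expr0 mulr1 => ->; rewrite -be0.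
  apply: disk_coefs_psE => //.
  apply: (@cvgC_le _ _ _ (fun N => if (N == 0)%N then normc (be 0%N) else 0)).
    case => [|N]; first by rewrite /psum big_ord0 sub0r normcN.
    rewrite /psum big_ord_recl big1 ?addr0 ?expr0 ?mulr1 /shift/= ?subn0.
      by rewrite subrr normc0.
    by move=> i _; rewrite /shift /bump /= subn0 be_eq0 mul0r.
  by apply: cvg_near_cst; exists 1%N => // -[].
have Tdot q : bergman q -> L2dot (Ts f) q = (b 0)^* * L2dot f q.
  move=> bq; have Lq := bergman_L2 bq; rewrite toeplitz_conj_dot// -L2dotZr//.
  by apply: eq_L2dot => // z z1; rewrite bc.
have bT := toeplitz_conj_bergman Lf; have LT := bergman_L2 bT.
apply: complexI; rewrite -!L2dot_nrm2 Tdot// -L2dotJ// Tdot// conjcM conjc_invol.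
rewrite L2dotJ// mulrA [_^* * _]mulrC mulcJ b01 expr1n.
exact: mul1r.
Qed.

End ToeplitzDefect.

(** * Positive operators and range spaces *)

Section PositiveOperators.
Context {R : realType}.
Local Notation C := R[i].
Local Notation E := (C -> C^o).
Local Notation c := (@disk_area R 1).
Implicit Types (f g h q x y u : E).

Let c0 : 0 < c. Proof. exact: disk_area_gt0. Qed.
Let c_neq0 : c != 0. Proof. by rewrite gt_eqF. Qed.

Lemma Re_conj_real_mul (t : R) (z : C) : Re (t%:C^* * z) = t * Re z.
Proof. by rewrite !ReImE; ring. Qed.

Lemma Re_conj_i_mul (z : C) : Re ('i%C^* * z) = Im z.
Proof. by rewrite !ReImE; ring. Qed.

(** Riesz-Fischer for A^2, the converse of [weighted_sum_le]. *)
Lemma bergman_of_hcoef (v : nat -> C) (V : R) :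
  (forall N, \sum_(j < N) j.+1%:R * normc (v j) ^+ 2 <= V) ->
  exists u, bergman u /\ forall j, hcoef u j = v j.
Proof.
move=> vV; pose a k := (k.+1%:R / c)%:C * v k.
have nz k : k.+1%:R != 0 :> R by rewrite pnatr_eq0.
have aB N : bergman_sum a N <= V / c ^+ 2.
  rewrite ler_pdivlMr ?exprn_gt0//; apply: le_trans (vV N).
  rewrite /bergman_sum mulr_suml; apply: ler_sum => k _.
  rewrite /a normcM normcC exprMn real_normK ?num_real// expr_div_n.
  have := weight_cancel2 (normc (v k) ^+ 2) (nz k) c_neq0.
  by rewrite mulrC expr2 -!mulrA => ->.
have ba := bergman_bounded_sum aB; exists (ps_on_disk a); split => // j.
rewrite /hcoef L2dot_coef; [|exact: bergman_disk_coefs aB|exact: bergman_L2].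
by rewrite /a mulrAC -rmorphM ratio_cancel// mul1r.
Qed.

Lemma hcoefB f g n : L2 f -> L2 g -> hcoef (f - g) n = hcoef f n - hcoef g n.
Proof. by move=> Lf Lg; exact: (L2dotBl Lf Lg (L2_mono n)). Qed.

(** Coefficients converge one by one, and the finite weighted sums pass to the limit with the rate
    [e] intact. *)
Lemma bergman_complete (h : nat -> E) (e : nat -> R) :
  (forall n, bergman (h n)) -> (forall n k, (n <= k)%N -> nrm2 (h n - h k) <= e n) ->
  e @ \oo --> (0 : R) -> exists u, bergman u /\ forall n, nrm2 (h n - u) <= e n.
Proof.
move=> bh he e0; have Lh n := bergman_L2 (bh n).
pose v n j := hcoef (h n) j.
have vd n k N : (n <= k)%N ->
    \sum_(j < N) j.+1%:R * normc (v n j - v k j) ^+ 2 <= c * e n.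
  move=> nk; apply: (@le_trans _ _ (weighted_sum (h n - h k) N)).
    apply: ler_sum => j _; have -> // : v n j - v k j = L2dot (h n - h k) (mono j).
    exact/esym/(hcoefB j (Lh n) (Lh k)).
  apply: le_trans (weighted_sum_le N (bergmanB (bh n) (bh k))) _.
  by rewrite ler_pM2l// he.
have /choice[l hl] : forall j, exists l, cvgC (v^~ j) l.
  move=> j; have [|l hl] := @complex_limit _ (v^~ j) (fun n => Num.sqrt (c * e n)).
    move=> n k nk; rewrite -[leLHS]ger0_norm ?normc_ge0// -sqrtr_sqr ler_wsqrtr//.
    rewrite normcB; apply: le_trans (vd n k j.+1 nk); rewrite big_ord_recr/=.
    rewrite -[leLHS]add0r lerD//.
      by apply: sumr_ge0 => i _; rewrite mulr_ge0// sqr_ge0.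
    by rewrite ler_peMl ?sqr_ge0// ler1n.
  exists l; apply: (cvgC_le hl); apply: cvg0_Ml.
  rewrite -sqrtr0; exact: (cvg_comp _ _ (cvg0_Ml c e0) (@sqrt_continuous R 0)).
have vl n N : \sum_(j < N) j.+1%:R * normc (v n j - l j) ^+ 2 <= c * e n.
  have lim : (fun k => \sum_(j < N) j.+1%:R * normc (v n j - v k j) ^+ 2) @ \oo -->
      \sum_(j < N) j.+1%:R * normc (v n j - l j) ^+ 2.
    apply: cvg_real_sum => j; apply: cvgM; first exact: cvg_cst.
    apply: cvg_realX; apply: cvgC_normc.
    rewrite -(mulN1r (l j)).
    by apply: eq_cvgC (cvgCD (cvgC_cst (v n j)) (cvgCZ (-1) (hl j))) => k; rewrite mulN1r.
  by apply: (cvgr_to_le lim); exists n => // k /= nk; exact: vd.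
(* The estimate just proved bounds the differences v 0 j - l j, so the element with these
   coefficients is built first and the limit is h 0 - x. *)
have [x [bx hx]] := @bergman_of_hcoef (fun j => v 0%N j - l j) _ (vl 0%N).
have Lx := bergman_L2 bx.
pose u := h 0%N - x; have bu : bergman u by exact: (bergmanB (bh 0%N) bx).
have hu j : hcoef u j = l j.
  by rewrite (hcoefB j (Lh 0%N) Lx) hx /v opprB addrCA subrr addr0.
exists u; split => // n; rewrite -(ler_pM2l c0).
apply: (nrm2_le_weighted (bergmanB (bh n) bu)) => N; apply: le_trans (vl n N).
apply: ler_sum => j _; have -> // : L2dot (h n - u) (mono j) = v n j - l j.
by rewrite -hu; exact: (hcoefB j (Lh n) (bergman_L2 bu)).
Qed.

Variable S : E -> E.
Hypothesis S_positive : positive_operator bergman L2dot S.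

Lemma pos_op_bergman f : bergman f -> bergman (S f).
Proof. by case: S_positive => [[h _ _] _]; exact: h. Qed.

Lemma pos_op_L2 f : bergman f -> L2 (S f).
Proof. by move=> /pos_op_bergman/bergman_L2. Qed.

Lemma pos_op_linear a f g : bergman f -> bergman g -> S (a *: f + g) = a *: S f + S g.
Proof. by case: S_positive => [[_ h _] _]; exact: h. Qed.

Lemma pos_opD f g : bergman f -> bergman g -> S (f + g) = S f + S g.
Proof. by move=> bf bg; rewrite -[f in LHS]scale1r pos_op_linear// scale1r. Qed.

Lemma pos_op0 : S 0 = 0.
Proof.
have := pos_opD bergman0 bergman0; rewrite addr0 => h.
by apply: (@addrI _ (S 0)); rewrite addr0 -h.
Qed.

Lemma pos_opZ a f : bergman f -> S (a *: f) = a *: S f.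
Proof. by move=> bf; rewrite -[a *: f]addr0 pos_op_linear ?pos_op0 ?addr0//; exact: bergman0. Qed.

Lemma pos_opB f g : bergman f -> bergman g -> S (f - g) = S f - S g.
Proof.
by move=> bf bg; rewrite -scaleN1r (pos_opD bf (bergmanZ (-1) bg)) (pos_opZ (-1) bg) scaleN1r.
Qed.

(** Polarization: <S h, h> is real for h = f + a g, and the cases a = 1 and a = i give the imaginary
    and the real part of the identity. *)
Lemma pos_op_adjoint f g : bergman f -> bergman g -> L2dot (S f) g = L2dot f (S g).
Proof.
move=> bf bg; have Lf := bergman_L2 bf; have Lg := bergman_L2 bg.
have LSf := pos_op_L2 bf; have LSg := pos_op_L2 bg.
have im h : bergman h -> Im (L2dot (S h) h) = 0.
  by case: S_positive => _ hh /hh; rewrite lecE => /andP[/eqP].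
have ex a : Im (a^* * L2dot (S f) g + a * L2dot (S g) f) = 0.
  have bag := bergmanZ a bg; have Lag := bergman_L2 bag.
  have LSag := L2Z a LSg.
  have := im _ (bergmanD bf bag); rewrite (pos_opD bf bag) (pos_opZ a bg).
  rewrite (L2dotDl LSf LSag (L2D Lf Lag)) (L2dotDr Lf Lag LSf) (L2dotDr Lf Lag LSag).
  rewrite (L2dotZl a LSg Lf) (L2dotZl a LSg Lag) !(L2dotZr a Lg)//.
  rewrite mulrA mulcJ !(cImD _ _) (im _ bf).
  have -> : Im ((normc a ^+ 2)%:C * L2dot (S g) g) = 0.
    by rewrite cImM cImC mul0r addr0 (im _ bg) mulr0.
  by rewrite addr0 add0r.
rewrite -(L2dotJ LSg Lf).
have h1 := ex 1; have h2 := ex 'i%C.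
have c1 : (1 : C)^* = 1 by exact: conjc1.
move: h1 h2; rewrite c1 !mul1r.
move: (L2dot (S f) g) (L2dot (S g) f) => z w.
rewrite !ReImE => h1 h2; apply: complex_ext; rewrite !ReImE; first by move: h2; lra.
by move: h1; lra.
Qed.

(* An almost closest point S q to g in the range of S. *)
Lemma approx_range_proj g (d : R) : bergman g -> 0 < d -> exists q, bergman q /\
  forall f, bergman f -> normc (L2dot (g - S q) (S f)) ^+ 2 <= d * nrm2 (S f).
Proof.
move=> bg d0; have Lg := bergman_L2 bg.
pose I := [set nrm2 (g - S q) | q in bergman].
have iI : has_inf I.
  split; first by exists (nrm2 (g - S 0)); exists 0 => //; exact: bergman0.
  by exists 0 => _ [q _ <-]; exact: nrm2_ge0.
have [_ [q bq <-] qlt] := inf_adherent d0 iI.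
exists q; split => // f bf; have bSq := pos_op_bergman bq; have LSq := bergman_L2 bSq.
have LSf := pos_op_L2 bf.
set e := g - S q; have Le : L2 e by exact: L2B.
set s := L2dot e (S f); set W := nrm2 (S f).
(* Moving q along s f cannot lower the squared distance by more than d; t = 1 / W turns this into
   |s|^2 <= d W. *)
have key (t : R) : 2 * t * normc s ^+ 2 - t ^+ 2 * normc s ^+ 2 * W <= d.
  have bq' := bergmanD bq (bergmanZ (t%:C * s) bf).
  have : inf I <= nrm2 (g - S (q + (t%:C * s) *: f)).
    by apply: ge_inf; [exact: iI.2|exists (q + (t%:C * s) *: f)].
  rewrite (pos_opD bq (bergmanZ _ bf)) (pos_opZ _ bf) opprD addrA -/e.
  rewrite (nrm2B Le (L2Z _ LSf)) (nrm2Z _ LSf) (L2dotZr _ LSf Le) -/s -/W.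
  rewrite conjcM mulrAC -mulrA mulcJ normcM normcC exprMn real_normK ?num_real//.
  rewrite (_ : Re _ = t * normc s ^+ 2); last by rewrite !ReImE; ring.
  by move: qlt; rewrite -/e; lra.
have W0 : 0 <= W by exact: nrm2_ge0.
have [Wz|Wnz] := eqVneq W 0.
  by rewrite Wz mulr0; have := L2_CauchySchwarz Le LSf; rewrite -/s -/W Wz mulr0.
have Wp : 0 < W by rewrite lt_neqAle eq_sym Wnz.
have := key W^-1; rewrite (_ : _ - _ = normc s ^+ 2 / W); last by field.
by rewrite ler_pdivrMr.
Qed.

Lemma discriminant_le (W rho eta : R) : 0 <= W -> 0 <= eta ->
  (forall t, 0 <= t ^+ 2 * W + 2 * t * rho + eta) -> rho ^+ 2 <= W * eta.
Proof.
move=> W0 eta0 h; have [Wz|Wnz] := eqVneq W 0; last first.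
  have Wp : 0 < W by rewrite lt_neqAle eq_sym Wnz.
  have := h (- rho / W); rewrite (_ : _ + _ + _ = eta - rho ^+ 2 / W); last by field.
  by rewrite subr_ge0 ler_pdivrMr// mulrC.
rewrite Wz mul0r; have [->|rnz] := eqVneq rho 0; first by rewrite expr0n.
have := h (- (eta + 1) / (2 * rho)); rewrite Wz mulr0 add0r.
rewrite (_ : 2 * _ * rho = - (eta + 1)); last by field.
lra.
Qed.

(* Douglas' lemma, by minimizing ||S f||^2 - 2 Re <y, f>: along a minimizing
   sequence S f converges, and its limit is the preimage of y. *)
Lemma range_majorization y (K : R) : 0 <= K -> bergman y ->
  (forall f, bergman f -> normc (L2dot y f) <= K * Num.sqrt (nrm2 (S f))) ->
  exists u, [/\ bergman u, S u = y & nrm2 u <= K ^+ 2].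
Proof.
move=> K0 by_ yK; have Ly := bergman_L2 by_.
pose F f := nrm2 (S f) - 2 * Re (L2dot y f).
have sq f : Num.sqrt (nrm2 (S f)) ^+ 2 = nrm2 (S f) by rewrite sqr_sqrtr// nrm2_ge0.
have ReyK f : bergman f -> Re (L2dot y f) <= K * Num.sqrt (nrm2 (S f)).
  move=> bf; apply: le_trans (yK f bf).
  by apply: le_trans (ler_norm _) _; exact: normc_Re.
pose I := [set F f | f in bergman].
have iI : has_inf I.
  split; first by exists (F 0); exists 0 => //; exact: bergman0.
  exists (- K ^+ 2) => _ [f bf <-]; rewrite /F -sq.
  have := ReyK f bf; have := sqr_ge0 (Num.sqrt (nrm2 (S f)) - K).
  by rewrite sqrrB; lra.
pose m := inf I.
have mF f : bergman f -> m <= F f by move=> bf; apply: ge_inf; [exact: iI.2|exists f].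
have /choice[h hh] : forall n : nat, exists f, bergman f /\ F f < m + n.+1%:R^-1.
  move=> n; have n0 : 0 < n.+1%:R^-1 :> R by rewrite invr_gt0.
  by have [_ [f bf <-] lt] := inf_adherent n0 iI; exists f.
have bh n : bergman (h n) by exact: (hh n).1.
have Lh n := bergman_L2 (bh n); have LSh n := pos_op_L2 (bh n).
pose e n : R := 4 * n.+1%:R^-1.
have e0 : e @ \oo --> (0 : R) by apply: cvg0_Ml; exact: cvg_harmonic.
(* By the parallelogram law the left-hand side is 2 F (h n) + 2 F (h k) - 4 F (midpoint), and F is
   at least m at the midpoint. *)
have cauchy n k : (n <= k)%N -> nrm2 (S (h n) - S (h k)) <= e n.
  move=> nk; have bnk := bergmanD (bh n) (bh k).
  have := mF _ (bergmanZ (2^-1)%:C bnk).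
  rewrite /F (pos_opZ _ bnk) (nrm2Z _ (pos_op_L2 bnk)) (pos_opD (bh n) (bh k)).
  rewrite (L2dotZr _ (L2D (Lh n) (Lh k)) Ly) (L2dotDr (Lh n) (Lh k) Ly).
  rewrite (nrm2D (LSh n) (LSh k)) (nrm2B (LSh n) (LSh k)) normcC ger0_norm ?invr_ge0//.
  rewrite Re_conj_real_mul cReD.
  have := (hh n).2; have := (hh k).2; rewrite /F /e.
  have : k.+1%:R^-1 <= n.+1%:R^-1 :> R by rewrite lef_pV2 ?posrE// ler_nat ltnS.
  move: (nrm2 _) (nrm2 _) (Re (L2dot (S _) _)) (Re _) (Re _) => A B D X Y.
  move: k.+1%:R^-1 n.+1%:R^-1 => p p' h1 h2 h3.
  rewrite expr2; lra.
have [u [bu hu]] := bergman_complete (fun n => pos_op_bergman (bh n)) cauchy e0.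
have Lu := bergman_L2 bu.
have orthRe f : bergman f -> Re (L2dot u (S f)) = Re (L2dot y f).
  move=> bf; have Lf := bergman_L2 bf; have LSf := pos_op_L2 bf.
  set W := nrm2 (S f); have W0 : 0 <= W by exact: nrm2_ge0.
  pose rho n := Re (L2dot (S (h n)) (S f)) - Re (L2dot y f).
  (* F (h n + t f) >= m > F (h n) - 1 / (n + 1) for all real t: a quadratic in t is nonnegative,
     which bounds its discriminant. *)
  have rho_le n : rho n ^+ 2 <= W * n.+1%:R^-1.
    apply: discriminant_le => // t.
    have := mF _ (bergmanD (bh n) (bergmanZ t%:C bf)).
    rewrite /F (pos_opD (bh n) (bergmanZ _ bf)) (pos_opZ _ bf).
    rewrite (nrm2D (LSh n) (L2Z _ LSf)) (nrm2Z _ LSf) (L2dotZr _ LSf (LSh n)).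
    rewrite (L2dotDr (Lh n) (L2Z _ Lf) Ly) (L2dotZr _ Lf Ly) -/W normcC real_normK ?num_real//.
    have := (hh n).2; rewrite /F /rho.
    rewrite cReD !Re_conj_real_mul.
    move: (nrm2 _) (Re _) (Re _) (Re _) n.+1%:R^-1 => A Q P Y i h1 h2.
    rewrite (_ : _ + _ + i = (A + 2 * (t * P) + t ^+ 2 * W - 2 * (Y + t * Q))
      - (A - 2 * Y) + i); last by ring.
    by lra.
  apply/eqP; rewrite -subr_eq0 -sqrf_eq0 eq_le sqr_ge0 andbT.
  (* 10 = 2 + 8: X = rho n - Z, so X^2 <= 2 (rho n)^2 + 2 Z^2, with bounds W / (n + 1) and 4 W / (n
     + 1) on the two squares. *)
  have lim : (fun n => 10 * W * n.+1%:R^-1) @ \oo --> (0 : R).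
    by apply: cvg0_Ml; exact: cvg_harmonic.
  apply: (cvgr_to_ge lim); apply: nearW => n.
  have := L2_CauchySchwarz (L2B (LSh n) Lu) LSf; rewrite (L2dotBl (LSh n) Lu LSf) -/W => cs.
  have {}cs : normc (L2dot (S (h n)) (S f) - L2dot u (S f)) ^+ 2 <= e n * W.
    by apply: le_trans cs _; rewrite ler_wpM2r.
  set X := Re (L2dot u (S f)) - Re (L2dot y f).
  set Z := Re (L2dot (S (h n)) (S f) - L2dot u (S f)).
  have Z2 : Z ^+ 2 <= 4 * n.+1%:R^-1 * W.
    apply: le_trans cs; rewrite normc_sqr lerDl; exact: sqr_ge0.
  have XE : X = rho n - Z by rewrite /X /rho /Z cReD cReN; ring.
  rewrite XE; have := rho_le n; move: Z2; clear XE; move: (rho n) Z (n.+1%:R^-1) => p z i.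
  rewrite (_ : 4 * i * W = 4 * (W * i)); last by ring.
  rewrite -[10 * W * i]mulrA => h1 h2; have := sqr_ge0 (p + z).
  rewrite (_ : (p - z) ^+ 2 = 2 * p ^+ 2 + 2 * z ^+ 2 - (p + z) ^+ 2); last by ring.
  by lra.
have orth f : bergman f -> L2dot u (S f) = L2dot y f.
  move=> bf; apply: complex_ext; first exact: orthRe.
  have := orthRe _ (bergmanZ 'i%C bf); rewrite (pos_opZ _ bf) (L2dotZr _ (pos_op_L2 bf) Lu).
  by rewrite (L2dotZr _ (bergman_L2 bf) Ly) !Re_conj_i_mul.
have Su : S u = y.
  apply/eqP; rewrite -subr_eq0; apply/eqP.
  apply: (bergman_orth_eq0 (bergmanB (pos_op_bergman bu) by_)) => f bf.
  by rewrite (L2dotBl (pos_op_L2 bu) Ly (bergman_L2 bf)) pos_op_adjoint// orth// subrr.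
exists u; split => //.
(* By orthogonality ||u||^2 <= e n + 2 Re <y, h n> - ||S (h n)||^2, and 2 K w - w^2 <= K^2 for w =
   ||S (h n)||. *)
have lim : (fun n => K ^+ 2 + e n) @ \oo --> K ^+ 2 + 0 by apply: cvgD => //; exact: cvg_cst.
rewrite addr0 in lim; apply: (cvgr_to_ge lim); apply: nearW => n.
have := hu n; rewrite (nrm2B (LSh n) Lu) -(L2dotJ Lu (LSh n)) cReJ orthRe//.
have := ReyK _ (bh n); have := sqr_ge0 (Num.sqrt (nrm2 (S (h n))) - K).
rewrite sqrrB sq; lra.
Qed.

End PositiveOperators.

Section RangeNorm.
Context {R : realType}.
Local Notation E := (R[i] -> R[i]^o).

(* The lift, when it exists, is the preimage of least norm; when it does not,
   its junk value 0 has norm 0. *)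
Lemma range_norm_le (S : E -> E) (u : E) :
  (forall f g, bergman f -> bergman g -> S (f - g) = S f - S g) -> bergman u ->
  range_norm bergman L2dot S (S u) <= Num.sqrt (nrm2 u).
Proof.
move=> SB bu; rewrite /range_norm /range_dot L2dot_nrm2 cReC ler_wsqrtr//.
rewrite /range_lift; case: xgetP => [f _ [[bf forth] Sf]|_]; last first.
  rewrite (_ : nrm2 0 = 0) ?nrm2_ge0//.
  apply: complexI; rewrite -L2dot_nrm2 -(scale0r (0 : E)).
  by rewrite (L2dotZl _ (@L2_0 R) (L2Z _ (@L2_0 R))) mul0r.
have Lf := bergman_L2 bf; have Lu := bergman_L2 bu.
have buf := bergmanB bu bf.
have : L2dot f (u - f) = 0 by apply: forth; split => //; rewrite SB// Sf subrr.
move=> h; rewrite -[u in leRHS](subrK f) addrC (nrm2D Lf (bergman_L2 buf)) h.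
by rewrite mulr0 addr0 lerDl nrm2_ge0.
Qed.

End RangeNorm.

Section Density.
Context {R : realType}.
Local Notation C := R[i].
Local Notation E := (C -> C^o).
Implicit Types (f g q u : E).

Lemma poly_dense_bergman q (e : R) : bergman q -> 0 < e ->
  exists p : {poly C}, nrm2 (q - poly_on_disk p) <= e.
Proof.
move=> /bergmanP[a [ha -> La]] e0.
have /cvgrPdist_le/(_ e e0)[N _ hN] := @partial_sum_cvg _ a ha La.
exists (\poly_(k < N) a k).
by have := hN N (leqnn N); rewrite sub0r normrN; apply: le_trans; exact: ler_norm.
Qed.

End Density.

(** * Density of polynomials in the range of the root *)

Section RootRange.
Context {R : realType}.
Local Notation C := R[i].
Local Notation E := (C -> C^o).
Implicit Types (f g q u : E).

Variable b : E.
Hypothesis bA : analytic_on_disk b.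
Hypothesis b1 : forall z, normc z < 1 -> normc (b z) <= 1.
Variables Tb Ts : E -> E.
Hypothesis TbP : forall h, L2 h -> bergman (Tb h) /\
  forall q, bergman q -> L2dot (Tb h) q = L2dot (fun z => b z * h z) q.
Hypothesis TsP : forall h, L2 h -> bergman (Ts h) /\
  forall q, bergman q -> L2dot (Ts h) q = L2dot h (fun z => b z * q z).
Variable S : E -> E.
Hypothesis S_positive : positive_operator bergman L2dot S.
Hypothesis S_sqr : forall f, bergman f -> S (S f) = f - Tb (Ts f).

Lemma nrm2_root f : bergman f -> nrm2 (S f) = nrm2 f - nrm2 (Ts f).
Proof.
move=> bf; apply: complexI; rewrite rmorphB /= -!L2dot_nrm2.
rewrite -(pos_op_adjoint S_positive (pos_op_bergman S_positive bf) bf) S_sqr//.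
exact: (defect_dot bA b1 TbP TsP bf bf).
Qed.

(** S g - p' splits into S (g - S q), S S (q - p) and D p - p'. Against f, each is at most d ||S f||
    with d = e / 6, so Douglas' lemma applies to the sum with constant e / 2. *)
Lemma root_range_dense f (e : R) : range_space bergman S f -> 0 < e ->
  exists p : {poly C}, range_space bergman S (poly_on_disk p) /\
    range_norm bergman L2dot S (f - poly_on_disk p) < e.
Proof.
move=> [g bg <-] e0; have bSg := pos_op_bergman S_positive bg; have LSg := bergman_L2 bSg.
have SBh f1 f2 : bergman f1 -> bergman f2 -> S (f1 - f2) = S f1 - S f2.
  exact: (pos_opB S_positive).
(* A preimage u of S g - p also puts p = S (g - u) into the range, and its norm bounds the
   distance. *)
suff [p [u [bu Su nu]]] : exists (p : {poly C}) u,
    [/\ bergman u, S u = S g - poly_on_disk p & nrm2 u <= (e / 2) ^+ 2].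
  exists p; split.
    exists (g - u); first exact: bergmanB.
    by rewrite SBh// Su opprB addrC subrK.
  rewrite -Su; apply: le_lt_trans (range_norm_le SBh bu) _.
  have e2 : 0 <= e / 2 by rewrite divr_ge0// ltW.
  apply: (@le_lt_trans _ _ (e / 2)); last by lra.
  by rewrite -(ger0_norm e2) -sqrtr_sqr ler_wsqrtr.
have b01 : normc (b 0) <= 1 by apply: b1; rewrite normc0.
have [b0lt|] := ltP (normc (b 0)) 1; last first.
  move=> b0ge; have b0E : normc (b 0) = 1 by apply/eqP; rewrite eq_le b01.
  have Sg0 : S g = 0.
    apply: (bergman_nrm2_eq0 bSg).
    by rewrite nrm2_root// (defect_unimodular bA b1 TsP b0E bg) subrr.
  exists 0, 0; split; first exact: bergman0.
    have p0 : poly_on_disk (0 : {poly C}) = 0.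
      by rewrite -[X in poly_on_disk X](subrr 0) poly_on_diskB subrr.
    by rewrite (pos_op0 S_positive) Sg0 p0 subrr.
  rewrite (_ : nrm2 0 = 0) ?sqr_ge0//.
  apply: complexI; rewrite -L2dot_nrm2 -(scale0r (0 : E)).
  by rewrite (L2dotZl _ (@L2_0 R) (L2Z _ (@L2_0 R))) mul0r.
pose d := e / 6; have d0 : 0 < d by rewrite divr_gt0.
have sqd : Num.sqrt (d ^+ 2) = d by rewrite sqrtr_sqr gtr0_norm.
have [kappa [kappa0 hkappa]] := hardy_le_defect bA b1 TsP b0lt.
have [q [bq hq]] := approx_range_proj S_positive bg (exprn_gt0 2 d0).
have [p hp] := poly_dense_bergman bq (exprn_gt0 2 d0).
have bp := bergman_poly p; have bqp := bergmanB bq bp.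
have k0 : 0 < Num.sqrt kappa by rewrite sqrtr_gt0.
(* Here V will be kappa ||S f||^2, so precision d / sqrt kappa in H^2 becomes d ||S f||. *)
have [p' hp'] := defect_poly_approx bA b1 TbP TsP p (divr_gt0 d0 k0).
exists p'.
have bp' := bergman_poly p'; have bSq := pos_op_bergman S_positive bq.
have bdp := bergman_defect TbP TsP bp.
have by_ := bergmanB bSg bp'.
have e20 : 0 <= e / 2 by rewrite divr_ge0// ltW.
have [|u [bu Su nu]] := @range_majorization R S S_positive _ (e / 2) e20 by_; last first.
  by exists u.
- clear f; move=> f bf; set w := Num.sqrt (nrm2 (S f)).
  have w0 : 0 <= w by exact: sqrtr_ge0.
  have Lf := bergman_L2 bf; have bSf := pos_op_bergman S_positive bf.
  have bgq := bergmanB bg bSq; have bSgq := pos_op_bergman S_positive bgq.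
  have bSqp := pos_op_bergman S_positive bqp; have bSSqp := pos_op_bergman S_positive bSqp.
  have h1 : normc (L2dot (S (g - S q)) f) <= d * w.
    rewrite (pos_op_adjoint S_positive bgq bf) -[leLHS]ger0_norm ?normc_ge0// -sqrtr_sqr.
    rewrite -sqd /w -sqrtrM ?sqr_ge0//; apply: ler_wsqrtr; exact: hq.
  have h2 : normc (L2dot (S (S (q - poly_on_disk p))) f) <= d * w.
    rewrite (pos_op_adjoint S_positive bSqp bf).
    apply: le_trans (L2dot_le (bergman_L2 bSqp) (bergman_L2 bSf)) _.
    rewrite ler_wpM2r// -sqd ler_wsqrtr//; apply: le_trans hp.
    by rewrite nrm2_root// gerBl nrm2_ge0.
  have h3 : normc (L2dot (poly_on_disk p - Tb (Ts (poly_on_disk p)) - poly_on_disk p') f) <= d * w.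
    have := hp' f (kappa * nrm2 (S f)) bf; rewrite sqrtrM ?(ltW kappa0)// -/w mulrA.
    by rewrite divfK ?gt_eqF//; apply => J; rewrite nrm2_root//; exact: hkappa.
  have -> : S g - poly_on_disk p' = S (g - S q) + S (S (q - poly_on_disk p))
      + (poly_on_disk p - Tb (Ts (poly_on_disk p)) - poly_on_disk p').
    have bSp := pos_op_bergman S_positive bp.
    rewrite -(S_sqr bp) (SBh _ _ bg bSq) (SBh _ _ bq bp) (SBh _ _ bSq bSp).
    by rewrite !addrA !subrK.
  rewrite (L2dotDl (L2D (bergman_L2 bSgq) (bergman_L2 bSSqp)) (bergman_L2 (bergmanB bdp bp')) Lf).
  rewrite (L2dotDl (bergman_L2 bSgq) (bergman_L2 bSSqp) Lf).
  apply: le_trans (normcD _ _) _.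
  have := normcD (L2dot (S (g - S q)) f) (L2dot (S (S (q - poly_on_disk p))) f).
  have : e / 2 * w = 3 * (d * w) by rewrite /d; field.
  move: h1 h2 h3; lra.
Qed.

End RootRange.

Theorem theorem2p2 (R : realType) (b : R[i] -> R[i]^o)
    (hb : Hinf b) (hb1 : Hinf_norm b <= 1) :
  forall f : R[i] -> R[i]^o, sub_bergman b f ->
  forall e : R, 0 < e ->
  exists p : {poly R[i]},
    sub_bergman b (poly_on_disk p) /\
    sub_bergman_norm b (f - poly_on_disk p) < e.
Proof.
have [bA [M hM]] := hb.
have b1 z : normc z < 1 -> normc (b z) <= 1.
  move=> z1; apply: le_trans hb1; apply: ub_le_sup; last by exists z.
  by exists M => _ [w w1 <-]; exact: hM.
rewrite /sub_bergman /sub_bergman_norm /defect_sqrt.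
move: (toeplitz b) (toeplitz (fun z => (b z)^*)) (toeplitzP bA b1) (toeplitz_conjP bA b1).
move=> Tb Ts TbP TsP f.
(* If no positive root existed, op_sqrt would be its default idfun, A(b) would
   be A^2, and the theorem would still hold: existence of the root is not
   needed. *)
rewrite /op_sqrt; case: xgetP => [S _ [S_positive S_sqr]|_] fr e e0.
  exact: (root_range_dense bA b1 TbP TsP S_positive S_sqr).
case: fr => g bg <-.
have e2 : 0 < e / 2 by rewrite divr_gt0.
have [p hp] := poly_dense_bergman bg (exprn_gt0 2 e2).
have bp := bergman_poly p; exists p; split; first by exists (poly_on_disk p).
apply: le_lt_trans (range_norm_le (S := idfun) _ (bergmanB bg bp)) _ => //.
apply: (@le_lt_trans _ _ (e / 2)); last by lra.
by rewrite -(ger0_norm (ltW e2)) -sqrtr_sqr ler_wsqrtr.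
Qed.
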